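(* The Noether decomposition of a cubic birational map of $\mathbb{P}^2(\mathbb{C})$ involves at most eight times the Cremona involution $\sigma$; that is, every birational map $f$ of $\mathbb{P}^2(\mathbb{C})$ of degree $3$ can be written $f=A_0\sigma A_1\sigma\cdots\sigma A_k$ with $k\le 8$ and $A_0,\ldots,A_k\in\mathrm{PGL}_3(\mathbb{C})$.
   Context: $\sigma=(x_1x_2:x_0x_2:x_0x_1)$ is the standard Cremona involution of $\mathbb{P}^2(\mathbb{C})$. A Noether decomposition of a birational map of $\mathbb{P}^2(\mathbb{C})$ is an expression of it as a composition of $\sigma$ and elements of $\mathrm{PGL}_3(\mathbb{C})=\mathrm{Aut}(\mathbb{P}^2(\mathbb{C}))$. The degree of $f=(f_0:f_1:f_2)$, with the $f_i$ homogeneous of the same degree and without common factor, is the degree of the $f_i$. *)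

(* Defs.v *)
From mathcomp Require Import all_boot all_order all_algebra.
From mathcomp Require Import reals.
From mathcomp Require Import complex mpoly.

Set Implicit Arguments.
Unset Strict Implicit.
Unset Printing Implicit Defensive.

Import GRing.Theory.
Local Open Scope ring_scope.

(* A rational map P^2 -> P^2 over K is represented by a triple                *)
(* (f_0 : f_1 : f_2) of homogeneous polynomials of the same degree in         *)
(* x_0, x_1, x_2, not all zero. Common factors are allowed, and two triples   *)
(* define the same rational map iff they satisfy ratmap_eq below.             *)
Section PlaneRationalMaps.
Context {K : fieldType}.

Definition triple := 3.-tuple {mpoly K[3]}.

Definition homog_triple (d : nat) (f : triple) : Prop :=
  forall i, tnth f i \is d.-homog.

Definition rational_map (f : triple) : Prop :=
  (exists d, homog_triple d f) /\ (exists i, tnth f i != 0).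

Definition ratmap_eq (f g : triple) : Prop :=
  [/\ rational_map f, rational_map g &
      forall i j, tnth f i * tnth g j = tnth f j * tnth g i].

(* f after g, by substitution. The composite of rational maps is undefined    *)
(* when the result is the zero triple, which ratmap_eq then rejects.          *)
Definition ratmap_comp (f g : triple) : triple :=
  [tuple tnth f i \mPo g | i < 3].

Definition ratmap_id : triple := [tuple 'X_i | i < 3].

Definition birational (f : triple) : Prop :=
  rational_map f /\
  exists g : triple, [/\ rational_map g,
    ratmap_eq (ratmap_comp f g) ratmap_id & ratmap_eq (ratmap_comp g f) ratmap_id].

(* A unit of K[x_0, x_1, x_2] is a nonzero constant.                          *)
Definition no_common_factor (f : triple) : Prop :=
  forall h : {mpoly K[3]},
    (forall i, exists q, tnth f i = q * h) -> h \is a GRing.unit.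

Definition has_degree (f : triple) (d : nat) : Prop :=
  exists g : triple, [/\ ratmap_eq f g, homog_triple d g & no_common_factor g].

(* The map x |-> A x on column vectors of homogeneous coordinates. For A      *)
(* invertible it is the automorphism given by the class of A in PGL_3(K).     *)
Definition lin_map (A : 'M[K]_3) : triple :=
  [tuple \sum_(j < 3) A i j *: 'X_j | i < 3].

Definition cremona : triple :=
  let x0 : {mpoly K[3]} := 'X_(inord 0) in
  let x1 : {mpoly K[3]} := 'X_(inord 1) in
  let x2 : {mpoly K[3]} := 'X_(inord 2) in
  [tuple x1 * x2; x0 * x2; x0 * x1].

(* A_0 \o sigma \o A_1 \o sigma \o ... \o sigma \o A_k.                       *)
Fixpoint noether_word (A : nat -> 'M[K]_3) (k : nat) : triple :=
  if k is k'.+1 then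
    ratmap_comp (ratmap_comp (noether_word A k') cremona) (lin_map (A k))
  else lin_map (A 0%N).

End PlaneRationalMaps.
Arguments triple K : clear implicits.

(* Main.v *)
(* The inverse g of f parametrizes the cubics of the net of f by the lines of the target. A smooth
   cubic has no rational parametrization, and a general member of the net is smooth outside its finitely
   many base points, so the net has a common double point b. Then f sends the lines through b to lines,
   and birationality forces the latter to form a pencil: in suitable coordinates f is
   x |-> (a x + b) / (c x + d) over K(y), with a, b, c, d of degrees 2, 3, 1, 2 in y and
   determinant D of degree 4.

   A continued fraction a_0 + e_1 / (a_1 + ... + e_k / (a_k + x)) with deg a_i <= 1 and e_i quadratic
   with distinct roots is a word with k letters sigma. Multiplying the matrix of f by six auxiliary
   linear forms l_1, ..., l_6 and running the expansion backwards, e_8 = l_1 l_2, each of the four next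
   steps removes one root of D together with one auxiliary root, and three more steps remove the rest.
   All the e_i have distinct roots as soon as the auxiliary roots are generic, whatever the
   multiplicities of the roots of D. *)

Require Import Defs.
From HB Require Import structures.
From mathcomp Require Import all_boot all_order all_algebra.
From mathcomp Require Import reals.
From mathcomp Require Import complex mpoly.
From mathcomp Require Import ring polyXY.

Set Implicit Arguments.
Unset Strict Implicit.
Unset Printing Implicit Defensive.
Import Order.TTheory GRing.Theory Num.Theory.
Local Open Scope ring_scope.
Local Open Scope complex_scope.

(** * Continued fractions *)

(** The obstacle is that x |-> e / x, with e the square of a linear form in y, is not equivalent to
    σ under linear maps (its base points are not three distinct points of the plane), while D may
    have multiple roots. The expansion therefore keeps an invariant: two columns with entries of
    degrees at most 3, 2 and 3, 2, whose determinant has degree 5. Dividing out a root p of D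
    together with an auxiliary root l replaces p by l in the determinant. When all five roots are
    chosen ones, they are simple, and the points (x, P(x) : Q(x)) above them are automatically in
    general position: a section of too small a degree through all five would force the determinant
    to be zero. This accounts for 8 = 1 + 4 + 3.

    On the geometric side no function field is used: generic statements are polynomial identities
    outside finitely many parameters. The singularity of a general member is obtained by pairing its
    gradient with the derivative of the parametrization across the pencil, and the pencil of image
    lines by a degree count of Lüroth type: y is a rational function of the point where its image
    line meets a fixed line. *)

Section SizeBounds.
Variable R : nzRingType.
Implicit Types p q : {poly R}.

Lemma size_mul_le m n p q :
  (size p <= m.+1)%N -> (size q <= n)%N -> (size (p * q)%R <= m + n)%N.
Proof.
move=> sp sq; apply: leq_trans (size_polyMleq _ _) _.
by rewrite -subn1 leq_subLR add1n -addSn leq_add.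
Qed.

Lemma size_mul_le1 m n p q :
  (size p <= m.+1)%N -> (size q <= n.+1)%N -> (size (p * q)%R <= (m + n).+1)%N.
Proof.
move=> sp sq; apply: leq_trans (size_polyMleq _ _) _.
by rewrite -subn1 leq_subLR add1n -addnS -addSn leq_add.
Qed.

Lemma size_subr_le n p q :
  (size p <= n)%N -> (size q <= n)%N -> (size (p - q)%R <= n)%N.
Proof.
by move=> sp sq; apply: leq_trans (size_polyD _ _) _; rewrite geq_max size_polyN sp.
Qed.

Lemma size_addr_le n p q :
  (size p <= n)%N -> (size q <= n)%N -> (size (p + q)%R <= n)%N.
Proof. by move=> sp sq; apply: leq_trans (size_polyD _ _) _; rewrite geq_max sp. Qed.

End SizeBounds.

Section ContinuedFractions.
Variable K : fieldType.
Implicit Types P Q e f : {poly K}.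

(* The columns (P, Q), (P', Q') are, up to a common factor, the last two convergents of
   a_0 + e_1 / (a_1 + ... + e_n / (a_n + x)), so that x is sent to (P x + P') / (Q x + Q'). Since
   the e_i have two distinct roots, each x |-> e_i / x is the Cremona involution up to linear maps. *)
Inductive cfrac : nat -> {poly K} -> {poly K} -> {poly K} -> {poly K} -> Prop :=
| cfrac0 (k q : K) (al : {poly K}) :
    k != 0 -> q != 0 -> (size al <= 2)%N -> cfrac 0 k%:P 0 al q%:P
| cfracS n P Q P' Q' (a : {poly K}) (r1 r2 k : K) :
    (size a <= 2)%N -> r1 != r2 -> k != 0 -> cfrac n P Q P' Q' ->
    cfrac n.+1 P' Q' (a * P' + k%:P * ('X - r1%:P) * ('X - r2%:P) * P)
                  (a * Q' + k%:P * ('X - r1%:P) * ('X - r2%:P) * Q)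
| cfracZ n h P Q P' Q' :
    h != 0 -> cfrac n (h * P) (h * Q) (h * P') (h * Q') -> cfrac n P Q P' Q'.

Lemma interp2 (x y u v : K) : x != y ->
  exists2 a : {poly K}, (size a <= 2)%N & a.[x] = u /\ a.[y] = v.
Proof.
move=> nxy; have d0 : y - x != 0 by rewrite subr_eq0 eq_sym.
exists (u%:P + ((v - u) / (y - x)) *: ('X - x%:P)).
  apply: leq_trans (size_polyD _ _) _; rewrite geq_max.
  rewrite (leq_trans (size_polyC_leq1 _)) //=.
  by apply: leq_trans (size_scale_leq _ _) _; rewrite size_XsubC.
rewrite !hornerE; split; first by ring.
by field.
Qed.

Lemma root_factor (p : {poly K}) x n : (size p <= n.+1)%N -> p.[x] = 0 ->
  exists2 q : {poly K}, (size q <= n)%N & p = q * ('X - x%:P).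
Proof.
move=> sp /eqP/factor_theorem [q pE]; exists q => //.
case: (eqVneq q 0) => [->|q0]; first by rewrite size_poly0.
by move: sp; rewrite pE size_Mmonic ?monicXsubC // size_XsubC addn2.
Qed.

(** * Five simple roots: general position and the last three steps *)

Section LastThree.
Variables (P Q P' Q' : {poly K}) (Ls : seq K) (k : K).
Hypotheses (sP : (size P <= 4)%N) (sQ : (size Q <= 3)%N).
Hypotheses (sP' : (size P' <= 4)%N) (sQ' : (size Q' <= 3)%N).
Hypotheses (k0 : k != 0) (uLs : uniq Ls) (sLs : size Ls = 5).
Hypothesis detE : P * Q' - Q * P' = k%:P * \prod_(x <- Ls) ('X - x%:P).
Hypothesis QLs : forall x, x \in Ls -> Q.[x] != 0.

Lemma detLs x : x \in Ls -> P.[x] * Q'.[x] = Q.[x] * P'.[x].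
Proof.
move=> xL; apply/eqP; rewrite -subr_eq0 -!hornerM -hornerN -hornerD detE hornerM.
rewrite (_ : (\prod_(_ <- _) _).[x] = 0) ?mulr0 //.
by apply/eqP; rewrite -[_ == _]/(root _ _) root_prod_XsubC.
Qed.

Lemma det_neq0 : P * Q' - Q * P' != 0.
Proof.
rewrite detE mulf_neq0 ?polyC_eq0 //.
by rewrite monic_neq0 // monic_prod_XsubC.
Qed.

(** [e * Q - f * P] has degree at most 4 and five roots, so it is zero. The two columns are
    proportional at these roots, so [e * Q' - f * P'] is zero as well, and the nonzero determinant
    leaves only the trivial solution. *)
Lemma no_conic e f : (size e <= 3)%N -> (size f <= 2)%N ->
  (forall x, x \in Ls -> e.[x] * Q.[x] = f.[x] * P.[x]) -> e = 0 /\ f = 0.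
Proof.
move=> se sf h.
have z1 : e * Q - f * P = 0.
  apply: (@roots_geq_poly_eq0 _ _ Ls) => //.
    by apply/allP=> x xL; rewrite rootE !hornerE h // subrr.
  by rewrite sLs; apply: size_subr_le; [exact: (@size_mul_le _ 2 3)|exact: (@size_mul_le1 _ 1 3)].
have z2 : e * Q' - f * P' = 0.
  apply: (@roots_geq_poly_eq0 _ _ Ls) => //.
    apply/allP=> x xL; rewrite rootE !hornerE; apply/eqP.
    apply: (mulfI (QLs xL)); rewrite mulr0.
    transitivity ((e.[x] * Q.[x]) * Q'.[x] - f.[x] * (Q.[x] * P'.[x])); first by ring.
    by rewrite h // -detLs //; ring.
  by rewrite sLs; apply: size_subr_le; [exact: (@size_mul_le _ 2 3)|exact: (@size_mul_le1 _ 1 3)].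
split; apply/eqP; apply: contraNT det_neq0 => n0; apply/eqP; apply: (mulfI n0).
  transitivity (P * (e * Q' - f * P') - P' * (e * Q - f * P)); first by ring.
  by rewrite z1 z2; ring.
transitivity (Q * (e * Q' - f * P') - Q' * (e * Q - f * P)); first by ring.
by rewrite z1 z2; ring.
Qed.

End LastThree.

(** The three numerators have the roots {l1, l2}, {l3, l4} and {l, l5}. [al] interpolates P / Q at
    the first pair; because it fails to do so at l3 and l4, the next partial quotient can be
    interpolated there. *)
Lemma cfrac_last_core P Q P' Q' l1 l2 l3 l4 l5 (k : K) (l : K) (al : {poly K}) :
  let Ls := [:: l1; l2; l3; l4; l5] in
  (size P <= 4)%N -> (size Q <= 3)%N -> (size P' <= 4)%N -> (size Q' <= 3)%N ->
  k != 0 -> uniq Ls -> 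
  P * Q' - Q * P' = k%:P * \prod_(x <- Ls) ('X - x%:P) ->
  (forall x, x \in Ls -> Q.[x] != 0) -> l \notin Ls -> (size al <= 2)%N ->
  P.[l1] = al.[l1] * Q.[l1] -> P.[l2] = al.[l2] * Q.[l2] ->
  P.[l3] != al.[l3] * Q.[l3] -> P.[l4] != al.[l4] * Q.[l4] ->
  cfrac 3 P Q (('X - l%:P) * P') (('X - l%:P) * Q').
Proof.
move=> Ls sP sQ sP' sQ' k0 uL detE QL lL sal a1 a2 a3 a4.
have [m1 m2 m3 m4 m5] : [/\ l1 \in Ls, l2 \in Ls, l3 \in Ls, l4 \in Ls & l5 \in Ls].
  by rewrite !inE !eqxx ?orbT.
have inL x : (x \in Ls) = (x \in [:: l1; l2; l3; l4]) || (x == l5).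
  by rewrite /Ls !inE !orbA.
have n12 : l1 != l2 by apply/eqP=> h; move: uL; rewrite /Ls h /= !inE eqxx.
have n34 : l3 != l4 by apply/eqP=> h; move: uL; rewrite /Ls h /= !inE eqxx /= ?orbT /= ?andbF.
have [n31 n32] : l3 != l1 /\ l3 != l2.
  by split; apply/eqP=> h; move: uL; rewrite /Ls h /= !inE eqxx /= ?orbT /= ?andbF.
have [n41 n42] : l4 != l1 /\ l4 != l2.
  by split; apply/eqP=> h; move: uL; rewrite /Ls h /= !inE eqxx /= ?orbT /= ?andbF.
(* The convergents are (1, 0), (al, 1), (P1, a), (P, Q) and ('X - l) (P', Q'); each new one passes
   through two more of the points (x, P(x) : Q(x)). *)
have noc := no_conic sP sQ sP' sQ' k0 uL erefl detE QL.
pose e12 : {poly K} := ('X - l1%:P) * ('X - l2%:P).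
have e12E x : e12.[x] = (x - l1) * (x - l2) by rewrite !hornerE.
have e12n x : x != l1 -> x != l2 -> e12.[x] != 0.
  by move=> h1 h2; rewrite e12E mulf_neq0 // subr_eq0.
have se12 : (size e12 <= 3)%N.
  by apply: (@size_mul_le1 _ 1 1); rewrite size_XsubC.
(* The condition P1 / a = P / Q at l3 and l4 reads a (P - al Q) = e12 Q, which prescribes two values
   of the linear polynomial [a]. *)
have [a sa [av3 av4]] := interp2 (e12.[l3] * Q.[l3] / (P.[l3] - al.[l3] * Q.[l3]))
   (e12.[l4] * Q.[l4] / (P.[l4] - al.[l4] * Q.[l4])) n34.
pose P1 := a * al + e12.
have sP1 : (size P1 <= 3)%N by apply: size_addr_le => //; apply: (@size_mul_le1 _ 1 1).
have w1at x : x \in [:: l1; l2; l3; l4] -> P1.[x] * Q.[x] = a.[x] * P.[x].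
  rewrite /P1 !inE => /or4P [] /eqP->; rewrite hornerD hornerM.
  - by rewrite e12E subrr a1; ring.
  - by rewrite e12E subrr a2; ring.
  - have h : P.[l3] - al.[l3] * Q.[l3] != 0 by rewrite subr_eq0.
    by rewrite av3; field.
  have h : P.[l4] - al.[l4] * Q.[l4] != 0 by rewrite subr_eq0.
  by rewrite av4; field.
have w1at5 : P1.[l5] * Q.[l5] != a.[l5] * P.[l5].
  apply/eqP=> h5.
  case: (noc P1 a) => // [x|P10 a0].
    by rewrite inL => /orP [/w1at//|/eqP->].
  by have := e12n _ n31 n32; move: P10; rewrite /P1 a0 mul0r add0r => ->; rewrite horner0 eqxx.
have [b1 sb1 b1E] : exists2 b : {poly K}, (size b <= 3)%N & P - al * Q = b * ('X - l1%:P).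
  apply: root_factor; last by rewrite !hornerE a1 subrr.
  by apply: size_subr_le => //; apply: (@size_mul_le _ 1 3).
have b1l2 : b1.[l2] = 0.
  have h : (P - al * Q).[l2] = 0 by rewrite !hornerE a2 subrr.
  move: h; rewrite b1E !hornerE => /eqP; rewrite mulf_eq0 => /orP [/eqP//|].
  by rewrite subr_eq0 eq_sym (negPf n12).
have [b sb bE] := root_factor sb1 b1l2.
have PE : P = al * Q + b * e12.
  apply/eqP; rewrite -subr_eq0; apply/eqP.
  transitivity (P - al * Q - b * e12); first by ring.
  by rewrite b1E bE /e12; ring.
pose rho := Q - b * a.
have srho : (size rho <= 3)%N.
  by apply: size_subr_le => //; apply: (@size_mul_le1 _ 1 1).
have PE2 : P = b * P1 + rho * al by rewrite /P1 /rho {1}PE; ring.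
have QE2 : Q = b * a + rho by rewrite /rho; ring.
have P1E : P1 = a * al + e12 by [].
clearbody rho P1.
have rat x : x \in [:: l1; l2; l3; l4] -> P.[x] != al.[x] * Q.[x] -> rho.[x] = 0.
  move=> /w1at h nx; apply/eqP; apply: contraNT nx => r0.
  apply/eqP; apply: (mulfI r0).
  have hP := congr1 (horner^~ x) PE2; have hQ := congr1 (horner^~ x) QE2.
  move: hP hQ; rewrite /= !(hornerD, hornerM) => hP hQ.
  have hr : rho.[x] = Q.[x] - b.[x] * a.[x] by rewrite hQ; ring.
  rewrite {1}hr.
  transitivity (P.[x] * Q.[x] - b.[x] * (a.[x] * P.[x])); first by ring.
  rewrite -h.
  transitivity (Q.[x] * (P.[x] - b.[x] * P1.[x])); first by ring.
  by rewrite hP; ring.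
have [r1 sr1 r1E] := root_factor srho (rat l3 ltac:(by rewrite !inE eqxx !orbT) a3).
have r14 : r1.[l4] = 0.
  have := rat l4 ltac:(by rewrite !inE eqxx !orbT) a4.
  rewrite r1E !hornerE => /eqP; rewrite mulf_eq0 => /orP [/eqP//|].
  by rewrite subr_eq0 eq_sym (negPf n34).
have [r2 sr2 r2E] := root_factor sr1 r14.
have [k2 k2E] : exists k2, r2 = k2%:P by exists r2`_0; apply: size1_polyC.
have k20 : k2 != 0.
  apply: contraNneq w1at5 => k2z.
  have hP := congr1 (horner^~ l5) PE2; have hQ := congr1 (horner^~ l5) QE2.
  move: hP hQ; rewrite r1E r2E k2E k2z !mul0r !addr0 /= !hornerM => -> ->.
  by apply/eqP; ring.
(* At l5 the columns are proportional with ratio [mu]. The quotient (t, s) of (P', Q') - mu (P, Q)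
   by 'X - l5 has the same degree bounds as (P1, a) and passes through the same four points. *)
pose mu := Q'.[l5] / Q.[l5].
have q5 := QL _ m5.
have [s ss sE] : exists2 s : {poly K}, (size s <= 2)%N & Q' - mu *: Q = s * ('X - l5%:P).
  apply: root_factor; last by rewrite !hornerE /mu; field.
  by apply: size_subr_le => //; apply: leq_trans (size_scale_leq _ _) _.
have [t st tE] : exists2 t : {poly K}, (size t <= 3)%N & P' - mu *: P = t * ('X - l5%:P).
  apply: root_factor; last first.
    have := detLs detE m5; rewrite !hornerE /mu => h.
    apply: (mulfI q5); rewrite mulr0.
    transitivity (Q.[l5] * P'.[l5] - P.[l5] * Q'.[l5]); first by field.
    by rewrite h subrr.
  by apply: size_subr_le => //; apply: leq_trans (size_scale_leq _ _) _.
have tsat x : x \in [:: l1; l2; l3; l4] -> t.[x] * Q.[x] = s.[x] * P.[x].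
  move=> xl; have xL : x \in Ls.
    by rewrite inL xl.
  have nx5 : x - l5 != 0.
    rewrite subr_eq0; apply: contraTneq xl => ->.
    by move: (uL : uniq ([:: l1; l2; l3; l4] ++ [:: l5])); rewrite cat_uniq /= orbF => /and3P [].
  apply: (mulIf nx5).
  have hs := congr1 (horner^~ x) sE; have ht := congr1 (horner^~ x) tE.
  move: hs ht; rewrite /= !hornerE => hs ht.
  transitivity (Q.[x] * (t.[x] * (x - l5))); first by ring.
  rewrite -ht; transitivity (P.[x] * (s.[x] * (x - l5))); last by ring.
  by rewrite -hs !mulrBr -(detLs detE xL); ring.
(* This multiple of (P1, a) makes the difference pass through the fifth point too, so that
   [no_conic] kills it; the denominator is nonzero by [w1at5]. *)
pose k3 := (t.[l5] * Q.[l5] - s.[l5] * P.[l5]) / (P1.[l5] * Q.[l5] - a.[l5] * P.[l5]).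
have [tz sz] : t - k3 *: P1 = 0 /\ s - k3 *: a = 0.
  apply: noc.
  - by apply: size_subr_le => //; apply: leq_trans (size_scale_leq _ _) _.
  - by apply: size_subr_le => //; apply: leq_trans (size_scale_leq _ _) _.
  move=> x; rewrite inL => /orP [xl|].
    rewrite !hornerE.
    transitivity (t.[x] * Q.[x] - k3 * (P1.[x] * Q.[x])); first by ring.
    by rewrite tsat // w1at //; ring.
  move=> /eqP ->; rewrite !hornerE /k3.
  have h : P1.[l5] * Q.[l5] - a.[l5] * P.[l5] != 0 by rewrite subr_eq0.
  by field.
move/eqP: tz; rewrite subr_eq0 => /eqP tz; move/eqP: sz; rewrite subr_eq0 => /eqP sz.
have k30 : k3 != 0.
  apply: contraNneq (det_neq0 k0 detE) => k3z.
  have -> : P' = mu *: P by apply/eqP; rewrite -subr_eq0 tE tz k3z scale0r mul0r.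
  have -> : Q' = mu *: Q by apply/eqP; rewrite -subr_eq0 sE sz k3z scale0r mul0r.
  by rewrite -!scalerAr [Q * P]mulrC subrr.
have nl5 : l != l5 by apply: contraNneq lL => ->.
have c0 : cfrac 0 1%:P 0 al 1%:P by apply: cfrac0; rewrite ?oner_eq0.
have c1 := cfracS sa n12 (oner_neq0 K) c0.
have c2 := cfracS sb n34 k20 c1.
have smu : (size (mu *: ('X - l%:P))%R <= 2)%N.
  by apply: leq_trans (size_scale_leq _ _) _; rewrite size_XsubC.
have c3 := cfracS smu nl5 k30 c2.
have eP : b * (a * al + 1%:P * ('X - l1%:P) * ('X - l2%:P) * 1%:P) +
     k2%:P * ('X - l3%:P) * ('X - l4%:P) * al = P.
  by rewrite [RHS]PE2 r1E r2E k2E P1E /e12; ring.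
have eQ : b * (a * 1%:P + 1%:P * ('X - l1%:P) * ('X - l2%:P) * 0) +
     k2%:P * ('X - l3%:P) * ('X - l4%:P) * 1%:P = Q.
  by rewrite [RHS]QE2 r1E r2E k2E; ring.
move: c3; rewrite eP eQ.
have -> : a * al + 1%:P * ('X - l1%:P) * ('X - l2%:P) * 1%:P = P1 by rewrite P1E /e12; ring.
have -> : a * 1%:P + 1%:P * ('X - l1%:P) * ('X - l2%:P) * 0 = a by ring.
have -> : mu *: ('X - l%:P) * P + k3%:P * ('X - l%:P) * ('X - l5%:P) * P1 = ('X - l%:P) * P'.
  have -> : P' = mu *: P + t * ('X - l5%:P) by rewrite -tE; ring.
  by rewrite tz -!mul_polyC; ring.
have -> // : mu *: ('X - l%:P) * Q + k3%:P * ('X - l%:P) * ('X - l5%:P) * a = ('X - l%:P) * Q'.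
have -> : Q' = mu *: Q + s * ('X - l5%:P) by rewrite -sE; ring.
by rewrite sz -!mul_polyC; ring.
Qed.

(** Only the labelling of the roots is at stake: of the three points other than l1 and l2 at most
    one lies on the line [al] through those two, so two of them can serve as l3 and l4. *)
Lemma cfrac_last P Q P' Q' (Ls : seq K) (k : K) (l : K) :
  (size P <= 4)%N -> (size Q <= 3)%N -> (size P' <= 4)%N -> (size Q' <= 3)%N ->
  k != 0 -> uniq Ls -> size Ls = 5 ->
  P * Q' - Q * P' = k%:P * \prod_(x <- Ls) ('X - x%:P) ->
  (forall x, x \in Ls -> Q.[x] != 0) -> l \notin Ls ->
  cfrac 3 P Q (('X - l%:P) * P') (('X - l%:P) * Q').
Proof.
move=> sP sQ sP' sQ' k0 uL sL detE QL lL.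
have core L' (al : {poly K}) l1 l2 l3 l4 l5 : L' = [:: l1; l2; l3; l4; l5] -> perm_eq Ls L' ->
    (size al <= 2)%N ->
    P.[l1] = al.[l1] * Q.[l1] -> P.[l2] = al.[l2] * Q.[l2] ->
    P.[l3] != al.[l3] * Q.[l3] -> P.[l4] != al.[l4] * Q.[l4] ->
    cfrac 3 P Q (('X - l%:P) * P') (('X - l%:P) * Q').
  move=> -> pL sal h1 h2 h3 h4; apply: (cfrac_last_core (l5 := l5) (k := k)) h1 h2 h3 h4 => //.
  - by rewrite -(perm_uniq pL).
  - by rewrite detE (perm_big _ pL).
  - by move=> x; rewrite -(perm_mem pL); apply: QL.
  - by rewrite -(perm_mem pL).
case: Ls sL uL detE QL lL core => [|l1 [|l2 [|x [|y [|z []]]]]] // _ uL detE QL lL core.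
have n12 : l1 != l2 by apply/eqP=> h; move: uL; rewrite h /= !inE eqxx.
have [al sal [v1 v2]] := interp2 (P.[l1] / Q.[l1]) (P.[l2] / Q.[l2]) n12.
have h1 : P.[l1] = al.[l1] * Q.[l1] by rewrite v1 divfK // QL // inE eqxx.
have h2 : P.[l2] = al.[l2] * Q.[l2] by rewrite v2 divfK // QL // !inE eqxx orbT.
(* four of the points on a line together with the fifth contradict no_conic *)
have two p q r : perm_eq [:: x; y; z] [:: p; q; r] ->
    ~~ ((P.[p] == al.[p] * Q.[p]) && (P.[q] == al.[q] * Q.[q])).
  move=> pr; apply/negP=> /andP [/eqP hp /eqP hq].
  have se : (size (al * ('X - r%:P))%R <= 3)%N.
    by apply: (@size_mul_le1 _ 1 1) => //; rewrite size_XsubC.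
  have sf : (size ('X - r%:P)%R <= 2)%N by rewrite size_XsubC.
  have [] := no_conic sP sQ sP' sQ' k0 uL erefl detE QL se sf; last first.
    by move=> _ /eqP; rewrite polyXsubC_eq0.
  move=> w wL; rewrite !hornerE.
  have : w \in [:: l1, l2 & [:: p; q; r]].
    have := perm_mem pr w; rewrite !inE => <-.
    by move: wL; rewrite !inE.
  by rewrite !inE => /or4P [/eqP->|/eqP->|/eqP->|/orP [/eqP->|/eqP->]];
     rewrite ?h1 ?h2 ?hp ?hq; ring.
have pxzy : perm_eq [:: x; y; z] [:: x; z; y].
  by rewrite perm_cons -[[:: z; y]]/([:: z] ++ [:: y]) perm_sym perm_catC.
have pyzx : perm_eq [:: x; y; z] [:: y; z; x].
  by rewrite -[[:: x; y; z]]/([:: x] ++ [:: y; z]) perm_catC.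
have := two _ _ _ (perm_refl _); have := two _ _ _ pxzy; have := two _ _ _ pyzx.
rewrite !negb_and => t1 t2 t3.
case: (boolP (P.[x] == al.[x] * Q.[x])) t2 t3 => [_ /= nz ny|nx _ _].
  by apply: (core _ al l1 l2 y z x) => //; rewrite 2!perm_cons.
case/orP: t1 => [ny|nz]; first by apply: (core _ al l1 l2 x y z).
by apply: (core _ al l1 l2 x z y) => //; rewrite 2!perm_cons.
Qed.

(** * Exchanging the roots of the determinant for simple ones *)

Hypothesis Kinf : forall s : seq K, exists x, x \notin s.

Lemma nonroot_notin (p : {poly K}) (s : seq K) : p != 0 ->
  exists2 x, x \notin s & p.[x] != 0.
Proof.
elim: {p}(size p) {-2}p (leqnn (size p)) s => [|n IH] p sp s p0.
  by move: sp; rewrite leqn0 size_poly_eq0 (negPf p0).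
have [x xs] := Kinf s; case: (eqVneq p.[x] 0) => [px|]; last by exists x.
have [q sq qE] := root_factor sp px.
have q0 : q != 0 by apply: contraNneq p0 => q0; rewrite qE q0 mul0r.
have [y] := IH q sq (x :: s) q0; rewrite inE negb_or => /andP [nyx ys] qy.
by exists y => //; rewrite qE !hornerE mulf_neq0 // subr_eq0.
Qed.

(* One level of the fraction trades a (possibly multiple) root p of the determinant for a fresh simple
   root l; that is why l is arbitrary. *)
Lemma cfrac_peel (ps : seq K) : forall P Q P' Q' (Ls : seq K) (k l : K),
  (size P <= 4)%N -> (size Q <= 3)%N -> (size P' <= 4)%N -> (size Q' <= 3)%N ->
  k != 0 -> uniq Ls -> (size ps + size Ls)%N = 5 ->
  (forall x, x \in ps -> x \notin Ls) ->
  P * Q' - Q * P' = k%:P * (\prod_(x <- ps) ('X - x%:P) * \prod_(x <- Ls) ('X - x%:P)) ->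
  (forall x, x \in Ls -> Q.[x] != 0) ->
  (forall x, x \in ps -> (P.[x] != 0) || (Q.[x] != 0)) ->
  l \notin Ls -> l \notin ps -> Q.[l] != 0 ->
  cfrac (3 + size ps) P Q (('X - l%:P) * P') (('X - l%:P) * Q').
Proof.
elim: ps => [|p ps IH] P Q P' Q' Ls k l sP sQ sP' sQ' k0 uL szL dis detE QL PQ lL lps Ql.
  by rewrite addn0; apply: (cfrac_last sP sQ sP' sQ' k0 uL) => //; rewrite detE big_nil mul1r.
have pp : p \in p :: ps by rewrite inE eqxx.
have np : l != p by apply: contraNneq lps => ->; rewrite inE eqxx.
have detp : P.[p] * Q'.[p] = Q.[p] * P'.[p].
  apply/eqP; rewrite -subr_eq0 -!hornerM -hornerN -hornerD detE big_cons !hornerM hornerXsubC subrr.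
  by rewrite !mul0r mulr0.
have [mu muP muQ] : exists2 mu, P'.[p] = mu * P.[p] & Q'.[p] = mu * Q.[p].
  case/orP: (PQ p pp) => [n0|n0].
    exists (P'.[p] / P.[p]); first by rewrite divfK.
    by apply: (mulfI n0); rewrite detp; field.
  exists (Q'.[p] / Q.[p]); last by rewrite divfK.
  by apply: (mulfI n0); rewrite -detp; field.
(* The partial quotient must take this value at p for ('X - l) (P', Q') - a (P, Q) to be divisible
   by 'X - p. Its slope [kp] stays free; it is spent below on keeping D nonzero at l and on [Ls],
   and (C, D) nonzero at the remaining roots of [ps]. *)
pose a0 := (p - l) * mu.
have [C0 sC0 C0E] : exists2 C0 : {poly K}, (size C0 <= 4)%N & ('X - l%:P) * P' - a0 *: P = C0 * ('X - p%:P).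
  apply: root_factor; last by rewrite !hornerE muP /a0; ring.
  apply: size_subr_le; first by apply: (@size_mul_le _ 1 4); rewrite ?size_XsubC.
  by apply: leq_trans (size_scale_leq _ _) _; apply: leq_trans sP _.
have [D0 sD0 D0E] : exists2 D0 : {poly K}, (size D0 <= 3)%N & ('X - l%:P) * Q' - a0 *: Q = D0 * ('X - p%:P).
  apply: root_factor; last by rewrite !hornerE muQ /a0; ring.
  apply: size_subr_le; first by apply: (@size_mul_le _ 1 3); rewrite ?size_XsubC.
  by apply: leq_trans (size_scale_leq _ _) _; apply: leq_trans sQ _.
pose bad := [seq D0.[x] / Q.[x] | x <- l :: Ls] ++ [seq C0.[x] / P.[x] | x <- ps]
   ++ [seq D0.[x] / Q.[x] | x <- ps].
have [kp] := Kinf bad; rewrite !mem_cat 2!negb_or => /and3P [b1 b2 b3].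
have avoid (V W : {poly K}) x (s : seq K) :
    kp \notin [seq V.[x] / W.[x] | x <- s] -> x \in s -> W.[x] != 0 ->
    V.[x] - kp * W.[x] != 0.
  move=> kn xs w0; apply: contraNneq kn => /eqP; rewrite subr_eq0 => /eqP e.
  by apply/mapP; exists x => //; rewrite e mulfK.
pose C := C0 - kp *: P; pose D := D0 - kp *: Q.
pose a := a0%:P + kp *: ('X - p%:P).
have sa : (size a <= 2)%N.
  apply: size_addr_le; first by apply: leq_trans (size_polyC_leq1 _) _.
  by apply: leq_trans (size_scale_leq _ _) _; rewrite size_XsubC.
have sC : (size C <= 4)%N by apply: size_subr_le => //; apply: leq_trans (size_scale_leq _ _) _.
have sD : (size D <= 3)%N by apply: size_subr_le => //; apply: leq_trans (size_scale_leq _ _) _.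
have CE : ('X - l%:P) * P' = a * P + ('X - p%:P) * C.
  rewrite -[LHS](subrK (a0 *: P)) C0E /C /a -!mul_polyC; ring.
have DE : ('X - l%:P) * Q' = a * Q + ('X - p%:P) * D.
  rewrite -[LHS](subrK (a0 *: Q)) D0E /D /a -!mul_polyC; ring.
have DQ x : x \in l :: Ls -> Q.[x] != 0 -> D.[x] != 0.
  by move=> xs q0; rewrite /D !hornerE (avoid _ _ _ _ b1).
have Dl : D.[l] != 0 by apply: DQ; rewrite ?inE ?eqxx.
have D0n : D != 0 by apply: contraNneq Dl => ->; rewrite horner0.
(* The root l' of the next level is chosen now: this step has the numerator ('X - l') ('X - p), and
   the common factor 'X - l' that it leaves in the second column, already present in the first, is
   cancelled by [cfracZ]. *)
have [l'] := nonroot_notin ((l :: Ls) ++ p :: ps) D0n.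
rewrite mem_cat negb_or => /andP [l'L]; rewrite inE negb_or => /andP [nl'p l'ps] Dl'.
have := IH C D P Q (l :: Ls) (- k) l' sC sD sP sQ.
rewrite oppr_eq0 => /(_ k0) IH'.
have {IH'} IH' : cfrac (3 + size ps) C D (('X - l'%:P) * P) (('X - l'%:P) * Q).
  apply: IH' => //.
  - by rewrite /= lL.
  - by move: szL => /=; rewrite addnS.
  - move=> x xps; rewrite inE negb_or dis ?inE ?xps ?orbT // andbT.
    by apply: contraNneq lps => <-; rewrite inE xps orbT.
  - have xp0 : 'X - p%:P != 0 :> {poly K} by rewrite polyXsubC_eq0.
    apply: (mulfI xp0).
    transitivity ((a * P + ('X - p%:P) * C) * Q - (a * Q + ('X - p%:P) * D) * P); first by ring.
    rewrite -CE -DE big_cons.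
    transitivity (- (('X - l%:P) * (P * Q' - Q * P'))); first by ring.
    by rewrite detE big_cons rmorphN; ring.
  - move=> x xL; apply: DQ => //; move: xL; rewrite inE => /orP [/eqP->//|]; exact: QL.
  move=> x xps; have := PQ x; rewrite inE xps orbT => /(_ isT) /orP [n0|n0]; apply/orP; [left|right].
    by rewrite /C !hornerE (avoid _ _ _ _ b2).
  by rewrite /D !hornerE (avoid _ _ _ _ b3).
have := cfracS sa nl'p (oner_neq0 K) IH'.
have e (U V : {poly K}) : a * (('X - l'%:P) * U) + 1%:P * ('X - l'%:P) * ('X - p%:P) * V =
    ('X - l'%:P) * (a * U + ('X - p%:P) * V) by ring.
rewrite !e -CE -DE -addnS => /cfracZ; apply.
by rewrite polyXsubC_eq0.
Qed.

(** The innermost step, with the constant partial quotient [kp] and the numerator ('X - l1) ('X -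
    l2), is peeled off by hand. It turns the columns (a, c), (b, d) into (b, d) - kp (a, c) and ('X
    - l1) (a, c), which have the degrees and the determinant of degree 5 that [cfrac_peel]
    expects. *)
Lemma cfrac_cubic (a b c d : {poly K}) (ps : seq K) (k : K) :
  (size a <= 3)%N -> (size b <= 4)%N -> (size c <= 2)%N -> (size d <= 3)%N ->
  size ps = 4 -> k != 0 -> a * d - b * c = k%:P * \prod_(x <- ps) ('X - x%:P) ->
  (forall x, x \in ps -> ~ [/\ a.[x] = 0, b.[x] = 0, c.[x] = 0 & d.[x] = 0]) ->
  cfrac 8 a c b d.
Proof.
move=> sa sb sc sd sps k0 detE cop.
pose bad := [seq b.[x] / a.[x] | x <- ps] ++ [seq d.[x] / c.[x] | x <- ps].
have cd : (c != 0) || (d != 0).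
  rewrite -negb_and; apply/negP => /andP [/eqP c0 /eqP d0].
  have := monic_neq0 (monic_prod_XsubC ps predT id).
  have : k%:P * \prod_(x <- ps) ('X - x%:P) = 0 by rewrite -detE c0 d0 !mulr0 subrr.
  by move/eqP; rewrite mulf_eq0 polyC_eq0 (negPf k0) /= => /eqP->; rewrite eqxx.
have [kp [kbad v0]] : exists kp, kp \notin bad /\ d - kp *: c != 0.
  case: (eqVneq c 0) cd => [->|c0 _] /=.
    by move=> d0; have [kp kb] := Kinf bad; exists kp; rewrite scaler0 subr0.
  have [kp] := Kinf ((lead_coef d / lead_coef c) :: d`_(size c).-1 / lead_coef c :: bad).
  rewrite !inE !negb_or => /and3P [_ n1 n2]; exists kp; split => //.
  apply: contraNneq n1 => /eqP; rewrite subr_eq0 => /eqP ->.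
  by rewrite coefZ -[c`_ _]/(lead_coef c) mulfK // lead_coef_eq0.
move: kbad; rewrite mem_cat negb_or => /andP [b1 b2].
pose P := b - kp *: a; pose Q := d - kp *: c.
have avoid (V W : {poly K}) x : kp \notin [seq V.[x] / W.[x] | x <- ps] -> x \in ps ->
    (W.[x] != 0) || (V.[x] != 0) -> V.[x] - kp * W.[x] != 0.
  move=> kn xs /orP; case: (eqVneq W.[x] 0) => [-> [//|]|w0 _].
    by rewrite mulr0 subr0.
  apply: contraNneq kn => /eqP; rewrite subr_eq0 => /eqP e.
  by apply/mapP; exists x => //; rewrite e mulfK.
have [l1 l1ps Ql1] := nonroot_notin ps v0.
have [l2] := nonroot_notin (l1 :: ps) v0.
rewrite inE negb_or => /andP [n21 l2ps] Ql2.
have D7 : cfrac (3 + size ps) P Q (('X - l2%:P) * (('X - l1%:P) * a)) (('X - l2%:P) * (('X - l1%:P) * c)).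
  apply: (@cfrac_peel ps P Q _ _ [:: l1] (- k)) => //.
  - by apply: size_subr_le => //; apply: leq_trans (size_scale_leq _ _) _; apply: leq_trans sa _.
  - by apply: size_subr_le => //; apply: leq_trans (size_scale_leq _ _) _; apply: leq_trans sc _.
  - by apply: (@size_mul_le1 _ 1 2); rewrite ?size_XsubC.
  - by apply: (@size_mul_le1 _ 1 1); rewrite ?size_XsubC.
  - by rewrite oppr_eq0.
  - by rewrite sps.
  - by move=> x xps; rewrite inE; apply: contraNneq l1ps => <-.
  - rewrite big_seq1 /P /Q; transitivity (- (('X - l1%:P) * (a * d - b * c))).
      by rewrite -!mul_polyC; ring.
    by rewrite detE rmorphN; ring.
  - by move=> x; rewrite inE => /eqP->.
  - move=> x xps; rewrite /P /Q !hornerE.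
    case: (boolP ((a.[x] != 0) || (b.[x] != 0))) => [h|]; first by rewrite (avoid _ _ _ b1).
    rewrite negb_or !negbK => /andP [/eqP ax /eqP bx].
    rewrite (avoid _ _ _ b2) ?orbT // -negb_and; apply/negP => /andP [/eqP cx /eqP dx].
    exact: (cop x xps).
  by rewrite inE.
rewrite sps in D7.
have skp : (size kp%:P <= 2)%N.
  by apply: leq_trans (size_polyC_leq1 _) _.
have := cfracS skp n21 (oner_neq0 K) D7.
have e (U V : {poly K}) :
   kp%:P * (('X - l2%:P) * (('X - l1%:P) * U)) +
   1%:P * ('X - l2%:P) * ('X - l1%:P) * (V - kp *: U) =
   ('X - l2%:P) * ('X - l1%:P) * V by rewrite -!mul_polyC; ring.
rewrite !e !mulrA => /cfracZ; apply.
by rewrite mulf_neq0 // polyXsubC_eq0.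
Qed.

End ContinuedFractions.

(** * Words in the Cremona involution *)

Definition o0 : 'I_3 := Ordinal (isT : (0 < 3)%N).
Definition o1 : 'I_3 := Ordinal (isT : (1 < 3)%N).
Definition o2 : 'I_3 := Ordinal (isT : (2 < 3)%N).

Lemma sum3 (V : nmodType) (F : 'I_3 -> V) : \sum_(i < 3) F i = F o0 + F o1 + F o2.
Proof.
rewrite !big_ord_recl big_ord0 addr0 addrA.
by congr (F _ + F _ + F _); apply: val_inj.
Qed.

Lemma forall3 (P : 'I_3 -> Prop) : P o0 -> P o1 -> P o2 -> forall i, P i.
Proof.
move=> h0 h1 h2 [[|[|[|n]]] Hn] //.
- by rewrite (_ : Ordinal Hn = o0) //; apply: val_inj.
- by rewrite (_ : Ordinal Hn = o1) //; apply: val_inj.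
- by rewrite (_ : Ordinal Hn = o2) //; apply: val_inj.
Qed.

Definition pt3 (T : Type) (x y z : T) : 'I_3 -> T :=
  fun i => match val i with 0%N => x | 1%N => y | _ => z end.

Section LinearAlgebra3.
Variable R : comNzRingType.
Implicit Types (u v w : 'I_3 -> R) (A B : 'M[R]_3).

Definition mvec A v : 'I_3 -> R := fun i => \sum_j A i j * v j.
Definition dot u v : R := \sum_i u i * v i.
Definition mx3 u v w : 'M[R]_3 := \matrix_(i, j) pt3 u v w i j.
Definition cross u v : 'I_3 -> R :=
  pt3 (u o1 * v o2 - u o2 * v o1) (u o2 * v o0 - u o0 * v o2) (u o0 * v o1 - u o1 * v o0).
Definition det3 u v w : R :=
  u o0 * (v o1 * w o2 - v o2 * w o1) - u o1 * (v o0 * w o2 - v o2 * w o0)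
  + u o2 * (v o0 * w o1 - v o1 * w o0).

Lemma mvecM A B v i : mvec A (mvec B v) i = mvec (A *m B) v i.
Proof.
rewrite /mvec; under eq_bigr => j _ do rewrite mulr_sumr.
rewrite exchange_big /=; apply: eq_bigr => k _.
by rewrite mxE mulr_suml; apply: eq_bigr => j _; rewrite mulrA.
Qed.

Lemma mvecZ A c v i : mvec A (fun j => c * v j) i = c * mvec A v i.
Proof. by rewrite /mvec mulr_sumr; apply: eq_bigr => j _; ring. Qed.

Lemma eq_mvec A u v : u =1 v -> mvec A u =1 mvec A v.
Proof. by move=> h i; apply: eq_bigr => j _; rewrite h. Qed.

Lemma mvec_mx3 u v w x i : mvec (mx3 u v w) x i = pt3 (dot u x) (dot v x) (dot w x) i.
Proof.
by elim/forall3: i; rewrite /mvec /dot; apply: eq_bigr => j _; rewrite !mxE.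
Qed.

End LinearAlgebra3.

Section Words.
Variable K : numClosedFieldType.
Implicit Types (u v w : 'I_3 -> K) (A B : nat -> 'M[K]_3).

Lemma horner_size2 (p : {poly K}) y : (size p <= 2)%N -> p.[y] = p`_1 * y + p`_0.
Proof.
by move=> sp; rewrite (horner_coef_wide _ sp) !big_ord_recl big_ord0 /=; ring.
Qed.

Lemma mx3_unit u v w : det3 u v w != 0 -> mx3 u v w \in unitmx.
Proof.
move=> d0.
have : mx3 u v w *m (\matrix_(i, j) (pt3 (cross v w) (cross w u) (cross u v) j i / det3 u v w)) = 1%:M.
  apply/matrixP=> i j; rewrite !mxE sum3 !mxE; move: d0; rewrite /det3.
  by elim/forall3: i; elim/forall3: j; rewrite /cross /pt3 /= => d0; field.
by case/mulmx1_unit.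
Qed.

Definition crem v : 'I_3 -> K := pt3 (v o1 * v o2) (v o0 * v o2) (v o0 * v o1).

(** The value of [noether_word] at a vector of homogeneous coordinates. Words are compared
    pointwise, so that forms of degree 2^k never have to be expanded. *)
Fixpoint wv A k v : 'I_3 -> K :=
  if k is k'.+1 then wv A k' (crem (mvec (A k) v)) else mvec (A 0%N) v.

Lemma eq_crem u v : u =1 v -> crem u =1 crem v.
Proof. by move=> h; apply: forall3; rewrite /crem /pt3 /= !h. Qed.

Lemma eq_wv A k u v : u =1 v -> wv A k u =1 wv A k v.
Proof.
elim: k u v => [|k IH] u v h; first exact: eq_mvec.
by apply: IH; apply: eq_crem; apply: eq_mvec.
Qed.

Lemma wvZ A k c v i : wv A k (fun j => c * v j) i = c ^+ (2 ^ k) * wv A k v i.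
Proof.
elim: k c v i => [|k IH] c v i /=; first by rewrite mvecZ expr1.
rewrite expnS exprM -IH; apply: eq_wv => {}i.
transitivity (crem (fun j => c * mvec (A k.+1) v j) i).
  by apply: eq_crem => j; rewrite mvecZ.
by elim/forall3: i; rewrite /crem /pt3 /=; ring.
Qed.

Lemma eq_wvA A B k v : (forall i, (i <= k)%N -> A i = B i) -> wv A k v =1 wv B k v.
Proof.
elim: k v => [|k IH] v h; first by rewrite /= h.
by rewrite /= h //; apply: IH => i ik; apply: h; apply: ltnW.
Qed.

Lemma noether_wordE A k v i : (tnth (noether_word A k) i).@[v] = wv A k v i.
Proof.
have linE (M : 'M[K]_3) x j : (tnth (lin_map M) j).@[x] = mvec M x j.
  rewrite tnth_mktuple raddf_sum; apply: eq_bigr => l _ /=.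
  by rewrite mevalZ mevalXU.
elim: k v i => [|k IH] v i /=; first exact: linE.
rewrite !tnth_mktuple !comp_mpoly_meval /= IH.
apply: eq_wv => {}i.
transitivity (crem (fun j => (tnth (lin_map (A k.+1)) j).@[v]) i); last first.
  by apply: eq_crem => j; apply: linE.
have i1 : inord 1 = o1 by apply: val_inj; rewrite /= inordK.
have i2 : inord 2 = o2 by apply: val_inj; rewrite /= inordK.
have i0 : inord 0 = o0 by apply: val_inj; rewrite /= inordK.
by elim/forall3: i; rewrite /cremona i0 i1 i2 (tnth_nth 0) /= mevalM !mevalXU.
Qed.

(* [P] holds for all but finitely many points. *)
Definition aa (P : K -> Prop) := exists s : seq K, forall x, x \notin s -> P x.

Lemma Kinf (s : seq K) : exists x, x \notin s.
Proof.
have S0 : 0 <= \sum_(a <- s) `|a| by rewrite sumr_ge0.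
exists (1 + \sum_(a <- s) `|a|); apply/negP => xs.
have h b : b \in s -> `|b| <= \sum_(a <- s) `|a|.
  by move=> bs; rewrite (big_rem _ bs) /= lerDl sumr_ge0.
by have := h _ xs; rewrite ger0_norm ?addr_ge0 // gerDr ler10.
Qed.

Lemma aa_ex P : aa P -> exists x, P x.
Proof. by case=> s h; have [x xs] := Kinf s; exists x; apply: h. Qed.

Lemma aa_and P Q : aa P -> aa Q -> aa (fun x => P x /\ Q x).
Proof.
move=> [s hs] [t ht]; exists (s ++ t) => x; rewrite mem_cat negb_or => /andP [? ?].
by split; [apply: hs|apply: ht].
Qed.

Lemma aa_mono (P Q : K -> Prop) : (forall x, P x -> Q x) -> aa P -> aa Q.
Proof. by move=> h [s hs]; exists s => x xs; apply: h; apply: hs. Qed.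

Lemma aaT (P : K -> Prop) : (forall x, P x) -> aa P.
Proof. by move=> h; exists [::]. Qed.

Lemma aa_root (p : {poly K}) : p != 0 -> aa (fun x => p.[x] != 0).
Proof.
move=> p0; have [s sE] := closed_field_poly_normal p; exists s => x xs.
rewrite sE hornerZ mulf_neq0 ?lead_coef_eq0 //.
by move: xs; rewrite -root_prod_XsubC.
Qed.

Lemma aa_neq (a : K) : aa (fun x => x != a).
Proof. by exists [:: a] => x; rewrite inE. Qed.

Lemma wv_lin A n (C : 'M[K]_3) v :
  wv (fun i => if i == n then A n *m C else A i) n v =1 wv A n (mvec C v).
Proof.
case: n => [|n] i /=; first by rewrite mvecM.
rewrite eqxx (eq_wvA (B := A)) => [|j jn].
  by apply: eq_wv; apply: eq_crem => j; rewrite mvecM.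
by rewrite ltn_eqF.
Qed.

(** In the chart (x, y) the word is the map that fixes y and acts on x by the Möbius transformation
    over K(y). One more level precomposes it with x |-> e / (x + a), a single σ between two linear
    maps, and the inner linear map is absorbed by the last matrix of the shorter word. *)
Lemma cfrac_word n P Q P' Q' : cfrac n P Q P' Q' ->
  exists2 A : nat -> 'M[K]_3, (forall i, (i <= n)%N -> A i \in unitmx) &
  aa (fun y => aa (fun x => exists2 c, c != 0 & forall i,
    wv A n (pt3 x y 1) i = c * pt3 (P.[y] * x + P'.[y]) (y * (Q.[y] * x + Q'.[y]))
                                (Q.[y] * x + Q'.[y]) i)).
Proof.
elim=> {n P Q P' Q'}.
- move=> k q al k0 q0 sal.
  exists (fun=> mx3 (pt3 k al`_1 al`_0) (pt3 0 q 0) (pt3 0 0 q)).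
    move=> _ _; apply: mx3_unit; rewrite (_ : det3 _ _ _ = k * (q * q)) ?mulf_neq0 //.
    by rewrite /det3 /pt3 /=; ring.
  apply: aaT => y; apply: aaT => x; exists 1; rewrite ?oner_eq0 // => i /=.
  rewrite mvec_mx3; elim/forall3: i; rewrite /pt3 /= /dot !sum3 /= !hornerE; try ring.
  by rewrite (horner_size2 _ sal); ring.
- move=> n P Q P' Q' a r1 r2 k sa n12 k0 _ [A uA [ys hy]].
  have d0 : r1 - r2 != 0 by rewrite subr_eq0.
  (* [N] below sends (x, y, 1) to (x + a, y - r1, y - r2). After σ, [C] recovers (x + a) y and x + a
     from (x + a) (y - r2) and (x + a) (y - r1); this linear system is solvable because the roots
     differ. The result is x + a times (e / (x + a), y, 1). *)
  pose C := mx3 (pt3 k 0 0) (pt3 0 (r1 / (r1 - r2)) (- r2 / (r1 - r2)))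
                (pt3 0 (1 / (r1 - r2)) (- 1 / (r1 - r2))).
  have uC : C \in unitmx.
    apply: mx3_unit; rewrite (_ : det3 _ _ _ = - k / (r1 - r2)).
      by rewrite mulf_neq0 ?oppr_eq0 // invr_eq0.
    by rewrite /det3 /pt3 /=; field.
  pose N := mx3 (pt3 1 a`_1 a`_0) (pt3 0 1 (- r1)) (pt3 0 1 (- r2)).
  have uN : N \in unitmx.
    apply: mx3_unit; rewrite (_ : det3 _ _ _ = r1 - r2) //.
    by rewrite /det3 /pt3 /=; ring.
  pose A1 i := if i == n then A n *m C else A i.
  exists (fun i => if i == n.+1 then N else A1 i).
    move=> i; rewrite leq_eqVlt ltnS /A1; case: (eqVneq i n.+1) => //= _ i_n.
    by case: (i == n); rewrite ?unitmx_mul ?uC ?andbT uA.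
  exists (r1 :: r2 :: ys) => y; rewrite !inE !negb_or => /and3P [y1 y2 /hy [xs hx]].
  have y10 : y - r1 != 0 by rewrite subr_eq0.
  have y20 : y - r2 != 0 by rewrite subr_eq0.
  pose e := k * (y - r1) * (y - r2).
  have e0 : e != 0 by rewrite !mulf_neq0.
  (* Besides the pole, the preimages under x |-> e / (x + a) of the exceptional points of the
     shorter word are excluded. *)
  exists (- a.[y] :: [seq e / x - a.[y] | x <- xs]) => x; rewrite inE negb_or => /andP [xa xxs].
  pose X0 := x + a.[y].
  have X00 : X0 != 0 by rewrite addr_eq0.
  have exs : e / X0 \notin xs.
    apply: contra xxs => h; apply/mapP; exists (e / X0) => //.
    by rewrite /X0; field; rewrite e0 X00.
  have [c c0 cE] := hx _ exs.
  exists (X0 ^+ (2 ^ n) * c / X0); first by rewrite !mulf_neq0 ?invr_eq0 // expf_neq0.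
  have NE : mvec N (pt3 x y 1) =1 pt3 X0 (y - r1) (y - r2).
    move=> i; rewrite mvec_mx3 /X0 (horner_size2 _ sa).
    by elim/forall3: i; rewrite /dot !sum3 /pt3 /=; ring.
  move=> i; rewrite /= eqxx (eq_wvA (B := A1)) => [|j jn]; last by rewrite ltn_eqF.
  rewrite wv_lin.
  transitivity (wv A n (fun j => X0 * pt3 (e / X0) y 1 j) i).
    apply: eq_wv => j; rewrite (eq_mvec _ (eq_crem NE)) mvec_mx3.
    by elim/forall3: j; rewrite /dot !sum3 /crem /e /pt3 /=; field.
  rewrite wvZ cE -!mulrA; congr (_ * (_ * _)).
  elim/forall3: i; rewrite /pt3 /= !(hornerD, hornerM, hornerN, hornerX, hornerC);
    move: X00; rewrite /X0 /e => X00; by field.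
- move=> n h P Q P' Q' h0 _ [A uA hA]; exists A => //.
  apply: aa_mono (aa_and (aa_root h0) hA) => y [hy].
  apply: aa_mono => x [c c0 cE]; exists (c * h.[y]); first by rewrite mulf_neq0.
  by move=> i; rewrite cE -mulrA; congr (_ * _); elim/forall3: i; rewrite /pt3 /= !hornerM; ring.
Qed.

End Words.

(** * Substitution in multivariate polynomials *)

Section Substitution.
Variables (n : nat) (K : fieldType).
Implicit Types p q : {mpoly K[n]}.

Lemma mpoly_ring_ind (P : {mpoly K[n]} -> Prop) :
  (forall c, P c%:MP) -> (forall i, P 'X_i) ->
  (forall p q, P p -> P q -> P (p + q)) -> (forall p q, P p -> P q -> P (p * q)) ->
  forall p, P p.
Proof.
move=> hC hX hD hM; apply: mpolyind => [|c m p _ _ Pp]; first by rewrite -mpolyC0.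
apply: hD => //; rewrite -mul_mpolyC; apply: (hM) => //; rewrite mpolyXE_id.
apply: big_ind => [||i _]; [by rewrite -mpolyC1|exact: hM|].
by elim: (m i) => [|k IH]; [rewrite expr0 -mpolyC1|rewrite exprS; apply: (hM)].
Qed.

Lemma rmorph_mmap (R S : comNzRingType) (f : {rmorphism K -> R}) (g : {rmorphism R -> S})
  (h : 'I_n -> R) p : g (mmap f h p) = mmap (g \o f) (g \o h) p.
Proof.
rewrite /mmap rmorph_sum; apply: eq_bigr => m _; rewrite rmorphM /=.
by rewrite rmorph_prod; congr (_ * _); apply: eq_bigr => i _; rewrite rmorphXn.
Qed.

Lemma eq_mmap (R : comNzRingType) (f g : K -> R) (h k : 'I_n -> R) p :
  f =1 g -> h =1 k -> mmap f h p = mmap g k p.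
Proof. by move=> fg hk; apply: eq_bigr => m _; rewrite fg (mmap1_eq _ hk). Qed.

Lemma mmap_homogZ (R : comNzRingType) (f : {rmorphism K -> R}) (h : 'I_n -> R) d c p :
  p \is d.-homog -> mmap f (fun i => c * h i) p = c ^+ d * mmap f h p.
Proof.
move=> hp; rewrite /mmap mulr_sumr big_seq [RHS]big_seq; apply: eq_bigr => m mp.
rewrite mulrCA; congr (_ * _); rewrite /mmap1.
under eq_bigr => i _ do rewrite exprMn.
rewrite big_split /= prodrXr -mdegE; congr (c ^+ _ * _).
exact: (dhomog_mf hp).
Qed.

(** The derivation is abstract because the rule serves three times: along a parametrized curve,
    across the pencil ([dX]), and in the outer variable at the double point. *)
Lemma mmap_chain (R : comNzRingType) (f : {rmorphism K -> R}) (h : 'I_n -> R)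
    (delta : R -> R) p :
  (forall x y, delta (x + y) = delta x + delta y) ->
  (forall x y, delta (x * y) = delta x * y + x * delta y) ->
  (forall c, delta (f c) = 0) ->
  delta (mmap f h p) = \sum_i mmap f h (p^`M(i)) * delta (h i).
Proof.
move=> dD dM dC; elim/mpoly_ring_ind: p => [c|i|p q hp hq|p q hp hq].
- rewrite mmapC dC big1 // => i _; by rewrite mderivC mmap0 mul0r.
- rewrite mmapX mmap1U (bigD1 i) //= big1 ?addr0 => [|j ji].
    rewrite mderivX mnm1E eqxx scale1r mmapX.
    by rewrite (_ : (U_(i) - U_(i))%MM = 0%MM) ?mmap11 ?mul1r //; apply/mnmP=> j; rewrite mnmBE subnn mnm0E.
  by rewrite mderivX mnm1E eq_sym (negPf ji) scale0r mmap0 mul0r.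
- rewrite mmapD dD hp hq -big_split; apply: eq_bigr => i _.
  by rewrite mderivD mmapD mulrDl.
rewrite rmorphM dM hp hq mulr_suml mulr_sumr -big_split; apply: eq_bigr => i _.
by rewrite mderivM mmapD !rmorphM /=; ring.
Qed.

Lemma euler d p : p \is d.-homog -> \sum_i 'X_i * p^`M(i) = d%:R *: p.
Proof.
move=> hp; rewrite {2}[p]mpolyE scaler_sumr.
under eq_bigr => i _ do rewrite {1}[p]mpolyE raddf_sum mulr_sumr.
rewrite exchange_big /= big_seq [RHS]big_seq; apply: eq_bigr => m mp.
have dm : mdeg m = d by exact: (dhomog_mf hp mp).
rewrite -dm mdegE natr_sum scaler_suml; apply: eq_bigr => i _.
rewrite mderivZ mderivX; case: (posnP (m i)) => [->|mi].
  by rewrite !scale0r scaler0 mulr0.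
rewrite -!scalerAr scalerA mulrC -scalerA -mpolyXD addmC submK // lep1mP.
by rewrite -lt0n.
Qed.

Lemma mderiv_homog d i p : p \is d.+1.-homog -> p^`M(i) \is d.-homog.
Proof.
move=> hp; apply/dhomogP => m; rewrite mcoeff_msupp mcoeff_deriv => h.
have : (m + U_(i))%MM \in msupp p.
  by rewrite mcoeff_msupp; apply: contraNneq h => ->; rewrite mul0rn.
by move/(dhomog_mf hp); rewrite /= mdegD mdeg1 addn1 => /eqP; rewrite eqSS => /eqP.
Qed.

End Substitution.

(** * Nonzero polynomials have nonzero values *)

Section NonVanishing.
Variable K : numClosedFieldType.

Lemma muni_coef n (p : {mpoly K[n.+1]}) (m : 'X_{1..n.+1}) :
  (muni p)`_(m ord_max)@_[multinom m (widen_ord (leqnSn n) i) | i < n] = p@_m.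
Proof.
rewrite muniE coef_sum (raddf_sum (mcoeff _)) /= [in RHS](mpolyE p) (raddf_sum (mcoeff m)) /=.
apply: eq_bigr => m' _; rewrite coefZ coefXn !mcoeffZ mcoeffX.
case: (eqVneq m' m) => [->|nm]; first by rewrite eqxx mulr1 mcoeffZ mcoeffX eqxx.
case: (eqVneq (m ord_max) (m' ord_max)) => [em|_]; last by rewrite mulr0 mcoeff0 mulr0.
rewrite mulr1 mcoeffZ mcoeffX; case: eqP => // e; case/negP: nm; apply/eqP/mnmP => i.
case: (unliftP ord_max i) => [j ->|->//].
have := congr1 (fun t : 'X_{1..n} => t j) e; rewrite !mnmE.
by rewrite (_ : widen_ord _ j = lift ord_max j) //; apply: val_inj; exact: (esym (lift_max j)).
Qed.

Lemma meval_muni n (p : {mpoly K[n.+1]}) (v : 'I_n.+1 -> K) :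
  p.@[v] = (map_poly (meval (fun i => v (widen_ord (leqnSn n) i))) (muni p)).[v ord_max].
Proof.
rewrite muniE raddf_sum /= horner_sum mevalE; apply: eq_bigr => m _.
rewrite map_polyZ /= mevalZ mevalX map_polyXn hornerZ hornerXn big_ord_recr mulrA /=.
by congr (_ * _ * _); apply: eq_bigr => i _; rewrite mnmE.
Qed.

Lemma mpoly_nonvanishing n (p : {mpoly K[n]}) : p != 0 -> exists v, p.@[v] != 0.
Proof.
elim: n p => [|n IH] p p0.
  exists (fun=> 0); have [c pE] : exists c, p = c%:MP.
    by exists p@_0; apply: nvar0_mpolyC.
  by move: p0; rewrite pE mevalC mpolyC_eq0.
have mp0 : muni p != 0.
  apply: contraNneq p0 => mp; apply/eqP/mpolyP=> m.
  by rewrite -muni_coef mp coef0 !mcoeff0.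
have lc0 : lead_coef (muni p) != 0 by rewrite lead_coef_eq0.
have [w hw] := IH _ lc0.
have q0 : map_poly (meval w) (muni p) != 0.
  apply: contraNneq hw => q0; have := congr1 (fun q : {poly K} => q`_(size (muni p)).-1) q0.
  by rewrite coef0 coef_map => ->.
have [x hx] := aa_ex (aa_root q0).
exists (fun i => if insub (val i) is Some j then w j else x).
rewrite meval_muni insubN ?ltnn //.
rewrite (_ : map_poly _ _ = map_poly (meval w) (muni p)) //.
apply/polyP=> k; rewrite !coef_map /=; apply: meval_eq => i.
by rewrite valK.
Qed.

End NonVanishing.

(** * Gauss lemma and gcd in two variables *)

Section GaussLemma.
Variable K : numClosedFieldType.
Implicit Types (h p q : {poly {poly K}}) (c : {poly K}).

(* In [{poly {poly K}}] the inner variable is written s or y, the outer one t or x0. *)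
Definition evX (a : K) : {poly {poly K}} -> {poly K} := map_poly (horner_eval a).

HB.instance Definition _ a := GRing.RMorphism.on (evX a).

Lemma evX_horner a p t : (evX a p).[t] = p.[t%:P].[a].
Proof.
have := horner_map (horner_eval a) p t%:P; rewrite /= !horner_evalE hornerC.
by [].
Qed.

Lemma evX_coef a p i : (evX a p)`_i = (p`_i).[a].
Proof. by rewrite coef_map. Qed.

Lemma evX_eq0 a h : evX a h = 0 -> exists h', h = ('X - a%:P)%:P * h'.
Proof.
move=> ha; exists (\poly_(i < size h) (h`_i %/ ('X - a%:P))).
apply/polyP=> i; rewrite coefCM coef_poly; case: ltnP => [_|hi]; last first.
  by rewrite mulr0 nth_default.
rewrite mulrC divpK // dvdp_XsubCl rootE -evX_coef ha coef0 //.
Qed.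

(** Content 1 with respect to the inner variable: as the field is algebraically closed, it suffices
    that no linear polynomial 'X - a divides all coefficients. *)
Definition primitive h := forall a, evX a h != 0.

(** The roots of [c] are cancelled one at a time: at a root a, [evX a] kills h q but not h, so 'X -
    a divides q. *)
Lemma gauss h p q c : primitive h -> c != 0 -> c%:P * p = h * q ->
  exists q', p = h * q'.
Proof.
move=> hprim; elim: {c}(size c) {-2}c (leqnn (size c)) q => [|n IH] c sc q c0 e.
  by move: sc; rewrite leqn0 size_poly_eq0 (negPf c0).
case: (eqVneq (size c) 1) => [/eqP/size_poly1P [k k0 ck]|nc].
  exists ((k^-1)%:P%:P * q); rewrite mulrCA -e ck mulrA -!polyCM mulVf //.
  by rewrite mul1r.
have [a /eqP ra] := closed_rootP c nc.
have [c1 sc1 cE] := root_factor (leq_trans sc (leqnn _)) ra.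
have c10 : c1 != 0 by apply: contraNneq c0 => c10; rewrite cE c10 mul0r.
have : evX a (h * q) = 0.
  by rewrite -e rmorphM /= /evX map_polyC /= horner_evalE ra mul0r.
rewrite rmorphM /= => /eqP; rewrite mulf_eq0 (negPf (hprim a)) /= => /eqP/evX_eq0 [q1 qE].
apply: (IH c1 sc1 q1 c10).
have x0 : ('X - a%:P)%:P != 0 :> {poly {poly K}} by rewrite polyC_eq0 polyXsubC_eq0.
apply: (mulfI x0); transitivity (c%:P * p); first by rewrite cE rmorphM /=; ring.
by rewrite e qE; ring.
Qed.

(** A linear factor of the content also divides the leading coefficient, so only finitely many a
    need testing, and the size of that coefficient decreases with each division. *)
Lemma primitive_part h : h != 0 ->
  exists c h0, [/\ c != 0, h = c%:P * h0 & primitive h0].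
Proof.
move: {2}(size (lead_coef h)) (leqnn (size (lead_coef h))) => n.
elim: n h => [|n IH] h sl h0.
  by move: sl; rewrite leqn0 size_poly_eq0 lead_coef_eq0 (negPf h0).
have [r rE] := closed_field_poly_normal (lead_coef h).
case: (boolP (has (fun a => evX a h == 0) r)) => [/hasP [a _ /eqP/evX_eq0 [h' hE]]|/hasPn hr].
  have h'0 : h' != 0 by apply: contraNneq h0 => h'0; rewrite hE h'0 mulr0.
  have [|c [h1 [c0 h1E pr]]] := IH h' _ h'0.
    move: sl; rewrite hE lead_coefM lead_coefC size_proper_mul; last first.
      by rewrite lead_coefXsubC mul1r !lead_coef_eq0.
    by rewrite size_XsubC.
  exists (('X - a%:P) * c), h1; split=> //; last by rewrite hE h1E rmorphM mulrA.
  by rewrite mulf_neq0 // polyXsubC_eq0.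
exists 1, h; split; rewrite ?oner_eq0 ?mul1r // => a.
case: (boolP (a \in r)) => [/hr//|ar]; apply/eqP=> ha.
have := evX_coef a h (size h).-1; rewrite ha coef0 => /esym/eqP; apply/negP.
rewrite -[_`_ _]/(lead_coef h) rE hornerZ mulf_neq0 ?lead_coef_eq0 //.
by move: ar; rewrite -root_prod_XsubC.
Qed.

Import Pdiv.Idomain.

(** The Bezout relation holds over K(s); clearing denominators leaves c(s) in place of 1. Hence the
    common zeros of the cofactors lie over finitely many s. Taking the primitive part of the gcd
    makes the divisions exact, by [gauss]. *)
Lemma gcd3 (p : 'I_3 -> {poly {poly K}}) : (exists i, p i != 0) ->
  exists h (q u : 'I_3 -> {poly {poly K}}) c,
    [/\ forall i, p i = h * q i, \sum_i u i * q i = c%:P, c != 0 & h != 0].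
Proof.
move=> [i0 pi0].
pose g01 := gcdp (p o0) (p o1); pose g := gcdp g01 (p o2).
have gp i : exists2 cq, cq.1 != 0 & cq.1 *: p i = cq.2 * g.
  apply/Pdiv.WeakIdomain.dvdpP; elim/forall3: i.
  - by apply: dvdp_trans (dvdp_gcdl _ _) (dvdp_gcdl _ _).
  - by apply: dvdp_trans (dvdp_gcdl _ _) (dvdp_gcdr _ _).
  exact: dvdp_gcdr.
have g0 : g != 0.
  apply: contraNneq pi0 => g0; have [[c r] /= c0] := gp i0.
  by rewrite g0 mulr0 => /eqP; rewrite -mul_polyC mulf_eq0 polyC_eq0 (negPf c0).
have [cg [h [cg0 gE hprim]]] := primitive_part g0.
have h0 : h != 0 by apply: contraNneq g0 => h0; rewrite gE h0 mulr0.
have hq i : exists q', p i = h * q'.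
  have [[c r] /= c0 e] := gp i; apply: (gauss (c := c) (q := cg%:P * r) hprim c0).
  by rewrite mul_polyC e gE; ring.
have [q0 q0E] := hq o0; have [q1 q1E] := hq o1; have [q2 q2E] := hq o2.
have [u /eqpP [[d1 d2] /= /andP [d10 d20] du]] := Bezoutp (p o0) (p o1).
have [v /eqpP [[e1 e2] /= /andP [e10 e20] ev]] := Bezoutp g01 (p o2).
exists h, (pt3 q0 q1 q2), (pt3 ((e1 * d1)%:P * v.1 * u.1) ((e1 * d1)%:P * v.1 * u.2) ((e1 * d2)%:P * v.2)), (d2 * e2 * cg).
split=> //; first by apply: forall3.
  rewrite sum3 /pt3 /=; apply: (mulfI h0).
  transitivity (e1%:P * (v.1 * (d1 *: (u.1 * p o0 + u.2 * p o1)) + d2%:P * v.2 * p o2)).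
    by rewrite q0E q1E q2E -!mul_polyC !rmorphM /=; ring.
  rewrite du -/g01; transitivity (d2%:P * (e1 *: (v.1 * g01 + v.2 * p o2))).
    by rewrite -!mul_polyC; ring.
  by rewrite ev -/g gE -!mul_polyC !rmorphM /=; ring.
by rewrite !mulf_neq0.
Qed.

End GaussLemma.

(** * Base points *)

Section Homogenization.
Variable K : numClosedFieldType.

Lemma mpoly_dense n (p : {mpoly K[n]}) k :
  (forall x, x k != 0 -> p.@[x] = 0) -> p = 0.
Proof.
move=> h; apply/eqP; case: (boolP (p * 'X_k == 0)).
  by rewrite mulf_eq0 => /orP [//|/eqP e]; have := congr1 (meval (fun=> 1)) e; rewrite mevalXU meval0 => /eqP; rewrite oner_eq0.
move/mpoly_nonvanishing => [v]; rewrite mevalM mevalXU mulf_eq0 negb_or => /andP [h1 h2].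
by rewrite h ?eqxx in h1.
Qed.

Lemma bipoly_dense (p : {poly {poly K}}) : (forall s t, p.[t%:P].[s] = 0) -> p = 0.
Proof.
move=> h; apply/eqP; apply: contraT => p0.
have lc : lead_coef p != 0 by rewrite lead_coef_eq0.
have [s hs] := aa_ex (aa_root lc).
have ps : evX s p != 0.
  apply: contraNneq hs => e.
  by have := evX_coef s p (size p).-1; rewrite e coef0 => <-.
by have [t] := aa_ex (aa_root ps); rewrite evX_horner h eqxx.
Qed.

Lemma msizeM_bound n a b (p q : {mpoly K[n]}) :
  (msize p <= a.+1)%N -> (msize q <= b.+1)%N -> (msize (p * q)%R <= (a + b).+1)%N.
Proof.
case: (eqVneq p 0) => [->|p0]; first by rewrite mul0r msize0.
case: (eqVneq q 0) => [->|q0]; first by rewrite mulr0 msize0.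
by move=> pa qb; rewrite msizeM // -subn1 leq_subLR add1n -addnS -addSn leq_add.
Qed.

Lemma msize_mmap n k (h : 'I_n -> {mpoly K[k]}) d (p : {mpoly K[n]}) :
  p \is d.-homog -> (forall j, (msize (h j) <= 2)%N) ->
  (msize (mmap (@mpolyC k K) h p) <= d.+1)%N.
Proof.
move=> hp sh; apply: leq_trans (mmeasure_sum _ _ _ _) _.
rewrite big_seq; apply/bigmax_leqP_seq => m _ mp.
rewrite mul_mpolyC; apply: leq_trans (msizeZ_le _ _) _.
have <- : mdeg m = d by exact: (dhomog_mf hp mp).
rewrite mdegE /mmap1.
apply: (big_ind2 (fun (q : {mpoly K[k]}) e => msize q <= e.+1)%N) => [||j _].
- by rewrite msize1.
- by move=> p1 a p2 b; apply: msizeM_bound.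
elim: (m j) => [|e IH]; first by rewrite expr0 msize1.
by rewrite exprS; apply: (@msizeM_bound k 1 e).
Qed.

Definition homogenize n (k : 'I_n) e (r : {mpoly K[n]}) : {mpoly K[n]} :=
  \sum_(m <- msupp r) r@_m *: ('X_k ^+ (e - mdeg m) * 'X_[m]).

Lemma homogenizeE n (k : 'I_n) e r x : x k != 0 -> (msize r <= e.+1)%N ->
  (homogenize k e r).@[x] = x k ^+ e * r.@[fun j => x j / x k].
Proof.
move=> x0 sr; rewrite raddf_sum mevalE mulr_sumr big_seq [RHS]big_seq /=.
apply: eq_bigr => m mr; rewrite mevalZ mevalM mevalX rmorphXn /= mevalXU.
have me : (mdeg m <= e)%N by have := msize_mdeg_lt mr; move/leq_trans/(_ sr).
rewrite [RHS]mulrCA; congr (_ * _).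
under [in RHS]eq_bigr => j _ do rewrite exprMn exprVn.
by rewrite big_split /= prodfV prodrXr -mdegE mulrCA mulrC -expfB_cond ?(negPf x0).
Qed.

Lemma mpoly_unit_const n (p : {mpoly K[n]}) : p \is a GRing.unit -> exists2 c, c != 0 & p = c%:MP.
Proof. by move=> /andP [/eqP pE]; rewrite unitfE => c0; exists p@_0. Qed.

End Homogenization.

(** * Forms in an affine chart *)

Section Chart.
Variable K : numClosedFieldType.
Variable (sg : 'I_3 -> 'I_3).
Hypothesis sgK : involutive sg.

Definition CC : K -> {poly {poly K}} := polyC \o polyC.
HB.instance Definition _ := GRing.RMorphism.on CC.

(** The involution [sg] decides which coordinate is set to 1, so that one computation covers the
    three standard charts. *)
Definition chart (i : 'I_3) : {poly {poly K}} := pt3 1 ('X%:P) 'X (sg i).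

Definition dehom (p : {mpoly K[3]}) : {poly {poly K}} := mmap CC chart p.

Lemma dehom_horner p s t : (dehom p).[t%:P].[s] = p.@[fun i => pt3 1 s t (sg i)].
Proof.
rewrite /dehom -[_.[s]]/(horner_eval s (horner_eval t%:P (mmap CC chart p))).
rewrite !rmorph_mmap /=; apply: eq_mmap => [c|i] /=.
  by rewrite /CC /= !horner_evalE !hornerC.
rewrite !horner_evalE /chart; elim/forall3: (sg i); rewrite /pt3 /= ?hornerX ?hornerC //.
  by rewrite hornerX.
Qed.

Lemma dehomE d p x : p \is d.-homog -> x (sg o0) != 0 ->
  p.@[x] = x (sg o0) ^+ d * (dehom p).[(x (sg o2) / x (sg o0))%:P].[x (sg o1) / x (sg o0)].
Proof.
move=> hp x0; rewrite dehom_horner -(mmap_homogZ _ _ _ hp).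
apply: eq_mmap => // i; rewrite -[in LHS](sgK i).
by elim/forall3: (sg i); rewrite /pt3 /= ?mulr1 // mulrC divfK.
Qed.

Definition XX i : {mpoly K[3]} := 'X_(sg i).
Definition iota1 : {poly K} -> {mpoly K[3]} := horner_eval (XX o1) \o map_poly (@mpolyC 3 K).
HB.instance Definition _ := GRing.RMorphism.on iota1.
Definition iotaS : {poly {poly K}} -> {mpoly K[3]} := horner_eval (XX o2) \o map_poly iota1.
HB.instance Definition _ := GRing.RMorphism.on iotaS.

Lemma iotaSE p x : (iotaS p).@[x] = p.[(x (sg o2))%:P].[x (sg o1)].
Proof.
rewrite /iotaS /= horner_evalE -horner_map /= mevalXU -map_poly_comp.
rewrite -[RHS]/(horner_eval (x (sg o1)) p.[(x (sg o2))%:P]) -horner_map /= !horner_evalE hornerC.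
congr (horner _ _); apply: eq_map_poly => c /=.
rewrite /iota1 /= horner_evalE -horner_map /= mevalXU -map_poly_comp.
by rewrite horner_evalE; congr (horner _ _); rewrite map_poly_id // => a _ /=; rewrite mevalC.
Qed.

Lemma msize_iotaS d p : p \is d.-homog -> (msize (iotaS (dehom p)) <= d.+1)%N.
Proof.
move=> hp; rewrite /dehom rmorph_mmap.
rewrite (@eq_mmap _ _ _ _ (@mpolyC 3 K) _ (fun i => pt3 1 (XX o1) (XX o2) (sg i))).
- apply: msize_mmap hp _ => j; elim/forall3: (sg j); rewrite /pt3 /= ?msize1 //.
    by rewrite /XX msizeX mdeg1.
  by rewrite /XX msizeX mdeg1.
- move=> c /=; rewrite /iotaS /CC /= horner_evalE map_polyC hornerC /= /iota1 /= horner_evalE.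
  by rewrite map_polyC hornerC.
move=> i /=; rewrite /chart; elim/forall3: (sg i); rewrite /pt3 /= ?rmorph1 //.
  rewrite /iotaS /= horner_evalE map_polyC hornerC /= /iota1 /= horner_evalE.
  by rewrite map_polyX hornerX.
by rewrite /iotaS /= horner_evalE map_polyX hornerX.
Qed.

(* A common factor in the affine chart homogenizes to a common factor of the forms. *)
Lemma dehom_common_factor (f : triple K) d h (q : 'I_3 -> {poly {poly K}}) :
  homog_triple d f -> no_common_factor f ->
  (forall i, dehom (tnth f i) = h * q i) -> exists2 c : K, c != 0 & h = c%:P%:P.
Proof.
move=> hf cop hq.
have iota0 p : iotaS p = 0 -> p = 0.
  move=> e; apply: bipoly_dense => s t.
  have := iotaSE p (fun i => pt3 0 s t (sg i)); rewrite e meval0 !sgK /pt3 /= => <-.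
  by [].
have d0 i : dehom (tnth f i) = 0 -> tnth f i = 0.
  move=> e; apply: (@mpoly_dense _ _ _ (sg o0)) => x x0.
  by rewrite (dehomE (hf i) x0) e !horner0 mulr0.
have [i0 fi0] : exists i, tnth f i != 0.
  case: (boolP [exists i, tnth f i != 0]) => [/existsP //|/existsPn z].
  have := cop 0; rewrite unitr0 => c; suff : false by []; apply: c => i.
  by exists 0; rewrite mul0r; apply/eqP; have := z i; rewrite negbK.
have hq0 : h * q i0 != 0 by rewrite -hq; apply: contraNneq fi0 => /d0 ->.
have h0 : h != 0 by apply: contraNneq hq0 => ->; rewrite mul0r.
have ih0 : iotaS h != 0 by apply: contraNneq h0 => /iota0 ->.
pose e := (msize (iotaS h)).-1.
have se : msize (iotaS h) = e.+1 by rewrite /e prednK // lt0n msize_poly_eq0.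
have sz i : q i != 0 -> (e + msize (iotaS (q i)) <= d.+1)%N.
  move=> qi0; have iq0 : iotaS (q i) != 0 by apply: contraNneq qi0 => /iota0 ->.
  by have := msize_iotaS (hf i); rewrite hq rmorphM /= msizeM // se addSn.
have qi0 : q i0 != 0 by apply: contraNneq hq0 => ->; rewrite mulr0.
have ed : (e <= d)%N.
  have := sz _ qi0; have : (0 < msize (iotaS (q i0)))%N.
    by rewrite lt0n msize_poly_eq0; apply: contraNneq qi0 => /iota0 ->.
  by case: (msize _) => // k _; rewrite addnS ltnS; apply: leq_trans; apply: leq_addr.
have sq i : (msize (iotaS (q i)) <= (d - e).+1)%N.
  case: (eqVneq (q i) 0) => [->|/sz]; first by rewrite rmorph0 msize0.
  by rewrite -subSn // -leq_subRL ?leqW // .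
pose k := sg o0.
have uH : homogenize k e (iotaS h) \is a GRing.unit.
  apply: cop => i; exists (homogenize k (d - e) (iotaS (q i))).
  apply/eqP; rewrite -subr_eq0; apply/eqP; apply: (@mpoly_dense _ _ _ k) => x x0.
  rewrite mevalB mevalM !homogenizeE ?se // (dehomE (hf i) x0) hq hornerM hornerM.
  rewrite !iotaSE -/k -{1}(subnK ed) exprD (mulrC _.[_]) mulrACA subrr //.
have [c c0 cE] := mpoly_unit_const uH; exists c => //.
apply/eqP; rewrite -subr_eq0; apply/eqP; apply: bipoly_dense => s t.
have := @homogenizeE K 3 k e (iotaS h) (fun i => pt3 1 s t (sg i)).
rewrite /k sgK /pt3 /= oner_eq0 se cE mevalC expr1n mul1r iotaSE !sgK /= !divr1.
by move/(_ isT (leqnn _)) => ->; rewrite !hornerE subrr.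
Qed.

End Chart.

(** * Finiteness of the base locus *)

Section BasePoints.
Variable K : numClosedFieldType.
Variables (f : triple K) (d : nat).
Hypotheses (hf : homog_triple d f) (cop : no_common_factor f).

Lemma no_common_factor_neq0 : exists i, tnth f i != 0.
Proof.
case: (boolP [exists i, tnth f i != 0]) => [/existsP //|/existsPn z].
have := @cop 0; rewrite unitr0 => c; suff : false by []; apply: c => i.
by exists 0; rewrite mul0r; apply/eqP; have := z i; rewrite negbK.
Qed.

Lemma roots_list (p : {poly K}) : p != 0 -> exists r : seq K, forall x, p.[x] = 0 -> x \in r.
Proof.
move=> /aa_root [r hr]; exists r => x px.
by apply: contraT => /hr; rewrite px eqxx.
Qed.

Lemma finite_fibration (S : seq K) (R : K -> K -> Prop) :
  (forall s, s \in S -> exists T : seq K, forall t, R s t -> t \in T) ->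
  exists L : seq (K * K), forall s t, s \in S -> R s t -> (s, t) \in L.
Proof.
elim: S => [|s S IH] h; first by exists [::].
have [L hL] := IH (fun x xS => h x (@mem_behead _ (s :: S) x xS)).
have [T hT] := h s (mem_head _ _).
exists ([seq (s, t) | t <- T] ++ L) => x t; rewrite inE mem_cat => /orP [/eqP->|xS] r.
  by rewrite map_f ?hT.
by rewrite hL ?orbT.
Qed.

(** The common factor in the chart is constant, so a base point (s, t) is a common zero of the
    cofactors and s is a root of c. Over each s only finitely many t occur, since otherwise 'X - s
    would be a common factor. *)
Lemma base_finite_chart (sg : 'I_3 -> 'I_3) : involutive sg ->
  exists L : seq (K * K), forall s t,
    (forall i, (tnth f i).@[fun j => pt3 1 s t (sg j)] = 0) -> (s, t) \in L.
Proof.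
move=> sgK; pose p i := dehom sg (tnth f i).
have [i0 pi0] : exists i, p i != 0.
  have [i fi] := no_common_factor_neq0; exists i; apply: contraNneq fi => e.
  apply/eqP; apply: (@mpoly_dense _ _ _ (sg o0)) => x x0.
  by rewrite (dehomE sgK (hf i) x0) -/(p i) e !horner0 mulr0.
have [h [q [u [c [hq uq c0 h0]]]]] := gcd3 (ex_intro _ i0 pi0).
have [k k0 hk] := dehom_common_factor sgK hf cop hq.
have [S hS] := roots_list c0.
pose R s t := forall i, (tnth f i).@[fun j => pt3 1 s t (sg j)] = 0.
have [|L hL] := @finite_fibration S R.
  move=> s _.
  have [i pis] : exists i, evX s (p i) != 0.
    case: (boolP [exists i, evX s (p i) != 0]) => [/existsP //|/existsPn z].
    have dv i : exists q', p i = ('X - s%:P)%:P * q'.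
      by apply: evX_eq0; apply/eqP; have := z i; rewrite negbK.
    have [q0 e0] := dv o0; have [q1 e1] := dv o1; have [q2 e2] := dv o2.
    have [|k' _] := @dehom_common_factor K sg sgK f d ('X - s%:P)%:P (pt3 q0 q1 q2) hf cop.
      exact: forall3.
    by move=> /polyC_inj /(congr1 (size \o val)) /=; rewrite size_XsubC size_polyC; case: eqP.
  have [T hT] := roots_list pis.
  by exists T => t Rt; apply: hT; rewrite evX_horner dehom_horner.
exists L => s t Rst; apply: hL => //; apply: hS.
have qz i : (q i).[t%:P].[s] = 0.
  have := Rst i; rewrite -dehom_horner -/(p i) hq hk !hornerM !hornerC => /eqP.
  by rewrite mulf_eq0 (negPf k0) => /eqP.
have := congr1 (fun P : {poly {poly K}} => P.[t%:P].[s]) uq; rewrite /= hornerC => <-.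
by rewrite sum3 !hornerD !hornerM !qz !mulr0 !addr0.
Qed.

Lemma base_finite : exists B : seq (K * K * K), forall x : 'I_3 -> K,
  (exists i, x i != 0) -> (forall i, (tnth f i).@[x] = 0) ->
  exists2 b, b \in B & exists2 c, c != 0 & forall i, x i = c * pt3 b.1.1 b.1.2 b.2 i.
Proof.
pose sw (k i : 'I_3) := if i == o0 then k else if i == k then o0 else i.
have swK k : involutive (sw k).
  by elim/forall3: k; apply: forall3.
have ch k : exists B : seq (K * K * K), forall x : 'I_3 -> K,
  x k != 0 -> (forall i, (tnth f i).@[x] = 0) ->
  exists2 b, b \in B & exists2 c, c != 0 & forall i, x i = c * pt3 b.1.1 b.1.2 b.2 i.
  have [L hL] := base_finite_chart (swK k).
  pose P st := fun i => pt3 1 st.1 st.2 (sw k i) : K.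
  exists [seq (P st o0, P st o1, P st o2) | st <- L] => x xk fx.
  pose st := (x (sw k o1) / x k, x (sw k o2) / x k).
  have xE i : x i = x k * P st i.
    rewrite -[in LHS](swK k i) /P; elim/forall3: (sw k i); rewrite /pt3 /=.
    - by rewrite mulr1.
    - by rewrite mulrC divfK.
    by rewrite mulrC divfK.
  exists (P st o0, P st o1, P st o2).
    apply: (map_f (fun st => (P st o0, P st o1, P st o2))); apply: hL => i.
    apply: (mulfI (expf_neq0 d xk)); rewrite mulr0 -(fx i) -(mmap_homogZ _ _ _ (hf i)).
    by apply: eq_mmap => // j; rewrite xE.
  by exists (x k) => // i; rewrite xE; congr (_ * _); elim/forall3: i.
have [B0 h0] := ch o0; have [B1 h1] := ch o1; have [B2 h2] := ch o2.
exists (B0 ++ B1 ++ B2) => x [j]; elim/forall3: j => xi fx.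
- by have [b bB hb] := h0 x xi fx; exists b; rewrite ?mem_cat ?bB.
- by have [b bB hb] := h1 x xi fx; exists b; rewrite ?mem_cat ?bB ?orbT.
by have [b bB hb] := h2 x xi fx; exists b; rewrite ?mem_cat ?bB ?orbT.
Qed.

End BasePoints.

(** * Singular members of a pencil *)

Section TopCoefficient.
Variable R : comNzRingType.
Implicit Types p q : {poly R}.

(** A formal leading coefficient: [e] only bounds the degree and [c] may be zero. For a parametrized
    curve it describes the point at infinity. *)
Definition topcoef p e c := (size p <= e.+1)%N /\ p`_e = c.

Lemma topcoefM p q a b c c' :
  topcoef p a c -> topcoef q b c' -> topcoef (p * q) (a + b) (c * c').
Proof.
move=> [sp <-] [sq <-]; split.
  apply: leq_trans (size_polyMleq _ _) _.
  by rewrite -subn1 leq_subLR add1n -addnS -addSn leq_add.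
rewrite coefM (bigD1 (inord a)) //= inordK ?ltnS ?leq_addr // addKn.
rewrite big1 ?addr0 // => i ia.
have {}ia : val i != a.
  by apply: contraNneq ia => e; apply/eqP/val_inj; rewrite /= inordK ?ltnS ?leq_addr.
case: (ltngtP (val i) a) ia => // [ia|ia] _.
  rewrite [X in _ * X]nth_default ?mulr0 //; apply: leq_trans sq _.
  by rewrite ltn_subRL ltn_add2r.
by rewrite nth_default ?mul0r //; apply: leq_trans sp _.
Qed.

Lemma mmap_topcoef (K : fieldType) (f : {rmorphism K -> R}) (h : 'I_3 -> {poly R}) d m
    (p : {mpoly K[3]}) : p \is d.-homog -> (forall j, (size (h j) <= m.+1)%N) ->
  topcoef (mmap (polyC \o f) h p) (d * m) (mmap f (fun j => (h j)`_m) p).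
Proof.
move=> hp sh; rewrite /mmap.
have T mm : mm \in msupp p ->
    topcoef (f p@_mm *: mmap1 h mm) (d * m) (f p@_mm * mmap1 (fun j => (h j)`_m) mm).
  move=> mp; have <- : mdeg mm = d by exact: (dhomog_mf hp mp).
  rewrite -mul_polyC -[X in topcoef _ X](add0n (_ * _)%N); apply: topcoefM.
    by split; rewrite ?coefC //; apply: size_polyC_leq1.
  rewrite mdegE big_distrl /= /mmap1.
  have -> : (\sum_(i < 3) mm i * m = mm o0 * m + mm o1 * m + mm o2 * m)%N.
    by rewrite -[LHS]/(\sum_(i < 3) _)%R sum3.
  have e (F : 'I_3 -> {poly R}) : \prod_i F i = F o0 * F o1 * F o2.
    by rewrite !big_ord_recl big_ord0 mulr1 mulrA; congr (F _ * F _ * F _); apply: val_inj.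
  have e' (F : 'I_3 -> R) : \prod_i F i = F o0 * F o1 * F o2.
    by rewrite !big_ord_recl big_ord0 mulr1 mulrA; congr (F _ * F _ * F _); apply: val_inj.
  have X j k : topcoef (h j ^+ k) (k * m) ((h j)`_m ^+ k).
    elim: k => [|k IH]; first by rewrite !expr0; split; rewrite ?size_poly1 ?coef1.
    by rewrite !exprS mulSn; apply: topcoefM => //; split.
  by rewrite e e'; apply: topcoefM => //; apply: topcoefM.
rewrite big_seq [X in topcoef _ _ X]big_seq.
apply: (big_ind2 (fun P c => topcoef P (d * m)%N c)) => [|P c P' c' [s1 <-] [s2 <-]|mm mp].
- by split; rewrite ?size_poly0 ?coef0.
- split; last by rewrite coefD.
  by apply: leq_trans (size_polyD _ _) _; rewrite geq_max s1.
by rewrite mul_polyC; apply: T.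
Qed.

End TopCoefficient.

Section SingularMember.
Variable K : numClosedFieldType.

Lemma gcd3_field (N : 'I_3 -> {poly K}) : (exists j, N j != 0) ->
  exists D (n m : 'I_3 -> {poly K}), (forall j, N j = D * n j) /\ \sum_j m j * n j = 1.
Proof.
move=> [j0 Nj0]; pose g := gcdp (gcdp (N o0) (N o1)) (N o2).
have dv j : exists q, N j = g * q.
  have /dvdpP [q ->] : g %| N j; last by exists q; rewrite mulrC.
  elim/forall3: j.
  - by apply: dvdp_trans (dvdp_gcdl _ _) (dvdp_gcdl _ _).
  - by apply: dvdp_trans (dvdp_gcdl _ _) (dvdp_gcdr _ _).
  exact: dvdp_gcdr.
have g0 : g != 0 by apply: contraNneq Nj0 => z; have [q ->] := dv j0; rewrite z mul0r.
have [q0 q0E] := dv o0; have [q1 q1E] := dv o1; have [q2 q2E] := dv o2.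
have [u /eqpP [[d1 d2] /= /andP [d10 d20] du]] := Bezoutp (N o0) (N o1).
have [v /eqpP [[e1 e2] /= /andP [e10 e20] ev]] := Bezoutp (gcdp (N o0) (N o1)) (N o2).
pose kk := (d2 * e2)^-1.
have kk0 : d2 * e2 != 0 by rewrite mulf_neq0.
exists g, (pt3 q0 q1 q2), (pt3 ((kk * e1 * d1)%:P * v.1 * u.1) ((kk * e1 * d1)%:P * v.1 * u.2) ((kk * e1 * d2)%:P * v.2)).
split; first exact: forall3.
apply: (mulfI g0); rewrite sum3 /pt3 /=.
transitivity (kk%:P * e1%:P * (v.1 * (d1 *: (u.1 * N o0 + u.2 * N o1)) + d2%:P * v.2 * N o2)).
  by rewrite q0E q1E q2E -!mul_polyC !rmorphM /=; ring.
rewrite du; transitivity (kk%:P * d2%:P * (e1 *: (v.1 * gcdp (N o0) (N o1) + v.2 * N o2))).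
  by rewrite -!mul_polyC; ring.
rewrite ev -/g -mul_polyC; transitivity ((kk * (d2 * e2))%:P * g); first by rewrite !rmorphM /=; ring.
by rewrite mulVf // mul1r mulr1.
Qed.

Lemma common_root_or_bezout (N : 'I_3 -> {poly K}) :
  (exists t, forall j, (N j).[t] = 0) \/
  (exists m : 'I_3 -> {poly K}, \sum_j m j * N j = 1).
Proof.
case: (boolP [exists j, N j != 0]) => [/existsP /gcd3_field [D [n [m [NE mn]]]]|/existsPn z].
  case: (boolP (size D == 1%N)) => [/size_poly1P [k k0 Dk]|/closed_rootP [t rt]].
    right; exists (fun j => k^-1%:P * m j); rewrite -[RHS]mn; apply: eq_bigr => j _.
    rewrite NE Dk; transitivity ((k^-1 * k)%:P * (m j * n j)); first by rewrite polyCM; ring.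
    by rewrite mulVf // mul1r.
  by left; exists t => j; rewrite NE hornerM (rootP rt) mul0r.
by left; exists 0 => j; have := z j; rewrite negbK => /eqP ->; rewrite horner0.
Qed.

Lemma mmap_CC_horner p (h : 'I_3 -> {poly {poly K}}) s t :
  (mmap (@CC K) h p).[t%:P].[s] = p.@[fun j => (h j).[t%:P].[s]].
Proof.
rewrite -[_.[s]]/(horner_eval s (horner_eval t%:P (mmap (@CC K) h p))).
rewrite !rmorph_mmap /=; apply: eq_mmap => [c|i] //=.
by rewrite /CC /= !horner_evalE !hornerC.
Qed.

Lemma horner2D (p q : {poly {poly K}}) s t :
  (p + q).[t%:P].[s] = p.[t%:P].[s] + q.[t%:P].[s].
Proof. by rewrite hornerD hornerD. Qed.

Lemma horner2N (p : {poly {poly K}}) s t : (- p).[t%:P].[s] = - p.[t%:P].[s].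
Proof. by rewrite hornerN hornerN. Qed.

Lemma horner2M (p q : {poly {poly K}}) s t :
  (p * q).[t%:P].[s] = p.[t%:P].[s] * q.[t%:P].[s].
Proof. by rewrite hornerM hornerM. Qed.

Lemma horner2X s t : ('X : {poly {poly K}}).[t%:P].[s] = t.
Proof. by rewrite hornerX hornerC. Qed.

Lemma horner2P (c : {poly K}) s t : (c%:P : {poly {poly K}}).[t%:P].[s] = c.[s].
Proof. by rewrite hornerC. Qed.

Lemma horner2CC c s t : (CC c : {poly {poly K}}).[t%:P].[s] = c.
Proof. by rewrite /CC /= !hornerC. Qed.

Definition horner2E := (horner2D, horner2N, horner2M, horner2X, horner2P, horner2CC).

Lemma evX_CC s c : evX s (CC c) = c%:P :> {poly K}.
Proof. by rewrite /evX /CC /= map_polyC /= horner_evalE hornerC. Qed.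

Lemma evX_mmap s p (h : 'I_3 -> {poly {poly K}}) :
  evX s (mmap (@CC K) h p) = mmap polyC (fun j => evX s (h j)) p.
Proof.
rewrite (@rmorph_mmap 3 K _ _ (@CC K) (evX s)).
by apply: eq_mmap => c /=; first exact: evX_CC.
Qed.

Lemma mmap_polyC_horner p (h : 'I_3 -> {poly K}) t :
  (mmap polyC h p).[t] = p.@[fun j => (h j).[t]].
Proof.
rewrite -[_.[t]]/(horner_eval t (mmap polyC h p)) rmorph_mmap.
by apply: eq_mmap => // c /=; rewrite horner_evalE hornerC.
Qed.

Definition dX : {poly {poly K}} -> {poly {poly K}} := map_poly (@deriv K).

Lemma dX_coef p i : (dX p)`_i = (p`_i)^`().
Proof. by rewrite coef_map. Qed.

Lemma dXD p q : dX (p + q) = dX p + dX q.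
Proof. exact: raddfD. Qed.

Lemma dXM p q : dX (p * q) = dX p * q + p * dX q.
Proof.
apply/polyP=> i; rewrite coefD dX_coef !coefM raddf_sum -big_split.
by apply: eq_bigr => j _; rewrite /= derivM !dX_coef.
Qed.

Lemma dX_CC c : dX (CC c) = 0.
Proof. by rewrite /dX /CC /= map_polyC /= derivC. Qed.

Variables (f g : triple K) (e : nat).
Hypotheses (hf : homog_triple 3 f) (hg : homog_triple e g).
Hypothesis fgX : forall X i j,
  (tnth f i).@[fun k => (tnth g k).@[X]] * X j = (tnth f j).@[fun k => (tnth g k).@[X]] * X i.
Variables A B C al be ga : 'I_3 -> K.
Hypotheses (alA : dot al A = 1) (alB : dot al B = 0) (alC : dot al C = 0).
Hypotheses (beA : dot be A = 0) (beB : dot be B = 1) (beC : dot be C = 0).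
Hypotheses (gaA : dot ga A = 0) (gaB : dot ga B = 0) (gaC : dot ga C = 1).
Hypothesis fgC : exists i, (tnth f i).@[fun k => (tnth g k).@[C]] != 0.

Let X i : {poly {poly K}} := CC (A i) + 'X%:P * CC (B i) + 'X * CC (C i).
Let G i : {poly {poly K}} := mmap (@CC K) X (tnth g i).

Lemma X_horner i s t : (X i).[t%:P].[s] = A i + s * B i + t * C i.
Proof. by rewrite /X /CC /= !hornerE. Qed.

Lemma dotCCX u : \sum_i CC (u i) * X i =
  CC (dot u A) + 'X%:P * CC (dot u B) + 'X * CC (dot u C).
Proof. by rewrite /dot !rmorph_sum /= !mulr_sumr -!big_split /=; apply: eq_bigr => i _; rewrite /X !rmorphM /=; ring. Qed.

(* The lines through [C] are parametrized by s, and the points of such a line by t. [Gt] is the image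
   by g of the generic one, freed of common factors, so that f o Gt = Psi (A + s B + t C). *)
Lemma pencil_parametrization : exists (Gt u : 'I_3 -> {poly {poly K}}) (Psi : {poly {poly K}})
    (c : {poly K}) (n : nat) (a : 'I_3 -> K),
  [/\ \sum_i u i * Gt i = c%:P, c != 0,
      forall i, mmap (@CC K) Gt (tnth f i) = X i * Psi,
      forall i, topcoef (Gt i) n (a i)%:P &
      exists i, (tnth f i).@[a] != 0].
Proof.
have XC i : (size (X i) <= 2)%N.
  rewrite /X; apply: leq_trans (size_polyD _ _) _; rewrite geq_max; apply/andP; split.
    rewrite (_ : _ + _ = ((A i)%:P + 'X * (B i)%:P)%:P); last by rewrite rmorphD rmorphM.
    by apply: leq_trans (size_polyC_leq1 _) _.
  apply: leq_trans (size_polyMleq _ _) _.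
  by rewrite size_polyX; apply: leq_trans (size_polyC_leq1 _) _.
have topG i : topcoef (G i) e ((tnth g i).@[C])%:P.
  have := mmap_topcoef polyC (hg i) XC; rewrite muln1.
  suff -> : mmap polyC (fun j => (X j)`_1) (tnth g i) = ((tnth g i).@[C])%:P by [].
  rewrite -[RHS]/(polyC (mmap idfun C _)) rmorph_mmap; apply: eq_mmap => // j.
  by rewrite /X !coefD coefC /CC coefCM coefXM coefC mulr0 !add0r coefC.
have [i1 fi1] := fgC.
have [k1 gk1] : exists k, (tnth g k).@[C] != 0.
  case: (boolP [exists k, (tnth g k).@[C] != 0]) => [/existsP //|/existsPn z].
  case/eqP: fi1; rewrite (_ : meval _ _ = mmap idfun (fun k => 0 * C k) (tnth f i1)).
    by rewrite (mmap_homogZ _ _ _ (hf i1)) expr0n mul0r.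
  by apply: eq_mmap => // k; rewrite mul0r; apply/eqP; have := z k; rewrite negbK.
have Gk0 : G k1 != 0.
  have [_ e1] := topG k1; apply: contraNneq gk1 => z.
  by move: e1; rewrite z coef0 => /esym/eqP; rewrite polyC_eq0.
have [h [Gt [u [c [GE uE c0 h0]]]]] := gcd3 (ex_intro _ k1 Gk0).
have GtE i : Gt i = 0 \/ (size h + size (Gt i) <= e.+2)%N.
  case: (eqVneq (Gt i) 0) => [->|q0]; [by left|right].
  have [s1 _] := topG i; move: s1; rewrite GE size_mul //.
  by move: h0; rewrite -size_poly_gt0; case: (size h).
pose m := (size h).-1; have sh : size h = m.+1 by rewrite /m prednK // size_poly_gt0.
have me : (m <= e)%N.
  have q0 : Gt k1 != 0 by apply: contraNneq Gk0 => z; rewrite GE z mulr0.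
  case: (GtE k1) => [z|]; first by rewrite z eqxx in q0.
  rewrite sh addSn ltnS; move: q0; rewrite -size_poly_gt0; case: (size _) => // k _.
  by rewrite addnS ltnS; apply: leq_trans; apply: leq_addr.
pose n := (e - m)%N.
have sGt i : (size (Gt i) <= n.+1)%N.
  case: (GtE i) => [->|]; first by rewrite size_poly0.
  by rewrite sh addSn ltnS /n -subSn // leq_subRL // leqW.
have top i : h`_m * (Gt i)`_n = ((tnth g i).@[C])%:P.
  have th : topcoef h m h`_m by split; rewrite ?sh.
  have tG : topcoef (Gt i) n (Gt i)`_n by split.
  have [_ <-] := topcoefM th tG; have [_ <-] := topG i.
  by rewrite GE /n subnKC.
(* The product of the top coefficients of h and of [Gt] is g(C), which does not involve s and is
   nonzero for the index [k1]; so the one of h is constant, and therefore also those of [Gt]. *)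
have [k k0 hk] : exists2 k, k != 0 & h`_m = k%:P.
  have := top k1 => e1; have : size (h`_m * (Gt k1)`_n) = 1%N by rewrite e1 size_polyC gk1.
  have lh : h`_m != 0 by rewrite -[h`_m]/(lead_coef h) lead_coef_eq0.
  have lq : (Gt k1)`_n != 0.
    by apply: contraNneq gk1 => z; move: e1; rewrite z mulr0 => /esym/eqP; rewrite polyC_eq0.
  rewrite size_mul // => s1.
  have /size_poly1P [k k0 ->] : size h`_m == 1%N; last by exists k.
  move: lh lq s1; rewrite -!size_poly_gt0; case: (size _) => // a; case: (size _) => // b _ _.
  by rewrite addSn addnS /= => /eqP; rewrite !eqSS addn_eq0 => /andP [].
have fX i j : mmap (@CC K) Gt (tnth f i) * X j = mmap (@CC K) Gt (tnth f j) * X i.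
  have h3 : h ^+ 3 != 0 by rewrite expf_neq0.
  apply: (mulfI h3); rewrite !mulrA -!(mmap_homogZ _ _ _ (hf _)).
  apply/eqP; rewrite -subr_eq0; apply/eqP; apply: bipoly_dense => s t.
  rewrite horner2D horner2N 2!horner2M !mmap_CC_horner !X_horner.
  pose x j := A j + s * B j + t * C j.
  have ev l : (tnth f l).@[fun j => (h * Gt j).[t%:P].[s]] = (tnth f l).@[fun k => (tnth g k).@[x]].
    apply: meval_eq => l'; rewrite -GE mmap_CC_horner; apply: meval_eq => l2; exact: X_horner.
  by rewrite !ev -/(x i) -/(x j) (fgX x) subrr.
exists Gt, u, (\sum_j CC (al j) * mmap (@CC K) Gt (tnth f j)), c, n, (fun i => (tnth g i).@[C] / k).
split=> //.
- move=> i; rewrite mulr_sumr.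
  transitivity (mmap (@CC K) Gt (tnth f i) * \sum_j CC (al j) * X j).
    by rewrite dotCCX alA alB alC !rmorph0 !mulr0 !addr0 rmorph1 mulr1.
  by rewrite mulr_sumr; apply: eq_bigr => j _; rewrite mulrCA fX; ring.
- move=> i; split=> //.
  have k00 : k%:P != 0 :> {poly K} by rewrite polyC_eq0.
  by apply: (mulfI k00); rewrite -{1}hk top -polyCM mulrC divfK.
exists i1; apply: contraNneq fi1 => z.
rewrite (_ : meval _ _ = mmap idfun (fun j => k * ((tnth g j).@[C] / k)) (tnth f i1)).
  by rewrite (mmap_homogZ _ _ _ (hf i1)) -[mmap _ _ _]/((tnth f i1).@[_]) z mulr0.
by apply: eq_mmap => // j; rewrite mulrC divfK.
Qed.

(* The Wronskian [cross phi phi'] of a parametrization of the cubic [F] is parallel to the gradient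
   along the curve; were the gradient nowhere zero, it would be a polynomial multiple of it, which
   degrees forbid: a smooth cubic has no rational parametrization. *)
Lemma smooth_cubic_not_rational (F : {mpoly K[3]}) (phi D : 'I_3 -> {poly K}) (P : {poly K}) n
    (N := fun j => mmap polyC phi (F^`M(j))) :
  F \is 3.-homog -> mmap polyC phi F = 0 -> \sum_j N j * D j = - P ->
  (forall t, exists j, (phi j).[t] != 0) ->
  (0 < n)%N -> (forall j, (size (phi j) <= n.+1)%N) -> (exists j, (phi j)`_n != 0) ->
  (forall j, (size (D j) <= n)%N) -> P`_(3 * n).-1 != 0 ->
  exists t, forall j, (N j).[t] = 0.
Proof.
move=> hF Fphi ND cphi n0 sphi [j0 phin] sD Pn.
have S1 : N o0 * phi o0 + N o1 * phi o1 + N o2 * phi o2 = 0.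
  have := congr1 (mmap polyC phi) (euler hF).
  rewrite mmapZ Fphi mulr0 rmorph_sum sum3 /= !rmorphM /= !mmapX !mmap1U => <-.
  by rewrite /N; ring.
have S2 : N o0 * (phi o0)^`() + N o1 * (phi o1)^`() + N o2 * (phi o2)^`() = 0.
  have := @mmap_chain 3 K {poly K} polyC phi _ F (@derivD K) (@derivM K) (@derivC K).
  by rewrite Fphi deriv0 sum3 => <-.
(* If all partial derivatives had degree at most 2n - 1 along the curve, the left side of [ND] would
   have degree at most 3n - 2, whereas P has a nonzero coefficient in degree 3n - 1. *)
case: (boolP [forall j, (size (N j) <= 2 * n)%N]) => [/forallP sN|].
  case/eqP: Pn; apply/eqP; rewrite -oppr_eq0 -coefN -ND coef_sum big1 // => j _.
  apply: nth_default; apply: leq_trans (size_polyMleq _ _) _.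
  rewrite -!subn1; apply: leq_sub2r; rewrite mulSn addnC.
  by apply: leq_add.
rewrite negb_forall => /existsP [j1]; rewrite -ltnNge => sN1.
have [//|[m mN]] := common_root_or_bezout N.
pose W := cross phi (fun j => (phi j)^`()).
have sd j : (size (phi j)^`() <= n)%N.
  case: (eqVneq (phi j) 0) => [->|p0]; first by rewrite deriv0 size_poly0.
  by rewrite -ltnS; apply: leq_trans (lt_size_deriv p0) (sphi j).
have sW j : (size (W j) <= 2 * n)%N.
  have s2 k l : (size (phi k * (phi l)^`())%R <= 2 * n)%N.
    rewrite mulSn mul1n; apply: leq_trans (size_polyMleq _ _) _.
    by rewrite -subn1 leq_subLR add1n -addSn leq_add.
  by elim/forall3: j; apply: size_subr_le; rewrite ?s2.
have W01 : W o0 * N o1 = W o1 * N o0.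
  apply/eqP; rewrite -subr_eq0; apply/eqP.
  transitivity ((phi o2)^`() * 0 - phi o2 * (0 : {poly K})); last by ring.
  by rewrite -{1}S1 -S2 /W /cross /pt3 /=; ring.
have W12 : W o1 * N o2 = W o2 * N o1.
  apply/eqP; rewrite -subr_eq0; apply/eqP.
  transitivity ((phi o0)^`() * 0 - phi o0 * (0 : {poly K})); last by ring.
  by rewrite -{1}S1 -S2 /W /cross /pt3 /=; ring.
have W20 : W o2 * N o0 = W o0 * N o2.
  apply/eqP; rewrite -subr_eq0; apply/eqP.
  transitivity ((phi o1)^`() * 0 - phi o1 * (0 : {poly K})); last by ring.
  by rewrite -{1}S1 -S2 /W /cross /pt3 /=; ring.
pose r := \sum_j m j * W j.
have WE j : W j = r * N j.
  rewrite -[LHS]mulr1 -mN /r !sum3; elim/forall3: j.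
  - transitivity (m o0 * N o0 * W o0 + m o1 * (W o0 * N o1) + m o2 * (W o0 * N o2)); first by ring.
    by rewrite W01 -W20; ring.
  - transitivity (m o0 * (W o1 * N o0) + m o1 * N o1 * W o1 + m o2 * (W o1 * N o2)); first by ring.
    by rewrite -W01 W12; ring.
  transitivity (m o0 * (W o2 * N o0) + m o1 * (W o2 * N o1) + m o2 * N o2 * W o2); first by ring.
  by rewrite W20 -W12; ring.
(* [W] has degree at most 2n - 1 while [N j1] has degree at least 2n, so the multiplier must
   vanish. *)
have r0 : r = 0.
  apply/eqP; apply: contraTT (sW j1) => r0; rewrite WE -ltnNge.
  have Nj : N j1 != 0 by rewrite -size_poly_gt0; apply: leq_trans sN1.
  rewrite size_mul //; apply: leq_trans sN1 _.
  by move: r0; rewrite -size_poly_gt0; case: (size r) => // k _; rewrite addSn leq_addl.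
have W0 j : W j = 0 by rewrite WE r0 mul0r.
have par k l : phi k * (phi l)^`() = phi l * (phi k)^`().
  have e0 := W0 o0; have e1 := W0 o1; have e2 := W0 o2.
  rewrite /W /cross /pt3 /= in e0 e1 e2.
  move/eqP: e0; rewrite subr_eq0 => /eqP e0; move/eqP: e1; rewrite subr_eq0 => /eqP e1.
  move/eqP: e2; rewrite subr_eq0 => /eqP e2.
  by elim/forall3: k; elim/forall3: l; rewrite // ?e0 ?e1 ?e2.
have [[t ht]|[u uphi]] := common_root_or_bezout phi.
  by have [j] := cphi t; rewrite ht eqxx.
have pj0 : phi j0 != 0 by apply: contraNneq phin => ->; rewrite coef0.
(* Now phi' is parallel to phi, which has no common zero; a Bezout relation shows that [phi j0]
   divides its own derivative, which is therefore zero. This contradicts its positive degree n. *)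
have cfrac0 : (phi j0)^`() = 0.
  apply/eqP; apply: contraTT (lt_size_deriv pj0) => dz; rewrite -leqNgt.
  have ePhi : (phi j0)^`() = phi j0 * \sum_j u j * (phi j)^`().
    rewrite -[LHS]mul1r -uphi mulr_suml mulr_sumr; apply: eq_bigr => j _.
    by rewrite -mulrA par mulrCA.
  have s0 : \sum_j u j * (phi j)^`() != 0.
    by apply: contraNneq dz => z; rewrite ePhi z mulr0.
  rewrite ePhi size_mul //; move: s0; set S := (X in X != 0).
  by rewrite -size_poly_gt0; case: (size S) => // k _; rewrite addnS leq_addr.
have := congr1 (fun q : {poly K} => q`_n.-1) cfrac0; rewrite coef_deriv coef0 prednK //.
by move/eqP; rewrite -mulr_natr mulf_eq0 (negPf phin) pnatr_eq0 (gtn_eqF n0).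
Qed.

Lemma evX_line s (a b c : K) :
  evX s (CC a + 'X%:P * CC b + 'X * CC c) = (a + s * b)%:P + 'X * c%:P.
Proof.
rewrite (rmorphD (evX s)) (rmorphD (evX s)) 2!(rmorphM (evX s)) /= !evX_CC.
have -> : evX s 'X%:P = s%:P by rewrite /evX map_polyC /= horner_evalE hornerX.
have -> : evX s 'X = 'X by rewrite /evX map_polyX.
by rewrite rmorphD rmorphM.
Qed.

(* Differentiating f o Gt = Psi (A + s B + t C) in s shows that the gradient of the member of the
   pencil does not vanish at Gt (s, t) unless Psi does, that is, unless Gt (s, t) is a base point. *)
Lemma singular_member : aa (fun s => exists b : 'I_3 -> K,
  [/\ exists i, b i != 0, forall k, (tnth f k).@[b] = 0 &
      forall j, \sum_k (s * al k - be k) * ((tnth f k)^`M(j)).@[b] = 0]).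
Proof.
have [Gt [u [Psi [c [n [a [uE c0 fG topG [k0 fa]]]]]]]] := pencil_parametrization.
apply: aa_mono (aa_root c0) => s cs.
(* The equation of the line through C and A + s B; [F] is the cubic of the net that f maps into this
   line. *)
pose lam k := s * al k - be k.
pose phi j := evX s (Gt j); pose P := evX s Psi; pose X0 k := evX s (X k).
pose F : {mpoly K[3]} := \sum_k lam k *: tnth f k.
have hF : F \is 3.-homog.
  by rewrite /F sum3 !rpredD // rpredZ // hf.
have X0E k : X0 k = (A k + s * B k)%:P + 'X * (C k)%:P by apply: evX_line.
have fphi k : mmap polyC phi (tnth f k) = X0 k * P.
  by rewrite -evX_mmap fG rmorphM.
have dl v : dot lam v = s * dot al v - dot be v.
  by rewrite /dot mulr_sumr -sumrB; apply: eq_bigr => k _; rewrite /lam; ring.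
have evlin (v : 'I_3 -> K) (Y : 'I_3 -> {poly {poly K}}) :
    \sum_k (v k)%:P * evX s (Y k) = evX s (\sum_k CC (v k) * Y k).
  by rewrite rmorph_sum; apply: eq_bigr => k _; rewrite rmorphM /= evX_CC.
have lamX : \sum_k (lam k)%:P * X0 k = 0.
  rewrite evlin dotCCX evX_line !dl alA alB alC beA beB beC mulr0 subrr mulr0 addr0.
  by rewrite -(rmorph0 polyC); congr (_%:P); ring.
have Fphi : mmap polyC phi F = 0.
  transitivity ((\sum_k (lam k)%:P * X0 k) * P); last by rewrite lamX mul0r.
  rewrite rmorph_sum mulr_suml; apply: eq_bigr => k _ /=.
  by rewrite mmapZ fphi mulrA.
have NE j : mmap polyC phi (F^`M(j)) = \sum_k (lam k)%:P * evX s (mmap (@CC K) Gt ((tnth f k)^`M(j))).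
  rewrite /F (raddf_sum (mderiv j)) raddf_sum; apply: eq_bigr => k _ /=.
  by rewrite mderivZ mmapZ evX_mmap.
have ND : \sum_j mmap polyC phi (F^`M(j)) * evX s (dX (Gt j)) = - P.
  transitivity (evX s (\sum_k CC (lam k) * dX (mmap (@CC K) Gt (tnth f k)))).
    rewrite -evlin.
    under [RHS]eq_bigr => k _ do rewrite (@mmap_chain 3 K {poly {poly K}} (@CC K) Gt dX (tnth f k) dXD dXM dX_CC) rmorph_sum mulr_sumr.
    rewrite exchange_big; apply: eq_bigr => j _ /=; rewrite NE mulr_suml.
    by apply: eq_bigr => k _; rewrite rmorphM /= mulrA.
  rewrite -evlin.
  have dXX k : dX (X k) = CC (B k).
    have d1 : dX 'X%:P = 1 by rewrite /dX map_polyC /= derivX.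
    have d2 : dX 'X = 0.
      by apply/polyP=> i; rewrite dX_coef coefX coef0; case: eqP; rewrite ?derivC ?deriv0 // -(rmorph1 polyC) derivC.
    by rewrite /X 2!dXD 2!dXM !dX_CC d1 d2; ring.
  transitivity ((\sum_k (lam k)%:P * (B k)%:P) * P + (\sum_k (lam k)%:P * X0 k) * evX s (dX Psi)).
    rewrite !mulr_suml -big_split; apply: eq_bigr => k _ /=.
    by rewrite fG dXM dXX (rmorphD (evX s)) 2!(rmorphM (evX s)) /= evX_CC -/(X0 k) -/P; ring.
  rewrite lamX mul0r addr0; under eq_bigr => k _ do rewrite -rmorphM.
  by rewrite -rmorph_sum /= -/(dot lam B) dl alB beB mulr0 sub0r rmorphN rmorph1 mulN1r.
have cphi t : exists j, (phi j).[t] != 0.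
  case: (boolP [exists j, (phi j).[t] != 0]) => [/existsP //|/existsPn z].
  have z0 j : (phi j).[t] = 0 by apply/eqP; have := z j; rewrite negbK.
  have := congr1 (fun q : {poly {poly K}} => (evX s q).[t]) uE.
  rewrite /= rmorph_sum sum3 !(rmorphM (evX s)) /= -!/(phi _) !hornerD !hornerM !z0 !mulr0 !addr0.
  by rewrite evX_horner hornerC => /esym/eqP; rewrite (negPf cs).
have sphi j : (size (phi j) <= n.+1)%N.
  by have [sG _] := topG j; apply: leq_trans (size_poly _ _) sG.
have phin j : (phi j)`_n = a j by have [_ tE] := topG j; rewrite /phi evX_coef tE hornerC.
have fphi_top k : topcoef (X0 k * P) (3 * n) (tnth f k).@[a].
  rewrite -fphi; have := @mmap_topcoef K K idfun phi 3 n _ (hf k) sphi.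
  by congr (topcoef _ _ _); apply: eq_mmap.
have ga_XP : 'X * P = \sum_k (ga k)%:P * (X0 k * P).
  under eq_bigr => k _ do rewrite mulrA.
  by rewrite -mulr_suml evlin dotCCX evX_line gaA gaB gaC mulr0 addr0 rmorph0 add0r rmorph1 mulr1.
have sXP : (size ('X * P)%R <= (3 * n).+1)%N.
  have sk k : (size ((ga k)%:P * (X0 k * P))%R <= (3 * n).+1)%N.
    by rewrite mul_polyC; apply: leq_trans (size_scale_leq _ _) _; case: (fphi_top k).
  by rewrite ga_XP sum3; apply: size_addr_le (sk _); apply: size_addr_le.
have P0 : P != 0.
  by apply: contraNneq fa => z; have [_ <-] := fphi_top k0; rewrite z mulr0 coef0.
have sP : (size P <= 3 * n)%N by move: sXP; rewrite size_mul ?polyX_eq0 // size_polyX /= ltnS.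
have n0 : (0 < n)%N.
  by case: (posnP n) sP => // ->; rewrite muln0 leqn0 size_poly_eq0 (negPf P0).
have n30 : (0 < 3 * n)%N by rewrite muln_gt0.
(* X0 P has the nonzero vector f(a) as its coefficient in degree 3n, and X0 is linear in t with
   leading vector C. *)
have Pn : P`_(3 * n).-1 != 0.
  apply: contraNneq fa => z; have [_ <-] := fphi_top k0.
  rewrite X0E mulrDl coefD coefCM (nth_default _ sP) mulr0 add0r -mulrA coefXM gtn_eqF //.
  by rewrite coefCM z mulr0.
(* The coefficient of degree n of [Gt] does not depend on s, so differentiation in s removes it; the
   degree count for the gradient rests on this loss of one degree. *)
have sD j : (size (evX s (dX (Gt j))) <= n)%N.
  have [sG tE] := topG j; apply/leq_sizeP => i ni; rewrite evX_coef dX_coef.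
  case: (eqVneq i n) => [->|ne]; first by rewrite tE derivC horner0.
  rewrite (nth_default _) ?deriv0 ?horner0 //; apply: leq_trans sG _.
  by rewrite ltn_neqAle eq_sym ne.
have [|t ht] := smooth_cubic_not_rational hF Fphi ND cphi n0 sphi _ sD Pn.
  have [j aj] : exists j, a j != 0.
    case: (boolP [exists j, a j != 0]) => [/existsP //|/existsPn z].
    case/eqP: fa; rewrite (_ : meval _ _ = mmap idfun (fun j => 0 * a j) (tnth f k0)).
      by rewrite (mmap_homogZ _ _ _ (hf k0)) expr0n mul0r.
    by apply: eq_mmap => // j; rewrite mul0r; apply/eqP; have := z j; rewrite negbK.
  by exists j; rewrite phin.
exists (fun j => (phi j).[t]); split=> //.
- move=> k; rewrite -mmap_polyC_horner fphi hornerM.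
  suff -> : P.[t] = 0 by rewrite mulr0.
  have := congr1 (horner^~ t) ND; rewrite /= sum3 !hornerD !hornerM !ht !mul0r !addr0 hornerN.
  by move/esym/eqP; rewrite oppr_eq0 => /eqP.
move=> j; rewrite -[RHS](ht j) mmap_polyC_horner /F (raddf_sum (mderiv j)) [RHS]raddf_sum.
by apply: eq_bigr => k _ /=; rewrite mderivZ mevalZ.
Qed.

End SingularMember.

(** * The double point *)

Section DoublePoint.
Variable K : numClosedFieldType.

Lemma pigeonhole (T U : eqType) (S : seq T) (B : seq U) (R : T -> U -> Prop) :
  uniq S -> (size B < size S)%N -> (forall s, s \in S -> exists2 b, b \in B & R s b) ->
  exists s s' b, [/\ s != s', b \in B, R s b & R s' b].
Proof.
move=> uS szS h.
have [L LS LB] : exists2 L : seq (T * U), unzip1 L = S &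
    forall x, x \in L -> x.2 \in B /\ R x.1 x.2.
  elim: S {uS szS} h => [|s S IH] h; first by exists [::].
  have [L LS LB] := IH (fun x xS => h x (@mem_behead _ (s :: S) x xS)).
  have [b bB Rb] := h s (mem_head _ _).
  exists ((s, b) :: L); first by rewrite /= LS.
  by move=> x; rewrite inE => /orP [/eqP -> //|/LB].
have nu : ~~ uniq (unzip2 L).
  apply: contraL szS => u2; rewrite -leqNgt -LS size_map -(size_map snd).
  by apply: uniq_leq_size => // y /mapP [x xL ->]; have [] := LB x xL.
have : exists x y, [/\ x \in L, y \in L, x.2 = y.2 & x.1 != y.1].
  elim: L S LS LB nu uS {szS h} => [|x L IH] S LS LB //=.
  rewrite negb_and negbK => /orP [/mapP [y yL xy]|nu] uS.
    exists x, y; rewrite !inE eqxx yL orbT; split=> //.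
    move: uS; rewrite -LS /= => /andP [xn _]; apply: contraNneq xn => ->; exact: map_f.
  have [] := IH (unzip1 L) erefl _ nu.
  - by move=> z zL; apply: LB; rewrite inE zL orbT.
  - by move: uS; rewrite -LS /= => /andP [].
  by move=> a [b [aL bL h1 h2]]; exists a, b; rewrite !inE aL bL !orbT.
move=> [x [y [xL yL e ne]]]; have [xB Rx] := LB x xL; have [yB Ry] := LB y yL.
by exists x.1, y.1, x.2; split=> //; rewrite e.
Qed.

Lemma aa_pigeonhole (U : eqType) (B : seq U) (R : K -> U -> Prop) :
  aa (fun s => exists2 b, b \in B & R s b) ->
  exists s s' b, [/\ s != s', b \in B, R s b & R s' b].
Proof.
move=> [E hE].
have [S [uS sS SE]] : exists S : seq K, [/\ uniq S, size S = (size B).+1 &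
    forall x, x \in S -> x \notin E].
  elim: (size B).+1 => [|n [S [uS sS SE]]]; first by exists [::].
  have [x] := Kinf (E ++ S); rewrite mem_cat negb_or => /andP [xE xS].
  exists (x :: S); split; rewrite /= ?xS ?sS // => y.
  by rewrite inE => /orP [/eqP->|/SE].
by apply: (pigeonhole uS); rewrite ?sS // => s /SE/hE.
Qed.

Lemma line_generic n (p : {mpoly K[n]}) (u v : 'I_n -> K) :
  p.@[u] != 0 -> aa (fun t => p.@[fun i => u i + t * v i] != 0).
Proof.
move=> pu; pose q := mmap polyC (fun i => (u i)%:P + 'X * (v i)%:P) p.
have qE t : q.[t] = p.@[fun i => u i + t * v i].
  rewrite -[_.[t]]/(horner_eval t q) rmorph_mmap; apply: eq_mmap => [c|i] /=.
    by rewrite horner_evalE hornerC.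
  by rewrite horner_evalE !hornerE.
have q0 : q != 0.
  apply: contraNneq pu => q0.
  have <- : p.@[fun i => u i + 0 * v i] = p.@[u].
    by apply: meval_eq => i; rewrite mul0r addr0.
  by rewrite -qE q0 horner0.
by apply: aa_mono (aa_root q0) => t; rewrite qE.
Qed.

Variables (f g : triple K) (e : nat).
Hypotheses (hf : homog_triple 3 f) (cop : no_common_factor f) (hg : homog_triple e g).
Hypothesis fgX : forall X i j,
  (tnth f i).@[fun k => (tnth g k).@[X]] * X j = (tnth f j).@[fun k => (tnth g k).@[X]] * X i.
Hypothesis fg0 : exists X k, (tnth f k).@[fun k => (tnth g k).@[X]] != 0.

Definition double_point (b : 'I_3 -> K) :=
  [/\ exists i, b i != 0, forall k, (tnth f k).@[b] = 0 &
      forall j k, ((tnth f k)^`M(j)).@[b] = 0].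

Let good C := (exists k, C k != 0) /\ (exists k, (tnth f k).@[fun k => (tnth g k).@[C]] != 0).

Lemma dual_basis (C : 'I_3 -> K) : (exists k, C k != 0) ->
  exists A B al be ga : 'I_3 -> K, [/\ 
    [/\ dot al A = 1, dot al B = 0 & dot al C = 0],
    [/\ dot be A = 0, dot be B = 1 & dot be C = 0],
    [/\ dot ga A = 0, dot ga B = 0 & dot ga C = 1] &
    forall v, dot al v = 0 -> dot be v = 0 -> forall i l, v i * C l = v l * C i].
Proof.
have fin (v : 'I_3 -> K) : v o0 * C o1 = v o1 * C o0 -> v o1 * C o2 = v o2 * C o1 ->
    v o2 * C o0 = v o0 * C o2 -> forall i l, v i * C l = v l * C i.
  by move=> h1 h2 h3; apply: forall3; apply: forall3.
move=> [k]; elim/forall3: k => Ck.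
- exists (pt3 0 1 0), (pt3 0 0 1), (pt3 (- (C o1 / C o0)) 1 0), (pt3 (- (C o2 / C o0)) 0 1), (pt3 (C o0)^-1 0 0).
  split; rewrite /dot ?sum3 /pt3 /=; try by split; field.
  move=> v; rewrite !sum3 /= => h1 h2.
  have e1 : v o1 = C o1 / C o0 * v o0 by apply/eqP; rewrite -subr_eq0 -h1; apply/eqP; ring.
  have e2 : v o2 = C o2 / C o0 * v o0 by apply/eqP; rewrite -subr_eq0 -h2; apply/eqP; ring.
  by apply: fin; rewrite ?e1 ?e2; field.
- exists (pt3 0 0 1), (pt3 1 0 0), (pt3 0 (- (C o2 / C o1)) 1), (pt3 1 (- (C o0 / C o1)) 0), (pt3 0 (C o1)^-1 0).
  split; rewrite /dot ?sum3 /pt3 /=; try by split; field.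
  move=> v; rewrite !sum3 /= => h1 h2.
  have e1 : v o2 = C o2 / C o1 * v o1 by apply/eqP; rewrite -subr_eq0 -h1; apply/eqP; ring.
  have e2 : v o0 = C o0 / C o1 * v o1 by apply/eqP; rewrite -subr_eq0 -h2; apply/eqP; ring.
  by apply: fin; rewrite ?e1 ?e2; field.
exists (pt3 1 0 0), (pt3 0 1 0), (pt3 1 0 (- (C o0 / C o2))), (pt3 0 1 (- (C o1 / C o2))), (pt3 0 0 (C o2)^-1).
split; rewrite /dot ?sum3 /pt3 /=; try by split; field.
move=> v; rewrite !sum3 /= => h1 h2.
have e1 : v o0 = C o0 / C o2 * v o2 by apply/eqP; rewrite -subr_eq0 -h1; apply/eqP; ring.
have e2 : v o1 = C o1 / C o2 * v o2 by apply/eqP; rewrite -subr_eq0 -h2; apply/eqP; ring.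
by apply: fin; rewrite ?e1 ?e2; field.
Qed.

(** The partial derivatives of f at b, as vectors of the target, are multiples of C: all cubics of
    the net that come from lines through C are singular at b. *)
Let singular_dir C (b : 'I_3 -> K) := [/\ exists i, b i != 0, forall k, (tnth f k).@[b] = 0 &
  forall j i l, ((tnth f i)^`M(j)).@[b] * C l = ((tnth f l)^`M(j)).@[b] * C i].

(** Two members of a pencil that are singular at the same base point make all of its members
    singular there: two values of s separate the conditions on [al] and [be], which together say
    parallel to C. *)
Lemma singular_direction (B : seq (K * K * K)) C :
  (forall x : 'I_3 -> K, (exists i, x i != 0) -> (forall i, (tnth f i).@[x] = 0) ->
    exists2 b, b \in B & exists2 c, c != 0 & forall i, x i = c * pt3 b.1.1 b.1.2 b.2 i) ->
  good C -> exists2 b, b \in B & singular_dir C (pt3 b.1.1 b.1.2 b.2).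
Proof.
move=> hB [C0 fC].
have [A [Bv [al [be [ga [[a1 a2 a3] [b1 b2 b3] [c1 c2 c3] par]]]]]] := dual_basis C0.
have := singular_member hf hg fgX a1 a2 a3 b1 b2 b3 c1 c2 c3 fC.
pose R s (b : K * K * K) := let p := pt3 b.1.1 b.1.2 b.2 in
  [/\ exists i, p i != 0, forall k, (tnth f k).@[p] = 0 &
      forall j, \sum_k (s * al k - be k) * ((tnth f k)^`M(j)).@[p] = 0].
move=> h; have /aa_pigeonhole [s [s' [b [ss bB [R1 R2 R3] [_ _ R3']]]]] :
    aa (fun s => exists2 b, b \in B & R s b).
  apply: aa_mono h => s [x [x0 fx sx]].
  have [b bB [c c0 xE]] := hB x x0 fx; exists b => //.
  split.
  - by have [i xi] := x0; exists i; apply: contraNneq xi => z; rewrite xE z mulr0.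
  - move=> k; apply: (mulfI (expf_neq0 3 c0)); rewrite mulr0 -(fx k).
    by rewrite -(mmap_homogZ _ _ _ (hf k)); apply: eq_mmap => // i; rewrite xE.
  move=> j; apply: (mulfI (expf_neq0 2 c0)); rewrite mulr0 -[RHS](sx j) mulr_sumr.
  apply: eq_bigr => k _; rewrite mulrCA; congr (_ * _).
  rewrite -(mmap_homogZ _ _ _ (mderiv_homog j (hf k))).
  by apply: eq_mmap => // i; rewrite xE.
exists b => //; split=> // j; apply: par.
  have d0 : s - s' != 0 by rewrite subr_eq0.
  apply: (mulfI d0); rewrite mulr0; have e1 := R3 j; have e2 := R3' j.
  transitivity (1 * 0 - 1 * 0 : K); last by rewrite !mulr0 subrr.
  rewrite -[X in 1 * X - _]e1 -[X in _ - 1 * X]e2 /dot !mulr_sumr -sumrB.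
  by apply: eq_bigr => k _; ring.
have d0 : s - s' != 0 by rewrite subr_eq0.
apply: (mulfI d0); rewrite mulr0; have e1 := R3 j; have e2 := R3' j.
transitivity (s' * 0 - s * 0 : K); last by rewrite !mulr0 subrr.
rewrite -[X in s' * X]e1 -[X in s * X]e2 /dot !mulr_sumr -sumrB.
by apply: eq_bigr => k _; ring.
Qed.

(* There are finitely many base points, but infinitely many cubics in a pencil and infinitely many
   pencils in the net. *)
Lemma exists_double_point : exists b, double_point b.
Proof.
have [B hB] := base_finite hf cop.
have [C0 [k0 [C00 fC0]]] : exists C k, C o0 != 0 /\ (tnth f k).@[fun k => (tnth g k).@[C]] != 0.
  have [X [k fX]] := fg0.
  have qX : 'X_o0 * (tnth f k \mPo g) != 0.
    rewrite mulf_neq0 //; last by apply: contraNneq fX => z; rewrite -comp_mpoly_meval z meval0.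
    apply/eqP=> z; have := congr1 (meval (fun=> 1)) z.
    by rewrite mevalXU meval0 => /eqP; rewrite oner_eq0.
  have [C] := mpoly_nonvanishing qX; rewrite mevalM mevalXU comp_mpoly_meval mulf_eq0 negb_or.
  by move=> /andP [h1 h2]; exists C, k.
(* The centres have the same nonzero coordinate 0 and distinct coordinates 1, so no two of them are
   proportional. Derivatives parallel to two such centres vanish. *)
pose C t := fun i => C0 i + t * pt3 0 1 0 i.
have gC : aa (fun t => exists2 b, b \in B & singular_dir (C t) (pt3 b.1.1 b.1.2 b.2)).
  have qC : (tnth f k0 \mPo g).@[C0] != 0 by rewrite comp_mpoly_meval.
  apply: aa_mono (line_generic (pt3 0 1 0) qC) => t; rewrite comp_mpoly_meval => h.
  apply: singular_direction hB _; split; last by exists k0.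
  by exists o0; rewrite /C /pt3 /= mulr0 addr0.
have [t [t' [b [tt _ [b0 fb h1] [_ _ h2]]]]] := aa_pigeonhole gC.
exists (pt3 b.1.1 b.1.2 b.2); split=> // j.
have J0 : ((tnth f o0)^`M(j)).@[pt3 b.1.1 b.1.2 b.2] = 0.
  have d0 : (t - t') != 0 by rewrite subr_eq0.
  apply: (mulfI d0); rewrite mulr0; have := h1 j o0 o1; have := h2 j o0 o1.
  rewrite /C /pt3 /= !mulr0 !mulr1 !addr0 => e2 e1.
  rewrite -[RHS](subrr (((tnth f o1)^`M(j)).@[pt3 b.1.1 b.1.2 b.2] * C0 o0)) -{1}e1 -e2.
  by rewrite /pt3; ring.
move=> k; apply: (mulIf C00); rewrite mul0r; have := h1 j o0 k.
by rewrite J0 mul0r /C /pt3 /= mulr0 addr0.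
Qed.

End DoublePoint.

(** * Cubics with a double point *)

Section Generic.
Variable K : numClosedFieldType.

Lemma aa_poly0 (p : {poly K}) : aa (fun x => p.[x] = 0) -> p = 0.
Proof.
move=> h; apply/eqP; apply: contraT => /aa_root h'.
by have [x [-> ]] := aa_ex (aa_and h h'); rewrite eqxx.
Qed.

Lemma aa_bipoly0 (p : {poly {poly K}}) :
  aa (fun s => aa (fun t => p.[t%:P].[s] = 0)) -> p = 0.
Proof.
move=> h; apply/polyP=> i; rewrite coef0; apply: aa_poly0.
apply: aa_mono h => s hs; rewrite -evX_coef.
suff -> : evX s p = 0 by rewrite coef0.
by apply: aa_poly0; apply: aa_mono hs => t; rewrite evX_horner.
Qed.

End Generic.

Section AffineExpansion.
Variable K : numClosedFieldType.

Variables (f : triple K) (b E1 E2 : 'I_3 -> K).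
Hypotheses (hf : homog_triple 3 f) (db : double_point f b).

Let pt x0 y z := fun j => x0 * b j + y * E1 j + z * E2 j.

(** Along b + t w the terms of degree 0 and 1 in t vanish since b is a double point; the remaining
    two give, with t = 1 / x0 and homogeneity, an expression linear in x0. The coefficient of t^k
    has degree at most k in the parameter of w, whence the sizes. *)
Lemma double_point_expansion : exists q c : 'I_3 -> {poly K},
  [/\ forall i, (size (q i) <= 3)%N, forall i, (size (c i) <= 4)%N,
      forall i x0 y, x0 != 0 -> (tnth f i).@[pt x0 1 y] = x0 * (q i).[y] + (c i).[y] &
      forall i, (c i).[0] = (tnth f i).@[E1]].
Proof.
have [b0 fb dfb] := db.
pose w j : {poly K} := (E1 j)%:P + 'X * (E2 j)%:P.
pose h j : {poly {poly K}} := CC (b j) + 'X * (w j)%:P.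
pose P i := mmap (@CC K) h (tnth f i).
have hE j s t : (h j).[t%:P].[s] = b j + t * (E1 j + s * E2 j).
  by rewrite /h !horner2E /w hornerD hornerM hornerX !hornerC.
have ev i s t : (P i).[t%:P].[s] = (tnth f i).@[fun j => b j + t * (E1 j + s * E2 j)].
  by rewrite mmap_CC_horner; apply: meval_eq => j; apply: hE.
have sh j : (size (h j) <= 2)%N.
  apply: leq_trans (size_polyD _ _) _; rewrite geq_max /CC /=.
  rewrite (leq_trans (size_polyC_leq1 _)) //=.
  apply: leq_trans (size_polyMleq _ _) _.
  by rewrite size_polyX; apply: leq_trans (size_polyC_leq1 _) _.
have sz i : (size (P i) <= 4)%N.
  by have [] := mmap_topcoef polyC (hf i) sh.
have graded p k : (size (((mmap (@CC K) h p)`_k)%R : {poly K}) <= k.+1)%N.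
  elim/mpoly_ring_ind: p k => [c|i|p q hp hq|p q hp hq] k.
  - rewrite mmapC /CC /= coefC; case: (k == 0%N); rewrite ?size_poly0 //.
    exact: leq_trans (size_polyC_leq1 _) _.
  - rewrite mmapX mmap1U /h coefD /CC /= coefC coefXM coefC.
    case: k => [|[|k]] /=; rewrite ?addr0 ?add0r ?size_poly0 ?size_polyC_leq1 //.
    rewrite /w; apply: size_addr_le; first by apply: leq_trans (size_polyC_leq1 _) _.
    apply: leq_trans (size_polyMleq _ _) _.
    by rewrite size_polyX; apply: leq_trans (size_polyC_leq1 _) _.
  - by rewrite mmapD coefD; apply: size_addr_le.
  rewrite rmorphM coefM; apply: leq_trans (size_sum _ _ _) _; apply/bigmax_leqP => j _.
  have e : (k = j + (k - j))%N by rewrite subnKC // -ltnS.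
  by rewrite [X in (_ <= X.+1)%N]e; apply: size_mul_le1.
have P0 i : (P i)`_0 = 0.
  rewrite -horner_coef0 -(rmorph0 polyC); apply: (aa_poly0); apply: aaT => s.
  by rewrite ev -[RHS](fb i); apply: meval_eq => j; rewrite mul0r addr0.
have P1 i : (P i)`_1 = 0.
  have -> : (P i)`_1 = (P i)^`().[0] by rewrite horner_coef0 coef_deriv mulr1n.
  rewrite /P (@mmap_chain 3 K {poly {poly K}} (@CC K) h _ _ (@derivD _) (@derivM _)).
    rewrite horner_sum big1 // => j _; rewrite hornerM.
    rewrite (_ : (mmap _ _ _).[0] = 0) ?mul0r //.
    rewrite -[X in _.[X]](rmorph0 polyC); apply: aa_poly0; apply: aaT => s.
    rewrite mmap_CC_horner -[RHS](dfb j i); apply: meval_eq => l.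
    by rewrite hE mul0r addr0.
  by move=> c; rewrite derivC.
exists (fun i => (P i)`_2), (fun i => (P i)`_3); split=> [i|i|i x0 y x00|i]; try exact: graded.
- transitivity (x0 ^+ 3 * (P i).[(x0^-1)%:P].[y]).
    rewrite ev -(mmap_homogZ _ _ _ (hf i)); apply: eq_mmap => // j.
    by rewrite /pt mul1r mulrDr mulrA mulfV // mul1r; ring.
  rewrite (horner_coef_wide _ (sz i)) !big_ord_recl big_ord0 /= P0 P1 !mul0r !add0r addr0.
  by rewrite -!polyC_exp hornerD !hornerM !hornerC /bump /=; field.
have [_] := mmap_topcoef polyC (hf i) sh; rewrite muln1 => ->.
rewrite mmap_polyC_horner; apply: meval_eq => j.
by rewrite /h coefD /CC /= coefC coefXM coefC /= add0r /w hornerD hornerM hornerX !hornerC mul0r addr0.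
Qed.

Lemma horner_rev n (p : {poly K}) y : (size p <= n.+1)%N -> y != 0 ->
  (\poly_(k < n.+1) p`_(n - k)).[y] = y ^+ n * p.[y^-1].
Proof.
move=> sp y0; rewrite horner_poly (horner_coef_wide _ sp) mulr_sumr.
rewrite (reindex_inj rev_ord_inj) /=; apply: eq_bigr => i _.
have ik : (i <= n)%N by rewrite -ltnS.
rewrite subSS subKn // exprVn mulrCA; congr (_ * _).
have -> : y ^+ n = y ^+ (n - i) * y ^+ i by rewrite -exprD subnK.
by rewrite mulfK // expf_neq0.
Qed.

(* The coordinate [y] is inverted, so that [E1] is the point at infinity of the pencil of lines. *)
Lemma double_point_normal_form : exists q c : 'I_3 -> {poly K},
  [/\ forall i, (size (q i) <= 3)%N, forall i, (size (c i) <= 4)%N,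
      forall i x0 y, (tnth f i).@[pt x0 y 1] = x0 * (q i).[y] + (c i).[y],
      forall i, (c i)`_3 = (tnth f i).@[E1] &
      forall i x0, (tnth f i).@[pt x0 1 0] = x0 * (q i)`_2 + (c i)`_3].
Proof.
have [q [c [sq sc fE c0]]] := double_point_expansion.
pose q' i := \poly_(k < 3) (q i)`_(2 - k); pose c' i := \poly_(k < 4) (c i)`_(3 - k).
have id i x0 y : (tnth f i).@[pt x0 y 1] = x0 * (q' i).[y] + (c' i).[y].
  pose h j : {poly {poly K}} := 'X * CC (b j) + 'X%:P * CC (E1 j) + CC (E2 j).
  pose R := mmap (@CC K) h (tnth f i) - ('X * (q' i)%:P + (c' i)%:P).
  have hE j s t : (h j).[t%:P].[s] = pt t s 1 j.
    by rewrite /h /pt !horner2E hornerX mul1r.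
  have RE s t : R.[t%:P].[s] = (tnth f i).@[pt t s 1] - (t * (q' i).[s] + (c' i).[s]).
    by rewrite /R horner2D horner2N mmap_CC_horner (meval_eq _ (fun j => hE j s t)) !horner2E.
  suff R0 : R = 0.
    by have := RE y x0; rewrite R0 !horner0 => /esym/eqP; rewrite subr_eq0 => /eqP.
  apply: aa_bipoly0; apply: aa_mono (aa_neq 0) => s s0; apply: aa_mono (aa_neq 0) => t t0.
  rewrite RE; apply/eqP; rewrite subr_eq0; apply/eqP.
  rewrite (horner_rev (n := 2)) ?sq // (horner_rev (n := 3)) ?sc //.
  transitivity (s ^+ 3 * (tnth f i).@[pt (t / s) 1 s^-1]).
    rewrite -(mmap_homogZ _ _ _ (hf i)); apply: eq_mmap => // j.
    by rewrite /pt; field.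
  by rewrite fE ?mulf_neq0 ?invr_eq0 //; field.
exists q', c'; split=> // [i|i|i|i x0]; try exact: size_poly.
- by rewrite coef_poly /= -horner_coef0.
have -> : (q' i)`_2 = (q i).[0] by rewrite coef_poly /= horner_coef0.
have -> : (c' i)`_3 = (c i).[0] by rewrite coef_poly /= horner_coef0.
pose Q := mmap polyC (fun j => 'X * (b j)%:P + (E1 j)%:P) (tnth f i) - ('X * ((q i).[0])%:P + ((c i).[0])%:P).
have QE t : Q.[t] = (tnth f i).@[pt t 1 0] - (t * (q i).[0] + (c i).[0]).
  rewrite /Q hornerD hornerN mmap_polyC_horner hornerD hornerM hornerX !hornerC; congr (_ - _).
  by apply: meval_eq => j; rewrite hornerD hornerM hornerX !hornerC /pt mul1r mul0r addr0.
have Q0 : Q = 0.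
  by apply: aa_poly0; apply: aa_mono (aa_neq 0) => t t0; rewrite QE fE // subrr.
by have := QE x0; rewrite Q0 horner0 => /esym/eqP; rewrite subr_eq0 => /eqP.
Qed.

End AffineExpansion.

Section LinearForms.
Variable K : numClosedFieldType.

Definition linform (v : 'I_3 -> K) : {mpoly K[3]} := \sum_i v i *: 'X_i.

Lemma linformE v x : (linform v).@[x] = dot v x.
Proof. by rewrite raddf_sum; apply: eq_bigr => i _ /=; rewrite mevalZ mevalXU. Qed.

Lemma linform_neq0 v i : v i != 0 -> linform v != 0.
Proof.
move=> vi; apply: contraNneq vi => z.
have := linformE v (fun j => (j == i)%:R); rewrite z meval0 /dot (bigD1 i) //= big1 ?eqxx ?mulr1 ?addr0 => [->//|j /negPf ->].
by rewrite mulr0.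
Qed.

Lemma cross_eq0_par (u v : 'I_3 -> K) : (forall i, cross u v i = 0) ->
  forall i j, u i * v j = u j * v i.
Proof.
move=> h; have h0 := h o0; have h1 := h o1; have h2 := h o2.
rewrite /cross /pt3 /= in h0 h1 h2.
move/eqP: h0; rewrite subr_eq0 => /eqP h0; move/eqP: h1; rewrite subr_eq0 => /eqP h1.
move/eqP: h2; rewrite subr_eq0 => /eqP h2.
by apply: forall3; apply: forall3; rewrite // ?h0 ?h1 ?h2.
Qed.

Lemma exists_neq0 (u : 'I_3 -> K) : (exists i, u i != 0) \/ (forall i, u i = 0).
Proof.
case: (boolP [exists i, u i != 0]) => [/existsP|/existsPn z]; [by left|right=> i].
by have := z i; rewrite negbK => /eqP.
Qed.

Lemma meval_homog0 d (p : {mpoly K[3]}) x : p \is d.+1.-homog -> (forall i, x i = 0) -> p.@[x] = 0.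
Proof.
move=> hp x0; rewrite (_ : p.@[x] = mmap idfun (fun i => 0 * x i) p).
  by rewrite (mmap_homogZ _ _ _ hp) expr0n mul0r.
by apply: eq_mmap => // i; rewrite x0 mulr0.
Qed.

Lemma meval_homogZ d (p : {mpoly K[3]}) c x y : p \is d.-homog -> (forall i, y i = c * x i) ->
  p.@[y] = c ^+ d * p.@[x].
Proof. by move=> hp yE; rewrite -(mmap_homogZ _ _ _ hp); apply: eq_mmap. Qed.

End LinearForms.

(** * Lines through the double point that are not contracted *)

Section Structure.
Variable K : numClosedFieldType.
Variables (f g : triple K) (e : nat).
Hypotheses (hf : homog_triple 3 f) (cop : no_common_factor f) (hg : homog_triple e g).

Definition fv x := fun k => (tnth f k).@[x].
Definition gv x := fun k => (tnth g k).@[x].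
Hypothesis fgX : forall X i j, fv (gv X) i * X j = fv (gv X) j * X i.
Hypothesis gfX : forall x i j, gv (fv x) i * x j = gv (fv x) j * x i.
Hypothesis gf0 : exists x l, gv (fv x) l != 0.

Lemma good_point (r : {mpoly K[3]}) : r != 0 -> exists x m l,
  [/\ fv x m != 0, gv (fv x) l != 0, exists i, x i != 0 & r.@[x] != 0].
Proof.
move=> r0; have [x0 [l gl]] := gf0.
have [m fm] := no_common_factor_neq0 cop.
have gf : tnth g l \mPo f != 0.
  by apply: contraNneq gl => z; rewrite /gv /fv -comp_mpoly_meval z meval0.
have /mpoly_nonvanishing [x] : tnth f m * (tnth g l \mPo f) * r != 0 by rewrite !mulf_neq0.
rewrite !mevalM comp_mpoly_meval !mulf_eq0 !negb_or => /andP [/andP [h1 h2] h3].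
exists x, m, l; split=> //.
by have [//|z] := exists_neq0 x; move: h1; rewrite (meval_homog0 (hf m) z) eqxx.
Qed.

Lemma good_scal x l : gv (fv x) l != 0 -> (exists i, x i != 0) ->
  exists2 c, c != 0 & forall i, gv (fv x) i = c * x i.
Proof.
move=> gl [i xi].
have xl : x l != 0.
  apply: contraNneq gl => xl; apply/eqP; apply: (mulIf xi).
  by rewrite gfX xl mulr0 mul0r.
exists (gv (fv x) l / x l); first by rewrite mulf_neq0 ?invr_eq0.
by move=> j; apply: (mulIf xl); rewrite gfX; field.
Qed.

Lemma fg0 : exists X k, fv (gv X) k != 0.
Proof.
have [x [m [l [h1 h2 h3 _]]]] := good_point (oner_neq0 _).
have [c c0 cE] := good_scal h2 h3.
by exists (fv x), m; rewrite /fv (meval_homogZ (hf m) cE) mulf_neq0 ?expf_neq0.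
Qed.

Variable b : 'I_3 -> K.
Hypothesis db : double_point f b.

(** If f were constant on the line through b and E1, then g after f would send E1 and t b + E1 to
    the same point. Through the last clause, the cross product of q and c will have degree exactly
    5. The third basis vector is chosen only later, so its slot, with coefficient 0, is filled by
    [E1]. *)
Lemma transversal_point : exists E1, [/\ exists k, fv E1 k != 0,
  (exists i, cross b E1 i != 0) &
  forall (q2 : 'I_3 -> K), (forall i x0, fv (fun j => x0 * b j + 1 * E1 j + 0 * E1 j) i = x0 * q2 i + fv E1 i) ->
    exists i, cross q2 (fv E1) i != 0].
Proof.
have [x [m [l [h1 h2 h3 _]]]] := good_point (oner_neq0 _).
have nb : exists i, cross b x i != 0.
  have [//|z] := exists_neq0 (cross b x); have par := cross_eq0_par z.
  have [[i bi] fb _] := db.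
  case/eqP: h1; rewrite /fv (@meval_homogZ _ 3 _ (x i / b i) b) ?fb ?mulr0 //.
  by move=> j; rewrite mulrAC -[x i * b j]mulrC par mulrC mulKf.
exists x; split=> //; first by exists m.
move=> q2 qE; have [//|z] := exists_neq0 (cross q2 (fv x)); have par := cross_eq0_par z.
pose k := q2 m / fv x m.
have qk i : q2 i = k * fv x i by apply: (mulIf h1); rewrite par /k; field.
have [t [t0 kt]] : exists t, t != 0 /\ 1 + k * t != 0.
  have p0 : 'X * (1 + k *: 'X) != 0 :> {poly K}.
    rewrite mulf_neq0 ?polyX_eq0 //; apply: contraNneq (oner_neq0 K) => z1.
    by have := congr1 (horner^~ 0) z1; rewrite /= !hornerE => ->.
  have [t] := aa_ex (aa_root p0); rewrite !hornerE mulf_eq0 negb_or => /andP [h4 h5].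
  by exists t.
pose y j := t * b j + 1 * x j + 0 * x j.
have fy i : fv y i = (1 + k * t) * fv x i by rewrite qE qk; ring.
have gy i : gv (fv y) i = (1 + k * t) ^+ e * gv (fv x) i.
  by rewrite /gv (meval_homogZ (hg i) fy).
have g1 i j : gv (fv x) i * b j = gv (fv x) j * b i.
  have kt0 : (1 + k * t) ^+ e * t != 0 by rewrite mulf_neq0 ?expf_neq0.
  apply: (mulfI kt0); have := gfX y i j; have := gfX x i j; rewrite !gy /y => h4 h5.
  transitivity ((1 + k * t) ^+ e * gv (fv x) i * (t * b j + 1 * x j + 0 * x j) - (1 + k * t) ^+ e * (gv (fv x) i * x j)); first by ring.
  by rewrite h5 h4; ring.
have [c c0 cE] := good_scal h2 h3.
have [i ci] := nb; case/eqP: ci.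
have pp j j' : b j * x j' = b j' * x j.
  apply: (mulfI c0); transitivity (gv (fv x) j' * b j); first by rewrite cE; ring.
  by rewrite g1 cE; ring.
by elim/forall3: i; rewrite /cross /pt3 /= pp subrr.
Qed.

End Structure.

(** * The pencil of lines through the double point *)

Section RationalInverse.
Variable K : numClosedFieldType.

(* If [R (be / al) = y] with [R = P1 / P2] then [al T - be] divides [P1(T) - y P2(T)], which has
   degree 1 in [y]. *)
Lemma size_rational_inverse (P1 P2 al be : {poly K}) :
  al != 0 -> (forall y, al.[y] = 0 -> be.[y] != 0) -> P2 != 0 ->
  aa (fun y => P1.[be.[y] / al.[y]] = y * P2.[be.[y] / al.[y]]) -> (size al <= 2)%N.
Proof.
move=> al0 cop P20 h.
pose S : {poly {poly K}} := P1^:P - 'X%:P * P2^:P.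
pose L : {poly {poly K}} := al%:P * 'X - be%:P.
have L1 : L`_1 = al by rewrite /L coefB coefCM coefX coefC mulr1 subr0.
have SE s t : S.[t%:P].[s] = P1.[t] - s * P2.[t].
  by rewrite /S !horner2E hornerX !horner_map /= !hornerC.
have LE s t : L.[t%:P].[s] = al.[s] * t - be.[s] by rewrite /L !horner2E.
have sL : size L = 2.
  apply/eqP; rewrite eqn_leq; apply/andP; split.
    apply: size_subr_le; last by apply: leq_trans (size_polyC_leq1 _) _.
    apply: leq_trans (size_polyMleq _ _) _; rewrite size_polyX addn2 /= ltnS.
    exact: size_polyC_leq1.
  by rewrite ltnNge; apply/negP => /leq_sizeP /(_ 1%N (leqnn _)) /eqP; rewrite L1 (negPf al0).
have L0 : L != 0 by rewrite -size_poly_eq0 sL.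
(* Pseudo-division over K[y]: the remainder is constant in T and vanishes at T = be / al for almost
   all y. As al and be have no common root, L is primitive, and Gauss's lemma removes the power of
   the leading coefficient. *)
have := Pdiv.WeakIdomain.divp_eq S L.
set k := Pdiv.IdomainDefs.scalp S L; set q := Pdiv.IdomainDefs.divp S L; set r := Pdiv.IdomainDefs.modp S L => dE.
have sr : (size r <= 1)%N.
  by have := Pdiv.CommonIdomain.ltn_modpN0 S L0; rewrite sL ltnS.
have r0 : r = 0.
  rewrite (size1_polyC sr); suff -> : r`_0 = 0 by rewrite polyC0.
  apply: aa_poly0; apply: aa_mono (aa_and (aa_root al0) h) => s [als hs].
  have := congr1 (fun p : {poly {poly K}} => p.[(be.[s] / al.[s])%:P].[s]) dE.
  rewrite /= -mul_polyC (horner2M _ S) (horner2D (q * L) r) (horner2M q L) SE LE hs subrr mulr0 [al.[s] * _]mulrC divfK // subrr mulr0 add0r.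
  by rewrite {1}(size1_polyC sr) horner2P => <-.
have Lp : primitive L.
  move=> y; apply/eqP=> z.
  have z1 := evX_coef y L 1; have z0 := evX_coef y L 0.
  rewrite z coef0 L1 in z1; have := cop y (esym z1).
  have e : L`_0 = - be by rewrite /L coefB coefCM coefX coefC mulr0 sub0r.
  by move: z0; rewrite z coef0 e hornerN => /esym/eqP; rewrite oppr_eq0 => ->.
have [q' SLq] : exists q', S = L * q'.
  apply: (gauss (c := lead_coef L ^+ k) (q := q) Lp).
    by rewrite expf_neq0 // lead_coef_eq0.
  by rewrite mul_polyC dE r0 addr0 mulrC.
have S0 : S != 0.
  apply: contraNneq P20 => z; apply/eqP/polyP=> j; rewrite coef0.
  have := congr1 (fun p : {poly {poly K}} => p`_j`_1) z.
  rewrite !coef0 /S coefB coefCM !coef_map /= coefB coefXM !coefC /= sub0r.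
  by move/eqP; rewrite oppr_eq0 => /eqP.
have q'0 : q' != 0 by apply: contraNneq S0 => z; rewrite SLq z mulr0.
have sS : (size (swapXY S) <= 2)%N.
  rewrite -sizeYE; apply/bigmax_leqP => j _.
  rewrite /S coefB coefCM !coef_map /=; apply: size_subr_le.
    by apply: leq_trans (size_polyC_leq1 _) _.
  by apply: (@size_mul_le _ 1 1); rewrite ?size_polyX ?size_polyC_leq1.
have sLY : (size al <= size (swapXY L))%N by rewrite -sizeYE -L1 max_size_coefXY.
apply: leq_trans sLY _; apply: leq_trans sS.
rewrite SLq rmorphM /= size_mul ?swapXY_eq0 //.
move: q'0; rewrite -swapXY_eq0 -size_poly_gt0; case: (size (swapXY q')) => // m _.
by rewrite addnS leq_addr.
Qed.

End RationalInverse.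

Section Dot.
Variable R : comNzRingType.
Implicit Types u v w : 'I_3 -> R.

Lemma dot_cross u v w : dot (cross u v) w = det3 u v w.
Proof. by rewrite /dot sum3 /cross /det3 /pt3 /=; ring. Qed.

Lemma det3C u v w : det3 u v w = det3 v w u.
Proof. by rewrite /det3; ring. Qed.

Lemma det3_id u v : det3 u v u = 0.
Proof. by rewrite /det3; ring. Qed.

Lemma cramer3 u v w x i :
  det3 u v w * x i = dot (cross v w) x * u i + dot (cross w u) x * v i + dot (cross u v) x * w i.
Proof. by rewrite !dot_cross /det3; elim/forall3: i; ring. Qed.

Lemma dot_par u v x y : (forall i j, u i * v j = u j * v i) -> dot x u * dot y v = dot y u * dot x v.
Proof.
move=> h; rewrite /dot !big_distrlr /= exchange_big; apply: eq_bigr => j _.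
by apply: eq_bigr => i _; transitivity (x i * y j * (u i * v j)); [ring | rewrite h; ring].
Qed.

End Dot.

(** * Image lines of the pencil and the matrix of f *)

Section NormalForm.
Variable K : numClosedFieldType.
Variables (f g : triple K) (e : nat).
Hypotheses (hf : homog_triple 3 f) (cop : no_common_factor f) (hg : homog_triple e g).
Hypothesis fgX : forall X i j, fv f (gv g X) i * X j = fv f (gv g X) j * X i.
Hypothesis gfX : forall x i j, gv g (fv f x) i * x j = gv g (fv f x) j * x i.
Hypothesis gf0 : exists x l, gv g (fv f x) l != 0.
Variable b E1 E2 : 'I_3 -> K.
Variables q c : 'I_3 -> {poly K}.
Hypothesis det0 : det3 b E1 E2 != 0.
Hypotheses (sq : forall i, (size (q i) <= 3)%N) (sc : forall i, (size (c i) <= 4)%N).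

Let pt x0 y := fun j => x0 * b j + y * E1 j + 1 * E2 j.

Hypothesis fE : forall i x0 y, fv f (pt x0 y) i = x0 * (q i).[y] + (c i).[y].

Let q2 i := (q i)`_2.
Let c3 i := (c i)`_3.
Variable k : 'I_3.
Hypothesis w5 : cross q2 c3 k != 0.

(** The equation of the line into which f maps the line of parameter y through b; [n] is the same
    line freed of the common factor [D]. *)
Let W := cross q c.

Lemma W_top j : topcoef (W j) 5 (cross q2 c3 j).
Proof.
have T i l : topcoef (q i * c l) 5 (q2 i * c3 l) by apply: (@topcoefM _ _ _ 2 3); split.
have S i l i' l' : topcoef (q i * c l - q i' * c l') 5 (q2 i * c3 l - q2 i' * c3 l').
  have [s1 <-] := T i l; have [s2 <-] := T i' l'.
  by split; [apply: size_subr_le|rewrite coefB].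
by elim/forall3: j; rewrite /W /cross /pt3 /=; apply: S.
Qed.

Variables (D : {poly K}) (n m : 'I_3 -> {poly K}).
Hypotheses (WE : forall j, W j = D * n j) (mn : \sum_j m j * n j = 1).

Lemma Wk_size : size (W k) = 6.
Proof.
have [s1 t1] := W_top k; apply/eqP; rewrite eqn_leq s1 ltnNge; apply/negP => /leq_sizeP h.
by move: w5; rewrite -t1 h ?eqxx.
Qed.

Lemma D_neq0 : D != 0.
Proof. by have := Wk_size; rewrite WE; apply: contra_eq_neq => ->; rewrite mul0r size_poly0. Qed.

Lemma nk_neq0 : n k != 0.
Proof. by have := Wk_size; rewrite WE; apply: contra_eq_neq => ->; rewrite mulr0 size_poly0. Qed.

Lemma size_Dnk : (size D + size (n k) = 7)%N.
Proof.
have := Wk_size; rewrite WE size_mul ?D_neq0 ?nk_neq0 //.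
by have := nk_neq0; rewrite -size_poly_gt0; case: (size (n k)) => // a _; rewrite addnS /= => ->.
Qed.

Lemma size_n j : (size (n j) <= size (n k))%N.
Proof.
case: (eqVneq (n j) 0) => [->|nj]; first by rewrite size_poly0.
have [s1 _] := W_top j; rewrite WE size_mul ?D_neq0 // in s1.
rewrite -(leq_add2l (size D)) size_Dnk; move: s1.
by move: nj; rewrite -size_poly_gt0; case: (size (n j)) => // a _; rewrite addnS.
Qed.

Lemma nq0 : \sum_j n j * q j = 0.
Proof.
apply: (mulfI D_neq0); rewrite mulr0 mulr_sumr.
under eq_bigr => j _ do rewrite mulrA -WE.
by rewrite -/(dot W q) /W dot_cross det3_id.
Qed.

Lemma nc0 : \sum_j n j * c j = 0.
Proof.
apply: (mulfI D_neq0); rewrite mulr0 mulr_sumr.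
under eq_bigr => j _ do rewrite mulrA -WE.
by rewrite -/(dot W c) /W dot_cross det3C det3C det3_id.
Qed.

(** Up to the factor [det3 b E1 E2], [eps1] and [eps2] are the coordinate forms of E1 and E2 in the
    basis (b, E1, E2); thus G1 / G2 is the y-coordinate of the inverse map. *)
Let eps1 := cross E2 b.
Let eps2 := cross b E1.
Let G1 : {mpoly K[3]} := \sum_i eps1 i *: tnth g i.
Let G2 : {mpoly K[3]} := \sum_i eps2 i *: tnth g i.

Lemma lincombE (u : 'I_3 -> K) X : (\sum_i u i *: tnth g i).@[X] = dot u (gv g X).
Proof. by rewrite raddf_sum; apply: eq_bigr => i _ /=; rewrite mevalZ. Qed.

Lemma eps2_neq0 : exists i, eps2 i != 0.
Proof.
have [//|z] := exists_neq0 eps2; case/eqP: det0.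
by rewrite -dot_cross -/eps2 /dot big1 // => i _; rewrite z mul0r.
Qed.

Lemma G2_neq0 : G2 != 0.
Proof.
have [i /linform_neq0 l0] := eps2_neq0.
have [x [m' [l [_ gl _]]]] := good_point hf cop gf0 l0; rewrite linformE => ex.
apply: contraNneq ex => z.
have : dot eps2 (gv g (fv f x)) = 0 by rewrite -lincombE -/G2 z meval0.
have el v : dot (fun j => (j == l)%:R) v = v l.
  by rewrite /dot (bigD1 l) //= big1 ?addr0 ?eqxx ?mul1r // => j /negPf ->; rewrite mul0r.
move=> h; have := dot_par eps2 (fun j => (j == l)%:R) (gfX x).
by rewrite h mul0r !el => /esym/eqP; rewrite mulf_eq0 (negPf gl).
Qed.

Lemma G12 x0 y : G1.@[fv f (pt x0 y)] = y * G2.@[fv f (pt x0 y)].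
Proof.
have := dot_par eps1 eps2 (gfX (pt x0 y)).
have -> : dot eps1 (pt x0 y) = y * det3 b E1 E2.
  by rewrite dot_cross /det3 /pt; ring.
have -> : dot eps2 (pt x0 y) = det3 b E1 E2.
  by rewrite dot_cross /det3 /pt; ring.
by rewrite -!lincombE -/G1 -/G2 => h; apply: (mulIf det0); rewrite h; ring.
Qed.

Lemma G_homog u : \sum_i u i *: tnth g i \is e.-homog.
Proof. by rewrite sum3 !rpredD // rpredZ // hg. Qed.

(** The image line [n] meets the line through A and a generic point B in be A - al B, and g sends
    this point back to the line of parameter y. So y is a rational function of be / al, and
    [size_rational_inverse] bounds the degree of al = [n k], the largest among the coordinates of
    [n]. *)
Lemma size_n2 j : (size (n j) <= 2)%N.
Proof.
apply: leq_trans (size_n j) _.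
pose A := fun i => (i == k)%:R : K.
have [i1 qA] : exists i, cross q2 A i != 0.
  have [//|z] := exists_neq0 (cross q2 A); have par := cross_eq0_par z.
  have q20 i : i != k -> q2 i = 0.
    by move=> ik; have := par i k; rewrite /A eqxx (negPf ik) mulr1 mulr0.
  case/eqP: w5; move: q20; elim/forall3: k => q20; rewrite /cross /pt3 /=.
  - by rewrite (q20 o1) // (q20 o2) //; ring.
  - by rewrite (q20 o0) // (q20 o2) //; ring.
  by rewrite (q20 o1) // (q20 o0) //; ring.
have [rs hrs] := roots_list nk_neq0.
have nr r : exists i, (n i).[r] != 0.
  have [//|z] := exists_neq0 (fun i => (n i).[r]).
  have := congr1 (horner^~ r) mn; rewrite /= sum3 !hornerD !hornerM !z !mulr0 !addr0 hornerC.
  by move/esym/eqP; rewrite oner_eq0.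
(* The factors require of B that G2 not vanish there, that [lq] be nonzero, and that al and be have
   no common root. *)
have Rn : G2 * linform (cross q2 A) * \prod_(r <- rs) linform (fun i => (n i).[r]) != 0.
  rewrite !mulf_neq0 ?G2_neq0 //; first exact: (linform_neq0 qA).
  rewrite prodf_seq_neq0; apply/allP => r _ /=; have [i ni] := nr r.
  exact: (linform_neq0 ni).
have [B] := mpoly_nonvanishing Rn; rewrite !mevalM !mulf_eq0 !negb_or linformE => /andP [/andP [GB qAB] nB].
pose al := n k; pose be := \sum_j (B j)%:P * n j.
pose ell := cross A B; pose lq := \sum_j (ell j)%:P * q j; pose lc := \sum_j (ell j)%:P * c j.
have lq0 : lq != 0.
  apply: contraNneq qAB => z; rewrite dot_cross det3C -dot_cross /dot.
  apply/eqP; transitivity (lq`_2); last by rewrite z coef0.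
  by rewrite coef_sum; apply: eq_bigr => i _; rewrite coefCM.
have XE i : lq * c i - lc * q i = D * (be * (A i)%:P - al * (B i)%:P).
  have alE : al = \sum_j (A j)%:P * n j.
    by rewrite (bigD1 k) //= big1 ?addr0 /A ?eqxx ?mul1r // => l /negPf ->; rewrite mul0r.
  have DA u : D * (\sum_j (u j)%:P * n j) = \sum_j (u j)%:P * W j.
    by rewrite mulr_sumr; apply: eq_bigr => l _; rewrite WE; ring.
  rewrite mulrBr !mulrA DA alE DA /lq /lc /W /ell !sum3.
  elim/forall3: i; rewrite /cross /pt3 /= !rmorphB !rmorphM /=; ring.
pose Pp (G : {mpoly K[3]}) := mmap polyC (fun j => 'X * (A j)%:P - (B j)%:P) G.
have PpE G t : (Pp G).[t] = G.@[fun j => t * A j - B j].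
  by rewrite mmap_polyC_horner; apply: meval_eq => i; rewrite hornerD hornerN hornerM hornerX !hornerC.
apply: (@size_rational_inverse K (Pp G1) (Pp G2) al be nk_neq0).
- move=> y aly; have yrs := hrs y aly.
  move: nB; rewrite rmorph_prod prodf_seq_neq0 => /allP /(_ y yrs) /=; rewrite linformE.
  apply: contraNneq => z; apply/eqP; rewrite -[RHS]z /be horner_sum; apply: eq_bigr => j' _.
  by rewrite hornerM hornerC mulrC.
- apply: contraNneq GB => z; have := PpE G2 0; rewrite z horner0.
  rewrite (@meval_homogZ _ e _ (-1) B) ?G_homog // => [/esym/eqP|i]; last by ring.
  by rewrite mulf_eq0 expf_eq0 oppr_eq0 oner_eq0 andbF.
apply: aa_mono (aa_and (aa_root nk_neq0) (aa_and (aa_root D_neq0) (aa_root lq0))) => y [aly [Dy lqy]].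
rewrite !PpE; set Y := fun j => _.
(* The parameter at which f crosses the line through A and B, and the factor between f there and the
   point (be / al) A - B. *)
pose x0 := - lc.[y] / lq.[y]; pose kap := D.[y] * al.[y] / lq.[y].
have kap0 : kap != 0 by rewrite /kap !mulf_neq0 ?invr_eq0.
have fY i : fv f (pt x0 y) i = kap * Y i.
  rewrite fE; apply: (mulIf lqy).
  transitivity ((lq * c i - lc * q i).[y]).
    by rewrite hornerD hornerN !hornerM /x0; field.
  by rewrite XE hornerM hornerD hornerN !hornerM !hornerC /kap /Y; field; rewrite aly lqy.
apply: (mulfI (expf_neq0 e kap0)); rewrite [RHS]mulrCA.
by rewrite -!(meval_homogZ _ fY) ?G_homog // G12.
Qed.

Lemma vanish_on_chart d (p : {mpoly K[3]}) : p \is d.-homog ->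
  (forall x0 y, p.@[pt x0 y] = 0) -> p = 0.
Proof.
move=> hp h; have [i /linform_neq0 l0] := eps2_neq0.
apply/eqP; apply: contraT => p0.
have /mpoly_nonvanishing [x] : p * linform eps2 != 0 by rewrite mulf_neq0.
rewrite mevalM linformE mulf_eq0 negb_or => /andP [px ex]; case/eqP: px.
pose z := dot eps2 x.
rewrite (@meval_homogZ _ d _ (z / det3 b E1 E2) (pt (dot (cross E1 E2) x / z) (dot eps1 x / z))) //.
  by rewrite h mulr0.
move=> j; apply: (mulfI det0); rewrite cramer3 -/eps1 -/eps2 -/z /pt; field.
by rewrite det0 ex.
Qed.

Let nu0 j := (n j)`_0.
Let nu1 j := (n j)`_1.

Lemma nE j : n j = (nu0 j)%:P + (nu1 j)%:P * 'X.
Proof.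
apply/polyP=> i; rewrite coefD coefC coefMX coefC /nu0 /nu1.
case: i => [|[|i]] /=; rewrite ?addr0 ?add0r //.
by rewrite nth_default // (leq_trans (size_n2 j)).
Qed.

(** With [n] constant, a fixed linear form would vanish on the image of f; then it would vanish
    identically by f after g being the identity. *)
Lemma nu1_neq0 : nu1 k != 0.
Proof.
apply/eqP => nk1.
have s1 : (size (n k) <= 1)%N by rewrite nE nk1 mul0r addr0 size_polyC_leq1.
have nc j : n j = (nu0 j)%:P by apply: size1_polyC; apply: leq_trans (size_n j) s1.
have nk0 : nu0 k != 0 by apply: contraNneq nk_neq0 => z; rewrite nc z.
pose F : {mpoly K[3]} := \sum_i nu0 i *: tnth f i.
have FE X : F.@[X] = dot nu0 (fv f X).
  by rewrite raddf_sum; apply: eq_bigr => i _ /=; rewrite mevalZ.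
have F0 : F = 0.
  apply: (@vanish_on_chart 3); first by rewrite /F sum3 !rpredD // rpredZ // hf.
  move=> x0 y; rewrite FE /dot sum3 !fE.
  have hq := congr1 (horner^~ y) nq0; have hc := congr1 (horner^~ y) nc0.
  move: hq hc; rewrite /= !sum3 !nc !hornerD !hornerM !hornerC => hq hc.
  transitivity (x0 * (nu0 o0 * (q o0).[y] + nu0 o1 * (q o1).[y] + nu0 o2 * (q o2).[y])
    + (nu0 o0 * (c o0).[y] + nu0 o1 * (c o1).[y] + nu0 o2 * (c o2).[y])); first by ring.
  by rewrite hq hc mulr0 addr0.
have [X0 [m' fgX0]] := fg0 hf cop gfX gf0.
have fm0 : tnth f m' \mPo g != 0.
  by apply: contraNneq fgX0 => z; rewrite /fv /gv -comp_mpoly_meval z meval0.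
have : (tnth f m' \mPo g) * linform nu0 != 0 by rewrite mulf_neq0 // (linform_neq0 nk0).
move/mpoly_nonvanishing => [X]; rewrite mevalM comp_mpoly_meval linformE.
suff -> : (tnth f m').@[fun i => (tnth g i).@[X]] * dot nu0 X = F.@[gv g X] * X m'.
  by rewrite F0 meval0 mul0r eqxx.
rewrite FE /dot mulr_sumr mulr_suml; apply: eq_bigr => i _.
by rewrite mulrCA -mulrA; congr (_ * _); apply: fgX.
Qed.

Lemma size_D : size D = 5.
Proof.
have := size_Dnk; have -> : size (n k) = 2.
  apply/eqP; rewrite eqn_leq size_n2 /= ltnNge; apply/negP => /leq_sizeP /(_ 1%N (leqnn _)) /eqP.
  by rewrite -[_`_1]/(nu1 k) (negPf nu1_neq0).
by rewrite addn2 => -[].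
Qed.

(** If the two coefficient vectors of [n] were proportional, [n] would have a zero, against the
    Bezout relation [mn]. *)
Lemma nu_cross : exists l, cross nu1 nu0 l != 0.
Proof.
have [//|z] := exists_neq0 (cross nu1 nu0); have par := cross_eq0_par z.
have := congr1 (horner^~ (- (nu0 k / nu1 k))) mn; rewrite /= horner_sum hornerC big1 => [/esym/eqP|j _].
  by rewrite oner_eq0.
rewrite hornerM nE hornerD hornerM hornerX !hornerC.
have -> : nu0 j = nu0 k / nu1 k * nu1 j.
  by apply: (mulIf nu1_neq0); rewrite [LHS]mulrC -par; field; rewrite nu1_neq0.
by ring.
Qed.

(* [n] is, up to the factor [D], the line on which f maps the line of parameter y through [b]; being of
   degree 1 in y, it turns around a point, which [T] sends to (1 : 0 : 0). *)
Lemma cubic_matrix_form : exists (T : 'M[K]_3) (a d c' d' : {poly K}) (ps : seq K) (kk : K),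
  [/\ T \in unitmx,
      [/\ (size a <= 3)%N, (size d <= 4)%N, (size c' <= 2)%N & (size d' <= 3)%N],
      [/\ size ps = 4, kk != 0 & a * d' - d * c' = kk%:P * \prod_(x <- ps) ('X - x%:P)],
      forall x, x \in ps -> ~ [/\ a.[x] = 0, d.[x] = 0, c'.[x] = 0 & d'.[x] = 0] &
      forall x0 y i, mvec T (fv f (pt x0 y)) i =
        pt3 (a.[y] * x0 + d.[y]) (y * (c'.[y] * x0 + d'.[y])) (c'.[y] * x0 + d'.[y]) i].
Proof.
have [l cl] := nu_cross; pose zeta := fun i => (i == l)%:R : K.
pose T := mx3 zeta (fun i => - nu0 i) nu1.
have dT : det3 zeta (fun i => - nu0 i) nu1 = cross nu1 nu0 l.
  rewrite det3C -dot_cross /dot (bigD1 l) //= big1 => [|i /negPf il]; last by rewrite /zeta il mulr0.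
  rewrite addr0 /zeta eqxx mulr1; elim/forall3: l {T zeta cl}; rewrite /cross /pt3 /=; ring.
have uT : T \in unitmx by apply: mx3_unit; rewrite dT.
pose L (u : 'I_3 -> K) (v : 'I_3 -> {poly K}) : {poly K} := \sum_j (u j)%:P * v j.
have sL u (v : 'I_3 -> {poly K}) s : (forall j, (size (v j) <= s)%N) -> (size (L u v) <= s)%N.
  move=> sv; have s1 j : (size ((u j)%:P * v j)%R <= s)%N.
    by rewrite mul_polyC; apply: leq_trans (size_scale_leq _ _) _.
  by rewrite /L sum3; apply: size_addr_le => //; apply: size_addr_le.
have LE u v y : (L u v).[y] = \sum_j u j * (v j).[y].
  by rewrite horner_sum; apply: eq_bigr => j _; rewrite hornerM hornerC.
(* The relation n . v = 0 says that the second row of T gives y times the third. This produces the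
   shape of the map and also lowers the degree bounds of [c'] and [d'] by one. *)
have nuL (v : 'I_3 -> {poly K}) : \sum_j n j * v j = 0 -> L (fun i => - nu0 i) v = L nu1 v * 'X.
  move=> z; apply/eqP; rewrite -subr_eq0 -oppr_eq0 -z; apply/eqP.
  by rewrite /L !sum3 !nE !rmorphN /=; ring.
have sX (p : {poly K}) s : (size (p * 'X)%R <= s.+1)%N -> (size p <= s)%N.
  by case: (eqVneq p 0) => [->|p0]; rewrite ?size_poly0 // size_mulX.
have detE : L zeta q * L nu1 c - L zeta c * L nu1 q = (cross nu1 nu0 l)%:P * D.
  transitivity (\sum_j (cross zeta nu1 j)%:P * W j).
    by rewrite /L /W !sum3 /cross /pt3 /= !rmorphB !rmorphM /=; ring.
  under eq_bigr => j _ do rewrite WE nE.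
  rewrite -dT /det3 !sum3 /cross /pt3 /= !(rmorphB, rmorphD, rmorphM, rmorphN) /=; ring.
have [ps psE] := closed_field_poly_normal D.
have lD : lead_coef D != 0 by rewrite lead_coef_eq0 D_neq0.
have hT x0 y i : mvec T (fv f (pt x0 y)) i =
        pt3 ((L zeta q).[y] * x0 + (L zeta c).[y]) (y * ((L nu1 q).[y] * x0 + (L nu1 c).[y]))
            ((L nu1 q).[y] * x0 + (L nu1 c).[y]) i.
  have dE u : dot u (fv f (pt x0 y)) = (L u q).[y] * x0 + (L u c).[y].
    by rewrite !LE /dot !sum3 !fE; ring.
  rewrite mvec_mx3 !dE (nuL _ nq0) (nuL _ nc0) !hornerM hornerX.
  by elim/forall3: i; rewrite /pt3 /=; ring.
exists T, (L zeta q), (L zeta c), (L nu1 q), (L nu1 c), ps, (cross nu1 nu0 l * lead_coef D).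
split=> //.
- split; try exact: sL.
    by apply: sX; rewrite -nuL ?nq0 //; apply: sL.
  by apply: sX; rewrite -nuL ?nc0 //; apply: sL.
- split; last by rewrite detE {1}psE -mul_polyC rmorphM mulrA.
    by have := size_D; rewrite psE size_scale // size_prod_XsubC => -[].
  by rewrite mulf_neq0.
move=> x _ [a0 d0 c0' d0'].
have fz x0 i : fv f (pt x0 x) i = 0.
  have h j : mvec T (fv f (pt x0 x)) j = 0 by rewrite hT a0 d0 c0' d0'; elim/forall3: j; rewrite /pt3 /=; ring.
  have : mvec (invmx T) (mvec T (fv f (pt x0 x))) i = 0.
    by rewrite (eq_mvec _ h) /mvec big1 // => j _; rewrite mulr0.
  rewrite mvecM mulVmx // /mvec (bigD1 i) //= big1 ?addr0 ?mxE ?eqxx ?mul1r // => j /negPf ji.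
  by rewrite mxE eq_sym ji mul0r.
(* A common zero x of the four entries would make f vanish on a whole line through b. Finiteness of
   the base locus then yields two proportional points with distinct parameters on that line, against
   the independence of b, E1 and E2. *)
have [Bs hB] := base_finite hf cop.
have /aa_pigeonhole [t [t' [be [tt _ [c1 c10 h1] [c2 c20 h2]]]]] :
   aa (fun t => exists2 b', b' \in Bs & exists2 c0, c0 != 0 & forall i, pt t x i = c0 * pt3 b'.1.1 b'.1.2 b'.2 i).
  apply: aaT => t; apply: hB => [|i]; last exact: fz.
  have [//|z] := exists_neq0 (pt t x); case/eqP: det0.
  transitivity (dot eps2 (pt t x)); first by rewrite dot_cross /det3 /pt; ring.
  by rewrite /dot big1 // => i _; rewrite z mulr0.
have par i j : pt t x i * pt t' x j = pt t x j * pt t' x i by rewrite !h1 !h2; ring.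
have d0t : t - t' != 0 by rewrite subr_eq0.
case/eqP: det0; apply: (mulfI d0t); rewrite mulr0.
have cr i : cross (pt t x) (pt t' x) i = 0.
  by elim/forall3: i; rewrite /cross [pt3]lock /= -lock /pt3 /=; rewrite par subrr.
transitivity (dot (cross (pt t x) (pt t' x)) (fun i => - E1 i)).
  by rewrite dot_cross /det3 /pt; ring.
by rewrite /dot big1 // => i _; rewrite cr mul0r.
Qed.

End NormalForm.

(** * Proof of the bound *)

Section CubicLength.
Variable K : numClosedFieldType.

Lemma comp_homog n k d e (p : {mpoly K[n]}) (lq : n.-tuple {mpoly K[k]}) :
  p \is d.-homog -> (forall i, tnth lq i \is e.-homog) -> p \mPo lq \is (e * d).-homog.
Proof.
move=> hp hq; rewrite /comp_mpoly /mmap big_seq; apply: rpred_sum => m mp.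
rewrite mul_mpolyC rpredZ //; have <- : mdeg m = d by exact: (dhomog_mf hp mp).
rewrite mdegE big_distrr /= /mmap1.
apply: (big_ind2 (fun (r : {mpoly K[k]}) s => r \is s.-homog)) => [|r s r' s' h h'|i _].
- exact: dhomog1.
- exact: dhomogM.
exact: dhomogMn.
Qed.

Lemma noether_word_homog (A : nat -> 'M[K]_3) k : homog_triple (2 ^ k) (noether_word A k).
Proof.
have hl (M : 'M[K]_3) : homog_triple 1 (lin_map M).
  by move=> i; rewrite tnth_mktuple; apply: rpred_sum => j _; rewrite rpredZ // dhomogX; apply/eqP/mdeg1.
have hX i : ('X_i : {mpoly K[3]}) \is 1.-homog by rewrite dhomogX; apply/eqP/mdeg1.
have hs : homog_triple 2 (@cremona K).
  by elim/forall3; rewrite (tnth_nth 0) /=; apply: (@dhomogM _ _ _ 1 _ 1).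
elim: k => [|k IH]; first exact: hl.
move=> i; rewrite /= /ratmap_comp !tnth_mktuple -[(2 ^ _)%N]mul1n; apply: comp_homog (hl _).
by rewrite expnS; apply: comp_homog.
Qed.

Lemma wv_left A n (M : 'M[K]_3) v :
  wv (fun i => if i == 0 then M *m A 0 else A i)%N n v =1 mvec M (wv A n v).
Proof. by elim: n v => [|n IH] v i /=; [rewrite mvecM|rewrite IH]. Qed.

Lemma generic_vanish (b E1 E2 : 'I_3 -> K) d (p : {mpoly K[3]}) :
  det3 b E1 E2 != 0 -> p \is d.-homog ->
  aa (fun y => aa (fun x0 => p.@[fun j => x0 * b j + y * E1 j + 1 * E2 j] = 0)) -> p = 0.
Proof.
move=> d0 hp h; apply: (vanish_on_chart d0 hp) => x0 y.
pose hh j : {poly {poly K}} := 'X * CC (b j) + 'X%:P * CC (E1 j) + CC (E2 j).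
have hE s t : (mmap (@CC K) hh p).[t%:P].[s] = p.@[fun j => t * b j + s * E1 j + 1 * E2 j].
  by rewrite mmap_CC_horner; apply: meval_eq => j; rewrite /hh !horner2E hornerX mul1r.
rewrite -hE (_ : mmap _ _ _ = 0) ?horner0 //.
apply: aa_bipoly0; apply: aa_mono h => s; apply: aa_mono => t; by rewrite hE.
Qed.

Section CoprimeCubic.
Variables (f g : triple K) (e : nat).
Hypotheses (hf : homog_triple 3 f) (cop : no_common_factor f) (hg : homog_triple e g).
Hypothesis fgX : forall X i j, fv f (gv g X) i * X j = fv f (gv g X) j * X i.
Hypothesis gfX : forall x i j, gv g (fv f x) i * x j = gv g (fv f x) j * x i.
Hypothesis gf0 : exists x l, gv g (fv f x) l != 0.

Lemma coprime_cubic_word : exists A : nat -> 'M[K]_3,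
  [/\ forall i, (i <= 8)%N -> A i \in unitmx,
      exists i, tnth (noether_word A 8) i != 0 &
      forall i j, tnth f i * tnth (noether_word A 8) j = tnth f j * tnth (noether_word A 8) i].
Proof.
have [b db] := exists_double_point hf cop hg fgX (fg0 hf cop gfX gf0).
have [E1 [_ [i0 cr] tr]] := transversal_point hf cop hg gfX gf0 db.
pose E2 (j : 'I_3) : K := (j == i0)%:R.
have det0 : det3 b E1 E2 != 0.
  rewrite -dot_cross /dot (bigD1 i0) //= big1 ?addr0 /E2 ?eqxx ?mulr1 //.
  by move=> i /negPf ->; rewrite mulr0.
have [q [c [sq sc fE c3E q2E]]] := double_point_normal_form E1 E2 hf db.
have [k w5] : exists k, cross (fun i => (q i)`_2) (fun i => (c i)`_3) k != 0.
  have [|k ck] := tr (fun i => (q i)`_2).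
    move=> i x0; have <- : (c i)`_3 = fv f E1 i by exact: c3E.
    by rewrite -q2E; apply: meval_eq => j; ring.
  by exists k; move: ck; elim/forall3: k; rewrite /cross /pt3 /= !c3E.
have [|D [n [m [WE mn]]]] := @gcd3_field K (cross q c).
  exists k; have [_ h] := W_top sq sc k; apply: contraNneq w5 => z.
  by rewrite -h z coef0.
have [T [a [d [c' [d' [ps [kk [uT [sa sd sc' sd'] [sps kk0 detE] co TE]]]]]]]] :=
  cubic_matrix_form hf cop hg fgX gfX gf0 det0 sq sc fE w5 WE mn.
have cf8 := cfrac_cubic (@Kinf K) sa sd sc' sd' sps kk0 detE co.
have [A uA hA] := cfrac_word cf8.
pose S := (mx3 b E1 E2)^T.
have uS : S \in unitmx by rewrite unitmx_tr mx3_unit.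
(* The coordinate changes in the source ([S]) and in the target ([T]) are absorbed into the last and
   the first matrix, so they cost no letter. *)
pose A1 i := if i == 8 then A 8 *m invmx S else A i.
pose A2 i := (if i == 0 then invmx T *m A1 0 else A1 i)%N.
have uA2 i : (i <= 8)%N -> A2 i \in unitmx.
  move=> i8; rewrite /A2 /A1; case: eqP => _; first by rewrite unitmx_mul unitmx_inv uT uA.
  by case: eqP => _; rewrite ?unitmx_mul ?unitmx_inv ?uS ?andbT uA.
pose pt x0 y := fun j => x0 * b j + y * E1 j + 1 * E2 j.
have Spt x0 y j : mvec S (pt3 x0 y 1) j = pt x0 y j.
  by rewrite /mvec sum3 !mxE /pt3 /= /pt; ring.
have main : aa (fun y => aa (fun x0 => exists2 c0, c0 != 0 & forall i,
    (tnth (noether_word A2 8) i).@[pt x0 y] = c0 * (tnth f i).@[pt x0 y])).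
  apply: aa_mono hA => y; apply: aa_mono => x0 [c0 c00 h]; exists c0 => // i.
  rewrite noether_wordE wv_left.
  have e1 : mvec (invmx S) (pt x0 y) =1 pt3 x0 y 1.
    move=> j; rewrite -(eq_mvec _ (Spt x0 y)) mvecM mulVmx // /mvec (bigD1 j) //=.
    by rewrite big1 ?mxE ?eqxx ?mul1r ?addr0 // => l /negPf lj; rewrite mxE eq_sym lj mul0r.
  have e2 : wv A1 8 (pt x0 y) =1 fun j => c0 * mvec T (fv f (pt x0 y)) j.
    move=> j; rewrite /A1 wv_lin (eq_wv _ _ e1) h; congr (_ * _).
    by rewrite TE.
  rewrite (eq_mvec _ e2) mvecZ mvecM mulVmx //; congr (_ * _).
  rewrite /mvec (bigD1 i) //= big1 ?mxE ?eqxx ?mul1r ?addr0 // => l /negPf li.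
  by rewrite mxE eq_sym li mul0r.
exists A2; split=> //.
- have [j fj] := no_common_factor_neq0 cop.
  case: (boolP [exists i, tnth (noether_word A2 8) i != 0]) => [/existsP //|/existsPn z].
  case/eqP: fj; apply: (generic_vanish det0 (hf j)).
  apply: aa_mono main => y; apply: aa_mono => x0 [c0 c00 h].
  apply: (mulfI c00); rewrite mulr0 -h; have := z j; rewrite negbK => /eqP ->.
  by rewrite meval0.
move=> i j; apply/eqP; rewrite -subr_eq0; apply/eqP.
apply: (@generic_vanish b E1 E2 (3 + 2 ^ 8)%N _ det0).
  by rewrite rpredB // dhomogM // noether_word_homog.
apply: aa_mono main => y; apply: aa_mono => x0 [c0 c00 h].
by rewrite mevalB !mevalM !h; ring.
Qed.

End CoprimeCubic.

Lemma vanish_off (p r : {mpoly K[3]}) : p != 0 -> (forall x, p.@[x] != 0 -> r.@[x] = 0) -> r = 0.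
Proof.
move=> p0 h; apply/eqP; apply: contraT => r0.
have /mpoly_nonvanishing [x] : p * r != 0 by rewrite mulf_neq0.
by rewrite mevalM mulf_eq0 negb_or => /andP [/h ->]; rewrite eqxx.
Qed.

(** The given triple may have common factors. Its coprime representative f' is proportional to it
    off the zero set of a nonzero form, and the identities with g, being polynomial, carry over to
    f' from there. *)
Lemma cubic_noether_length (f : triple K) : birational f -> has_degree f 3 ->
  exists (k : nat) (A : nat -> 'M[K]_3),
    [/\ (k <= 8)%N, (forall i : nat, (i <= k)%N -> A i \in unitmx) &
        ratmap_eq f (noether_word A k)].
Proof.
move=> [rf [g [[[e hg] _] [[_ [kc fgc]] _ fgE] [[_ [lc gfc]] _ gfE]]]] [f' [[_ rf' ff'] hf' cop]].
have [k fk'] := no_common_factor_neq0 cop.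
have fk : tnth f k != 0.
  have [_ [i fi]] := rf; apply: contraNneq fi => z.
  have := ff' i k; rewrite z mul0r => /eqP; rewrite mulf_eq0 (negPf fk') orbF => /eqP.
  by move=> ->.
have prop x : (tnth f k * tnth f' k).@[x] != 0 ->
    exists2 mu, mu != 0 & forall i, fv f x i = mu * fv f' x i.
  rewrite mevalM mulf_eq0 negb_or => /andP [h1 h2].
  exists ((tnth f k).@[x] / (tnth f' k).@[x]); first by rewrite mulf_neq0 ?invr_eq0.
  move=> i; apply: (mulIf h2); rewrite /fv -mevalM ff' mevalM.
  by field.
have kk0 : tnth f k * tnth f' k != 0 by rewrite mulf_neq0.
have tE (h1 h2 : triple K) i x : (tnth (ratmap_comp h1 h2) i).@[x] = (tnth h1 i).@[fun j => (tnth h2 j).@[x]].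
  by rewrite tnth_mktuple comp_mpoly_meval.
have idE i x : (tnth (@ratmap_id K) i).@[x] = x i by rewrite tnth_mktuple mevalXU.
have gfX x i j : gv g (fv f' x) i * x j = gv g (fv f' x) j * x i.
  pose r := (tnth g i \mPo f') * 'X_j - (tnth g j \mPo f') * 'X_i.
  suff r0 : r = 0.
    have := congr1 (meval x) r0; rewrite mevalB !mevalM !comp_mpoly_meval !mevalXU meval0.
    by move/eqP; rewrite subr_eq0 => /eqP.
  apply: (vanish_off kk0) => y /prop [mu mu0 muE].
  rewrite mevalB !mevalM !comp_mpoly_meval !mevalXU; apply: (mulfI (expf_neq0 e mu0)).
  have := congr1 (meval y) (gfE i j); rewrite !mevalM !tE !idE.
  rewrite (meval_homogZ (hg i) muE) (meval_homogZ (hg j) muE) => h.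
  by rewrite mulr0 mulrBr !mulrA h subrr.
have gf0 : exists x l, gv g (fv f' x) l != 0.
  have /mpoly_nonvanishing [x] : (tnth f k * tnth f' k) * tnth (ratmap_comp g f) lc != 0.
    by rewrite mulf_neq0.
  rewrite mevalM mulf_eq0 negb_or => /andP [/prop [mu mu0 muE]].
  rewrite tE (meval_homogZ (hg lc) muE) mulf_eq0 negb_or => /andP [_ h].
  by exists x, lc.
have fgX X i j : fv f' (gv g X) i * X j = fv f' (gv g X) j * X i.
  pose r := (tnth f' i \mPo g) * 'X_j - (tnth f' j \mPo g) * 'X_i.
  suff r0 : r = 0.
    have := congr1 (meval X) r0; rewrite mevalB !mevalM !comp_mpoly_meval !mevalXU meval0.
    by move/eqP; rewrite subr_eq0 => /eqP.
  apply: (vanish_off fgc) => y; rewrite tE => h0.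
  rewrite mevalB !mevalM !comp_mpoly_meval !mevalXU.
  pose Z := fun l => (tnth g l).@[y].
  have fz i' j' : (tnth f i').@[Z] * (tnth f' j').@[Z] = (tnth f j').@[Z] * (tnth f' i').@[Z].
    by rewrite -!mevalM ff'.
  have fy : (tnth f i).@[Z] * y j = (tnth f j).@[Z] * y i.
    by have := congr1 (meval y) (fgE i j); rewrite !mevalM !tE !idE.
  apply: (mulfI h0); rewrite mulr0 mulrBr !mulrA (fz kc i) (fz kc j).
  by rewrite mulrAC fy [X in _ - X]mulrAC subrr.
have [A [uA w0 wE]] := coprime_cubic_word hf' cop hg fgX gfX gf0.
exists 8, A; split=> //; split=> // [|i j].
  by split=> //; exists (2 ^ 8)%N; apply: noether_word_homog.
apply: (mulIf fk').
transitivity (tnth f i * tnth f' k * tnth (noether_word A 8) j); first exact: mulrAC.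
rewrite ff' -mulrA wE mulrA -ff'; exact: mulrAC.
Qed.

End CubicLength.

Theorem mainTheorem19 (R : realType) (f : triple R[i]) :
  birational f -> has_degree f 3 ->
  exists (k : nat) (A : nat -> 'M[R[i]]_3),
    [/\ (k <= 8)%N,
        (forall i : nat, (i <= k)%N -> A i \in unitmx) &
        ratmap_eq f (noether_word A k)].
Proof. exact: cubic_noether_length. Qed.
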